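(* Let $\mu$ be a positive measure on a set $X$ such that $L^2(X,\mu)$ is a separable complex Hilbert space, and let $K$ be an operator on $L^2(X,\mu)$ of rank $n \in \mathbb{N}$ (so $n \geq 1$). If $K$ has increasing spectrum relative to standard compressions, then $K$ admits a standard, multiplicity-free triangularization. Furthermore, there exist a positive integer $m \le 2n+1$ and a partition $\{E_1, E_2, \ldots, E_m\}$ of $X$ into measurable sets such that, relative to the decomposition $L^2(X,\mu) = \bigoplus_{j=1}^m L^2(E_j, \mu|_{E_j})$, the operator $K$ has an upper triangular block-matrix form $K = [K_{i,j}]_{i,j=1}^m$, i.e. $K_{i,j} = 0$ for all $i > j$, where each diagonal block $K_{j,j}$ can be non-zero only when $L^2(E_j, \mu|_{E_j})$ is a one-dimensional space (corresponding to an atom), and whenever $K_{j,j}$ is non-zero, it is (multiplication by) a non-zero eigenvalue of $K$.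
   Context: Operators are bounded linear operators. For a measurable set $E \subseteq X$, the standard projection $P_E$ corresponding to $E$ is the operator on $L^2(X,\mu)$ of multiplication by the characteristic function $\chi_E$; its range, identified with $L^2(E,\mu|_E)$, is called a standard subspace. The block $K_{i,j} : L^2(E_j,\mu|_{E_j}) \to L^2(E_i,\mu|_{E_i})$ is the compression $P_{E_i} K|_{\operatorname{ran} P_{E_j}}$. An operator $T$ on $L^2(X,\mu)$ has increasing spectrum relative to standard compressions if $\sigma(PT|_{\operatorname{ran} P}) \subseteq \sigma(QT|_{\operatorname{ran} Q})$ whenever $P$ and $Q$ are standard projections with $\operatorname{ran} P \subseteq \operatorname{ran} Q$, where $PT|_{\operatorname{ran} P}$ is regarded as an operator on the Hilbert space $\operatorname{ran} P$ and $\sigma$ denotes the spectrum. $M^\infty(X,\mu) = \{M_\phi : \phi \in L^\infty(X,\mu)\}$ is the algebra of all multiplication operators $M_\phi f = \phi f$ on $L^2(X,\mu)$. An operator $T$ admits a standard triangularization if there exist a totally ordered set $\Lambda$ and an increasing family $\{P_\lambda\}_{\lambda\in\Lambda}$ of standard projections such that $\{\operatorname{ran} P_\lambda\}_{\lambda \in \Lambda}$ is a maximal increasing family of standard subspaces (i.e. a maximal totally ordered family, under inclusion, among families of standard subspaces), and all $\operatorname{ran} P_\lambda$ are invariant under $T$. If moreover the closed linear span of $\{P_\lambda\}_{\lambda\in\Lambda}$ in the weak operator topology equals $M^\infty(X,\mu)$, the triangularization is called multiplicity-free. *)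

(* Defs.v *)
From HB Require Import structures.
From mathcomp Require Import all_boot all_order all_algebra.
From mathcomp Require Import ring_quotient generic_quotient.
From mathcomp Require Import all_classical all_reals all_analysis measurable_realfun ess_sup_inf.
From mathcomp Require Import complex.

Set Implicit Arguments.
Unset Strict Implicit.
Unset Printing Implicit Defensive.

Import Order.TTheory GRing.Theory Num.Theory.
Import numFieldTopology.Exports numFieldNormedType.Exports.

Local Open Scope classical_set_scope.
Local Open Scope ring_scope.
Local Open Scope complex_scope.
Local Open Scope quotient_scope.

(* The modulus with values in `R`; the library norm `|z| lies in `R[i]`. *)
Notation modc := Normc.normc.

Section lp_functions.
Context d (X : measurableType d) (R : realType).
Variable mu : {measure set X -> \bar R}.

(* Borel measurability for the product sigma-algebra on `R[i]`, which carries no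
   measurable structure of its own. *)
Definition cmeasurable (f : X -> R[i]) :=
  measurable_fun setT (fun x => complex.Re (f x)) /\
  measurable_fun setT (fun x => complex.Im (f x)).

Definition Lp (p : \bar R) : set (X -> R[i]) :=
  [set f | cmeasurable f /\ finite_norm mu p (fun x => modc (f x))].

Lemma modcE (z : R[i]) : `|z| = (modc z)%:C.
Proof. by case: z. Qed.

Lemma modc_ge0 (z : R[i]) : 0 <= modc z.
Proof. by case: z => a b /=; rewrite sqrtr_ge0. Qed.

Lemma modcD (z w : R[i]) : modc (z + w) <= modc z + modc w.
Proof. by rewrite -lecR rmorphD /= -!modcE ler_normD. Qed.

Lemma measurable_modc (f : X -> R[i]) :
  cmeasurable f -> measurable_fun setT (fun x => modc (f x)).
Proof.
move=> [mr mi]; rewrite (_ : (fun _ => _) =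
  Num.sqrt \o ((fun x => complex.Re (f x) ^+ 2) \+ (fun x => complex.Im (f x) ^+ 2))).
  apply: measurableT_comp; last first.
    by apply: measurable_funD; [exact: (measurable_funX 2 mr)|exact: (measurable_funX 2 mi)].
  by apply: continuous_measurable_fun; exact: sqrt_continuous.
by apply/funext => x /=; case: (f x).
Qed.


Lemma le_Lnorm2 (f g : X -> R) : measurable_fun setT f -> measurable_fun setT g ->
  {ae mu, forall x, `|f x| <= `|g x|} ->
  ('N[mu]_2%:E[EFin \o f] <= 'N[mu]_2%:E[EFin \o g])%E.
Proof.
move=> mf mg fg; rewrite unlock /=.
apply: gt0_ler_poweR; rewrite ?invr_ge0// ?in_itv/= ?leey ?andbT//;
  try by apply: integral_ge0 => x _; rewrite lee_fin powR_ge0.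
have m (h : X -> R) : measurable_fun setT h ->
    measurable_fun [set: X] (fun x => (`|h x| `^ 2)%:E).
  move=> mh; apply/measurable_EFinP; apply: (@measurableT_comp _ _ _ _ _ _ (@powR R ^~ 2)) => //.
  exact: measurableT_comp.
apply: ae_ge0_le_integral => //; try by move=> x _; rewrite lee_fin powR_ge0.
- exact: m.
- exact: m.
- by apply: filterS fg => x fgx _; rewrite lee_fin ge0_ler_powR// nnegrE.
Qed.

Lemma eq_Lnorm2 (f g : X -> R) : measurable_fun setT f -> measurable_fun setT g ->
  f = g %[ae mu] -> 'N[mu]_2%:E[EFin \o f]%E = 'N[mu]_2%:E[EFin \o g]%E.
Proof.
move=> mf mg fg; apply/eqP; rewrite eq_le !le_Lnorm2//.
- by apply: filterS fg => x ->.
- by apply: filterS fg => x ->.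
Qed.

Definition sqint : {pred X -> R[i]} := mem (Lp 2%:E).

Lemma cmeasurableD (f g : X -> R[i]) :
  cmeasurable f -> cmeasurable g -> cmeasurable (f + g).
Proof.
move=> [fr fi] [gr gi]; split.
- rewrite (_ : (fun _ => _) =
    (fun x => complex.Re (f x)) \+ (fun x => complex.Re (g x))).
    exact: measurable_funD.
  by apply/funext => x /=; rewrite -[(f + g) x]/(f x + g x); case: (f x) (g x) => ? ? [].
- rewrite (_ : (fun _ => _) =
    (fun x => complex.Im (f x)) \+ (fun x => complex.Im (g x))).
    exact: measurable_funD.
  by apply/funext => x /=; rewrite -[(f + g) x]/(f x + g x); case: (f x) (g x) => ? ? [].
Qed.

Lemma cmeasurableM (f g : X -> R[i]) :
  cmeasurable f -> cmeasurable g -> cmeasurable (fun x => f x * g x).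
Proof.
move=> [fr fi] [gr gi]; split.
- rewrite (_ : (fun _ => _) =
    ((fun x => complex.Re (f x)) \* (fun x => complex.Re (g x))) \-
    ((fun x => complex.Im (f x)) \* (fun x => complex.Im (g x)))).
    by apply: measurable_funB; exact: measurable_funM.
  by apply/funext => x /=; case: (f x) (g x) => ? ? [].
- rewrite (_ : (fun _ => _) =
    ((fun x => complex.Re (f x)) \* (fun x => complex.Im (g x))) \+
    ((fun x => complex.Im (f x)) \* (fun x => complex.Re (g x)))).
    by apply: measurable_funD; exact: measurable_funM.
  by apply/funext => x /=; case: (f x) (g x) => ? ? [].
Qed.

Lemma cmeasurable_cst (z : R[i]) : cmeasurable (cst z).
Proof. by split; exact: measurable_cst. Qed.

Lemma Lnorm2_modcD (f g : X -> R[i]) : cmeasurable f -> cmeasurable g ->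
  ('N[mu]_2%:E[EFin \o (fun x => modc ((f + g)%R x))] <=
   'N[mu]_2%:E[EFin \o (fun x => modc (f x))] +
   'N[mu]_2%:E[EFin \o (fun x => modc (g x))])%E.
Proof.
move=> mf mg.
apply: (@le_trans _ _
  ('N[mu]_2%:E[EFin \o ((fun x => modc (f x)) \+ (fun x => modc (g x)))%R])%E).
  apply: le_Lnorm2.
  - exact/measurable_modc/cmeasurableD.
  - by apply: measurable_funD; exact: measurable_modc.
  - apply/aeW => x /=; rewrite !ger0_norm ?modc_ge0 ?addr_ge0 ?modc_ge0//.
    exact: modcD.
by apply: eminkowski; [exact: measurable_modc..|rewrite lee_fin ler1n].
Qed.

Lemma Lnorm2_modcZ (z : R[i]) (f : X -> R[i]) : Lp 2%:E f ->
  'N[mu]_2%:E[EFin \o (fun x => modc ((z *: f) x))]%E =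
  ((modc z)%:E * 'N[mu]_2%:E[EFin \o (fun x => modc (f x))])%E.
Proof.
move=> [mf nf].
have mF : (fun x => modc (f x)) \in Lfun mu 2%:E.
  rewrite inE; apply/andP; split; rewrite inE//=; exact: measurable_modc.
have := LnormZ (Lfun_Sub (lee1n 2 : (1 <= 2%:E :> \bar R)%E) mF) (modc z).
rewrite (ger0_norm (modc_ge0 _)) => <-; congr Lnorm; apply/funext => x /=.
by congr EFin; rewrite -[(z *: f) x]/(z * f x) Normc.normcM.
Qed.

Lemma sqint_submod_closed : submod_closed sqint.
Proof.
split => [|z f g]; rewrite !inE.
  split; first exact: cmeasurable_cst.
  rewrite /finite_norm (_ : _ \o _ = cst 0) ?Lnorm0 ?eqe ?pnatr_eq0//.
  by apply/funext => x /=; rewrite expr0n addr0 sqrtr0.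
move=> [mf nf] [mg ng]; have mzf : cmeasurable (z *: f).
  by apply: cmeasurableM => //; exact: cmeasurable_cst.
split; first exact: cmeasurableD.
apply: le_lt_trans (Lnorm2_modcD _ _) _ => //.
by rewrite lte_add_pinfty// Lnorm2_modcZ// lte_mul_pinfty// lee_fin modc_ge0.
Qed.

HB.instance Definition _ :=
  GRing.isSubmodClosed.Build R[i] (X -> R[i]) sqint sqint_submod_closed.

Record sqfun := SqFun { sqval :> X -> R[i]; sqvalP : sqval \in sqint }.

HB.instance Definition _ := [isSub for sqval].
HB.instance Definition _ := [Choice of sqfun by <:].
HB.instance Definition _ := [SubChoice_isSubLmodule of sqfun by <:].

Lemma sqvalZ (z : R[i]) (f : sqfun) x : (z *: f : sqfun) x = z * f x.
Proof. by []. Qed.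

(* L^2(X, mu) is the quotient of the square-integrable functions by the functions
   vanishing almost everywhere. *)
Definition nullfun : {pred sqfun} := mem [set f : sqfun | f = cst 0 %[ae mu]].

Lemma nullfun_zmod_closed : zmod_closed nullfun.
Proof.
split; rewrite ?inE/=; first exact: aeW.
move=> f g /[!inE] /= f0 g0; apply: filterS2 f0 g0 => x /(_ I) fx /(_ I) gx _.
by rewrite -[LHS]/(f x - g x) fx gx subrr.
Qed.

HB.instance Definition _ :=
  GRing.isZmodClosed.Build sqfun nullfun nullfun_zmod_closed.

Definition L2 : Type := Quotient.quot nullfun.

HB.instance Definition _ := Choice.on L2.
HB.instance Definition _ := EqQuotient.on L2.
HB.instance Definition _ := GRing.Zmodule.on L2.

(* A chosen representative. *)
Definition L2fun (f : L2) : sqfun := repr f.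

Lemma L2funK (f : L2) : f = \pi_L2 (L2fun f).
Proof. by rewrite reprK. Qed.

Lemma L2_piP (f g : sqfun) :
  reflect (f = g %[ae mu]) (\pi_L2 f == \pi_L2 g).
Proof.
apply: (iffP idP); rewrite -Quotient.idealrBE inE /=.
- apply: filterS => x /(_ I) h _; apply/eqP; rewrite -subr_eq0; apply/eqP.
  exact: h.
- apply: filterS => x /(_ I) fgx _.
  by rewrite -[LHS]/(f x - g x) fgx subrr.
Qed.

Lemma L2fun_pi (f : sqfun) : L2fun (\pi_L2 f) = f %[ae mu].
Proof. by apply/L2_piP; rewrite reprK. Qed.

Lemma L2_eq0P (f : L2) : reflect (L2fun f = cst 0 %[ae mu]) (f == 0).
Proof.
have -> : (f == 0) = (\pi_L2 (L2fun f) == \pi_L2 0) by rewrite -L2funK raddf0.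
apply: (iffP (L2_piP _ _)).
- by apply: filterS => x /(_ I) -> _.
- by apply: filterS => x /(_ I) -> _.
Qed.

Definition L2scale (z : R[i]) (f : L2) : L2 := \pi_L2 (z *: L2fun f).

Lemma L2_piZ z (f : sqfun) : L2scale z (\pi_L2 f) = \pi_L2 (z *: f).
Proof.
apply/eqP/L2_piP; apply: filterS (L2fun_pi f) => x /(_ I) e _.
by rewrite !sqvalZ e.
Qed.

Lemma L2_piD (f g : sqfun) : \pi_L2 (f + g) = \pi_L2 f + \pi_L2 g.
Proof. exact: raddfD. Qed.

Lemma L2scaleA a b f : L2scale a (L2scale b f) = L2scale (a * b) f.
Proof. by rewrite (L2funK f) !L2_piZ scalerA. Qed.

Lemma L2scale1 : left_id 1 L2scale.
Proof. by move=> f; rewrite (L2funK f) !L2_piZ scale1r. Qed.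

Lemma L2scaleDr : right_distributive L2scale +%R.
Proof.
move=> a f g; rewrite (L2funK f) (L2funK g).
by rewrite -L2_piD !L2_piZ scalerDr L2_piD.
Qed.

Lemma L2scaleDl f : {morph L2scale^~ f : a b / a + b}.
Proof. by move=> a b; rewrite (L2funK f) !L2_piZ scalerDl L2_piD. Qed.

HB.instance Definition _ :=
  GRing.Zmodule_isLmodule.Build R[i] L2 L2scaleA L2scale1 L2scaleDr L2scaleDl.

Lemma L2funD (f g : L2) : L2fun (f + g) = L2fun f + L2fun g %[ae mu].
Proof.
apply: filterS (L2fun_pi (L2fun f + L2fun g)) => x /(_ I) + _.
by rewrite L2_piD -!L2funK.
Qed.

Lemma L2funZ z (f : L2) : L2fun (z *: f) = z *: (L2fun f : X -> R[i]) %[ae mu].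
Proof. by apply: filterS (L2fun_pi (z *: L2fun f)) => x /(_ I) + _. Qed.

Lemma sqfun_cmeasurable (f : sqfun) : cmeasurable f.
Proof. by have := sqvalP f; rewrite inE => -[]. Qed.

Lemma sqfun_Lnorm_fin (f : sqfun) :
  'N[mu]_2%:E[EFin \o (fun x => modc (f x))]%E \is a fin_num.
Proof.
have [_] : Lp 2%:E f by have := sqvalP f; rewrite inE.
by rewrite /finite_norm ge0_fin_numE ?Lnorm_ge0.
Qed.

Definition L2norm (f : L2) : R :=
  fine 'N[mu]_2%:E[EFin \o (fun x => modc (L2fun f x))]%E.

Lemma L2normE (f : L2) :
  ((L2norm f)%:E = 'N[mu]_2%:E[EFin \o (fun x => modc (L2fun f x))])%E.
Proof. by rewrite fineK// sqfun_Lnorm_fin. Qed.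

Lemma ler_L2normD f g : (L2norm (f + g))%:C <= (L2norm f)%:C + (L2norm g)%:C.
Proof.
rewrite -rmorphD lecR -lee_fin EFinD !L2normE.
apply: le_trans (Lnorm2_modcD _ _); try exact: sqfun_cmeasurable.
rewrite (eq_Lnorm2 _ _ (g := fun x => modc ((L2fun f + L2fun g) x)))//.
- exact/measurable_modc/sqfun_cmeasurable.
- by apply/measurable_modc/cmeasurableD; exact: sqfun_cmeasurable.
- by apply: filterS (L2funD f g) => x /(_ I) -> _.
Qed.

Lemma L2normZ (z : R[i]) f : (L2norm (z *: f))%:C = `|z| * (L2norm f)%:C.
Proof.
rewrite modcE -rmorphM; congr (_%:C); apply: EFin_inj; rewrite EFinM !L2normE.
rewrite -Lnorm2_modcZ; last by have := sqvalP (L2fun f); rewrite inE.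
apply: eq_Lnorm2.
- exact/measurable_modc/sqfun_cmeasurable.
- by apply/measurable_modc/cmeasurableM;
    [exact: cmeasurable_cst|exact: sqfun_cmeasurable].
- by apply: filterS (L2funZ z f) => x /(_ I) -> _.
Qed.

Lemma L2norm_eq0 f : (L2norm f)%:C = 0 -> f = 0.
Proof.
move=> [f0]; have : (L2norm f)%:E = 0%:E by rewrite f0.
rewrite L2normE => n0.
have mf : measurable_fun setT (EFin \o (fun x => modc (L2fun f x))).
  by apply/measurable_EFinP/measurable_modc/sqfun_cmeasurable.
apply/eqP/L2_eq0P; apply: filterS (Lnorm_eq0_eq0 mf _ n0) => //.
by move=> x /(_ I) [/Normc.eq0_normc].
Qed.

HB.instance Definition _ :=
  Lmodule_isNormed.Build R[i] L2 ler_L2normD L2normZ L2norm_eq0.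

(* The class of `h` when `h` is square-integrable, and 0 otherwise. *)
Definition L2class (h : X -> R[i]) : L2 := \pi_L2 (insubd (0 : sqfun) h).

Lemma L2classK (h : X -> R[i]) : Lp 2%:E h -> L2fun (L2class h) = h %[ae mu].
Proof.
move=> hL; apply: filterS (L2fun_pi (insubd (0 : sqfun) h)) => x /(_ I) -> _.
by rewrite [sqval _]insubdK// inE.
Qed.

(* M_phi; only meaningful for `phi` in L^oo, see `mulopE`. *)
Definition mulop (phi : X -> R[i]) (f : L2) : L2 :=
  L2class (fun x => phi x * L2fun f x).

Lemma Linfty_bounded (phi : X -> R[i]) : Lp +oo phi ->
  exists M : R, {ae mu, forall x, modc (phi x) <= M}.
Proof.
move=> [mphi]; rewrite /finite_norm unlock /Lnorm; case: ifPn => [_|].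
  rewrite (_ : _ \o _ = EFin \o (fun x => modc (phi x))).
    exact: ess_supr_bounded.
  by apply/funext => x /=; rewrite ger0_norm// modc_ge0.
rewrite -leNgt => mu0 _; exists 0; exists setT; split => //.
by apply/eqP; rewrite eq_le mu0 measure_ge0.
Qed.

Lemma Linfty_mul (phi f : X -> R[i]) : Lp +oo phi -> Lp 2%:E f ->
  Lp 2%:E (fun x => phi x * f x).
Proof.
move=> pL fL; have [M phiM] := Linfty_bounded pL.
have mpf : cmeasurable (fun x => phi x * f x).
  by apply: cmeasurableM; [case: pL|case: fL].
split => //; apply: (@le_lt_trans _ _
   'N[mu]_2%:E[EFin \o (fun x => modc ((M%:C *: f) x))]%E).
  apply: le_Lnorm2; [exact: measurable_modc| |].
    by apply/measurable_modc/cmeasurableM; [exact: cmeasurable_cst|case: fL].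
  apply: filterS phiM => x pM; rewrite !ger0_norm ?modc_ge0//.
  rewrite -[(M%:C *: f) x]/(M%:C * f x) !Normc.normcM ler_wpM2r ?modc_ge0//.
  by rewrite (le_trans pM)//= expr0n addr0 sqrtr_sqr ler_norm.
rewrite Lnorm2_modcZ// lte_mul_pinfty ?lee_fin ?modc_ge0//.
by case: fL.
Qed.

Lemma mulopE (phi : X -> R[i]) (f : L2) : Lp +oo phi ->
  L2fun (mulop phi f) = (fun x => phi x * L2fun f x) %[ae mu].
Proof.
move=> pL; apply/L2classK/Linfty_mul => //.
by have := sqvalP (L2fun f); rewrite inE.
Qed.

Definition stdproj (E : set X) : L2 -> L2 := mulop (fun x => (\1_E x)%:C).

Lemma Linfty_indic (E : set X) : measurable E -> Lp +oo (fun x => (\1_E x)%:C).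
Proof.
move=> mE; split; first by split => //=; exact: measurable_indic.
rewrite /finite_norm unlock /Lnorm; case: ifPn => // _.
apply: (@le_lt_trans _ _ 1%E); last by rewrite ltry.
apply/ess_supP/aeW => x /=; rewrite lee_fin indicE.
by case: (x \in E); rewrite ?(expr1n, expr0n) addr0 ?sqrtr1 ?sqrtr0 ?normr1 ?normr0.
Qed.

Definition cintegral (h : X -> R[i]) : R[i] :=
  (\int[mu]_x complex.Re (h x)) +i* (\int[mu]_x complex.Im (h x)).

(* Linear in the first argument. *)
Definition L2inner (f g : L2) : R[i] :=
  cintegral (fun x => L2fun f x * (L2fun g x)^*%C).

(* The matrix coefficients of `A`; they induce the weak operator topology. *)
Definition coefficients (A : L2 -> L2) :
    {ptws (L2 * L2) -> (R[i] : numFieldType)} :=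
  fun fg => L2inner (A fg.1) fg.2.

End lp_functions.

Definition lin_span (K : pzRingType) (V : lmodType K) (S : set V) : set V :=
  [set v | exists n (c : 'I_n -> K) (s : 'I_n -> V),
    (forall i, S (s i)) /\ v = \sum_(i < n) c i *: s i].

Definition has_dim (K : pzRingType) (V : lmodType K) (S : set V) (n : nat) :=
  exists b : 'I_n -> V,
    (forall c : 'I_n -> K, \sum_(i < n) c i *: b i = 0 -> forall i, c i = 0) /\
    S = lin_span (range b).

Section operators.
Context (R : realType) (H : normedModType R[i]).

(* `A` restricts to a bounded linear operator of the subspace `V` into itself;
   its values outside `V` are irrelevant. *)
Definition bounded_operator_on (V : set H) (A : H -> H) :=
  [/\ forall f, V f -> V (A f),
      forall (c : R[i]) f g, V f -> V g -> A (c *: f + g) = c *: A f + A g &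
      exists M : R, forall f, V f -> `|A f| <= M%:C * `|f| ].

Definition bounded_operator := bounded_operator_on setT.

(* The spectrum of `A` regarded as an operator on the space `V`; it is empty
   when `V` is the zero space. *)
Definition spectrum_on (V : set H) (A : H -> H) : set R[i] :=
  [set z | ~ exists2 B : H -> H, bounded_operator_on V B &
    forall f, V f -> B (A f - z *: f) = f /\ A (B f) - z *: B f = f].

Definition is_eigenvalue (A : H -> H) (z : R[i]) :=
  exists2 f : H, f != 0 & A f = z *: f.

End operators.

Arguments mulop {d X R} mu phi f.
Arguments stdproj {d X R} mu E f.

Section standard.
Context d (X : measurableType d) (R : realType).
Variable mu : {measure set X -> \bar R}.

Local Notation L2 := (L2 mu).
Local Notation P := (stdproj mu).

Definition separable_L2 := exists2 D : set L2, countable D & dense D.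

Definition standard_projection : set (L2 -> L2) := [set P E | E in measurable].

Definition standard_subspace : set (set L2) :=
  [set range Q | Q in standard_projection].

Definition increasing_spectrum (T : L2 -> L2) :=
  forall Q Q' : L2 -> L2, standard_projection Q -> standard_projection Q' ->
    range Q `<=` range Q' ->
    spectrum_on (range Q) (Q \o T) `<=` spectrum_on (range Q') (Q' \o T).

Definition maximal_standard_chain (C : set (set L2)) :=
  [/\ C `<=` standard_subspace, total_on C subset &
      forall C' : set (set L2), C' `<=` standard_subspace ->
        total_on C' subset -> C `<=` C' -> C' = C].

Definition standard_triangularization (T : L2 -> L2)
    (disp : Order.disp_t) (L : orderType disp) (Q : L -> L2 -> L2) :=
  [/\ forall l, standard_projection (Q l),
      forall l l', (l <= l')%O -> range (Q l) `<=` range (Q l'),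
      maximal_standard_chain (range (fun l => range (Q l))) &
      forall l f, range (Q l) f -> range (Q l) (T f)].

(* The closed linear span inside the bounded operators, hence the restriction
   to bounded operators of the closure taken in the space of all maps. *)
Definition wot_closed_span (S : set (L2 -> L2)) : set (L2 -> L2) :=
  [set A | bounded_operator A /\
    closure (lin_span S : set (initial_topology (@coefficients _ _ _ mu))) A].

Definition Minfty : set (L2 -> L2) := [set mulop mu phi | phi in Lp mu +oo].

Definition multiplicity_free (I : Type) (Q : I -> L2 -> L2) :=
  wot_closed_span (range Q) = Minfty.

(* The block `ran P_F -> ran P_E` of `T` vanishes. *)
Definition block_eq0 (T : L2 -> L2) (E F : set X) :=
  forall f, range (P F) f -> P E (T f) = 0.

Definition is_atom (A : set X) :=
  [/\ measurable A, (0 < mu A)%E &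
      forall B, measurable B -> B `<=` A -> mu B = 0%E \/ mu (A `\` B) = 0%E].

End standard.

(* Main.v *)
Require Import Defs.
From HB Require Import structures.
From mathcomp Require Import all_boot all_order all_algebra.
From mathcomp Require Import boolp.

(* Write K f = sum_i <f, g_i> b_i, so that K has the kernel
   k(x, y) = <u(x), v(y)> with u(x) = (b_i(x)) and v(y) = (conj g_i(y)).
   Increasing spectrum confines the nonzero eigenvalues of every compression to
   the finite spectrum of K, hence traces of powers of compressions take finitely
   many values. Compress to unions of small cells around points x_0, ..., x_r:
   deleting the cell of a non-atomic x_i eventually does not change the trace of
   the (r+1)-st power, and polarization, followed by the Lebesgue limit along
   the cells, makes k(x_0, x_1) ... k(x_r, x_0) vanish when x_0, ..., x_r is a
   chordless cycle; if all the points are atoms, a finite matrix argument gives the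
   same. So the relation k(x, y) != 0 has no cycles besides loops at atoms, and a
   single change of basis makes all the rank one matrices v(x)^T u(x)
   triangular. The position of v(x) in the flag, together with the presence of a
   nonzero diagonal entry, gives a label in {0, ..., 2n} that triangularizes K.

   For the first part, refine the label by binary digits recording membership in a
   countable generating family of sets. The sets on which the refined code is below
   a bound form a chain; extend it to a maximal one by Zorn's lemma. A functional
   that is a finite sum of matrix coefficients and vanishes on this chain vanishes
   on all multiplication operators, because the chain generates the sigma-algebra
   up to null sets; conversely, weak limits of combinations of projections
   commute with M^oo, which is its own commutant. *)

Set Implicit Arguments.
Unset Strict Implicit.
Unset Printing Implicit Defensive.

Import Order.TTheory GRing.Theory Num.Theory.

Local Open Scope ring_scope.

(** * Cycles in finite relations and triangular vectors *)

(** Elements of L^2 have no values at points, while the combinatorics needs them. The cells are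
    therefore cut out by rational level sets of the chosen representatives of a dense sequence that
    contains the [b i] and [g i]. These representatives vary little on small cells around every
    point, so cycles are excluded at all regular points at once, without exceptional null sets in
    powers of X. Points that no cell separates are identified.

    The equality of traces has to be exact before the limit, because it is then divided by the
    product of the cell measures, which tends to 0. This is why it matters that the traces lie in a
    finite set: a null sequence in a finite set is eventually 0.

    The bound 2n+1 counts the n+1 positions in a flag of C^n, each of the n nonzero ones split in
    two by the presence of a loop. Members of the maximal chain are invariant whatever Zorn's lemma
    selects: a standard subspace comparable with all label segments is invariant, since a nonzero
    diagonal block has dimension one. *)

(** Shorten the cycle as long as possible: a repeated vertex or a chord yields a strictly shorter
    cycle. Two distinct vertices are carried along so that the process does not end in a mere
    loop. *)
Lemma chordless_cycle (T : eqType) (e : rel T) (s : seq T) (x y : T) :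
  cycle e s -> x \in s -> y \in s -> x != y ->
  exists t : seq T, [/\ uniq t, (1 < size t)%N, cycle e t &
    {in t &, forall a b, e a b -> a != b -> b = next t a}].
Proof.
elim: (size s).+1 {-2}s x y (ltnSn (size s)) => // m IH {}s x y.
rewrite ltnS => sm cs xs ys xy.
have sub (t : seq T) a b : cycle e t -> (size t < size s)%N ->
    a \in t -> b \in t -> a != b ->
    exists t : seq T, [/\ uniq t, (1 < size t)%N, cycle e t &
    {in t &, forall a b, e a b -> a != b -> b = next t a}].
  by move=> ct ts; apply: IH => //; exact: leq_trans ts sm.
have [us|/negP nus] := boolP (uniq s); last first.
  have [z zs] : exists z, count_mem z s != (z \in s).
    by apply/not_existsP => H; apply: nus; apply: count_mem_uniq => z; apply/eqP/negPn/negP/H.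
  have {}zs : (1 < count_mem z s)%N.
    have := zs; rewrite -has_pred1 has_count.
    by case: (count_mem z s) => [|[|]].
  have zins : z \in s by rewrite -has_pred1 has_count ltnW.
  have [i p ip] := rot_to zins.
  have cp : cycle e (z :: p) by rewrite -ip rot_cycle.
  have sE : s =i z :: p by move=> u; rewrite -ip mem_rot.
  have szp : size s = (size p).+1 by rewrite -(size_rot i) ip.
  have zp : z \in p.
    move: zs; have /permP <- : perm_eq (rot i s) s by rewrite perm_rot.
    by rewrite ip /= eqxx add1n ltnS -has_count has_pred1.
  case/splitPr: p / zp cp sE szp {ip} => p1 p2 cp sE szp.
  have := cp; rewrite /= rcons_cat cat_path /= => /and3P[e1 e2 e3].
  have c1 : cycle e (z :: p1) by rewrite /= rcons_path e1.
  have c2 : cycle e (z :: p2) by [].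
  (* Cutting at the repeated [z] gives two shorter cycles through [z]; at least one of them keeps a
     vertex other than [z]. *)
  have [t [a [at_ az]]] : exists t a, [/\ a \in t, a != z & t = z :: p1 \/ t = z :: p2].
    have [a [as_ az]] : exists a, a \in s /\ a != z.
      by have [xz|xz] := eqVneq x z; [exists y; rewrite -xz eq_sym|exists x].
    move: as_; rewrite sE in_cons (negbTE az) /= mem_cat in_cons (negbTE az) /=.
    by case/orP => ap; [exists (z :: p1)|exists (z :: p2)]; exists a; split=> //;
      rewrite ?in_cons ?ap ?orbT; auto.
  move=> tE; apply: (sub t a z) => //.
  - by case: tE => ->.
  - by rewrite szp size_cat /=; case: tE => -> /=; rewrite ltnS ?addnS ltnS ?leq_addr ?leq_addl.
  - by case: tE => ->; rewrite in_cons eqxx.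
have [|/negP H] := boolP [forall i : 'I_(size s), forall j : 'I_(size s), 
    (e (nth x s i) (nth x s j) && (nth x s i != nth x s j)) ==>
      (nth x s j == next s (nth x s i))].
  move=> /forallP H; exists s; split => //.
    case: s xs ys {sm cs us sub H} => [|u [|v s]] //; rewrite !inE => /eqP xu /eqP yu.
    by move: xy; rewrite xu yu eqxx.
  move=> a b as_ bs eab ab.
  have := H (Ordinal (etrans (index_mem a s) as_)).
  move=> /forallP/(_ (Ordinal (etrans (index_mem b s) bs))) /=.
  by rewrite !nth_index// eab ab /= => /eqP.
have [a [b [as_ bs eab ab nb]]] : exists a b, [/\ a \in s, b \in s, e a b, a != b & b != next s a].
  apply/not_existsP => H'; apply: H; apply/forallP => i; apply/forallP => j.
  apply/implyP => /andP[eij nij]; apply/negPn/negP => nn; apply: (H' (nth x s i)).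
  by exists (nth x s j); split; rewrite ?mem_nth.
have [i p ip] := rot_to bs.
have ap : a \in p.
  by have := as_; rewrite -(mem_rot i) ip in_cons (negbTE ab).
have := cs; rewrite -(rot_cycle i) ip => cp.
have szp : size s = (size p).+1 by rewrite -(size_rot i) ip.
rewrite -(next_rot i) // ip in nb; move: us; rewrite -(rot_uniq i) ip => us.
case/splitPr: p / ap cp szp nb us {ip} => p1 p2 cp szp nb us.
have := cp; rewrite /= rcons_cat cat_path /= => /and3P[e1 e2 e3].
(* The chord from [a] to [b] closes the arc from [b] to [a]. The arc misses [p2], which is nonempty
   because [b] is not the successor of [a]. *)
apply: (sub (b :: rcons p1 a) b a).
- by rewrite /= !rcons_path last_rcons e1 e2.
- rewrite szp size_cat /= size_rcons addnS !ltnS -[X in (X < _)%N]addn0 ltn_add2l.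
  case: p2 nb us {cp e3 szp} => // nb us; move: nb; rewrite cats1.
  rewrite cats1 in us.
  have us' : uniq (rot (size p1).+1 (b :: rcons p1 a)) by rewrite rot_uniq.
  rewrite -(next_rot (size p1).+1)//.
  by rewrite -rcons_cons -cats1 (rot_size_cat (b :: p1)) /= !eqxx.
- by rewrite in_cons eqxx.
- by rewrite in_cons mem_rcons in_cons eqxx orbT.
- by rewrite eq_sym.
Qed.

Definition reaches (T : Type) (e : rel T) (x y : T) :=
  exists2 p, path e x p & last x p = y.

Lemma reaches_trans (T : Type) (e : rel T) x y z :
  reaches e x y -> reaches e y z -> reaches e x z.
Proof.
move=> [p xp <-] [q yq <-]; exists (p ++ q); last by rewrite last_cat.
by rewrite cat_path xp.
Qed.

Lemma reaches1 (T : Type) (e : rel T) x y : e x y -> reaches e x y.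
Proof. by move=> exy; exists [:: y] => //=; rewrite exy. Qed.

Lemma reaches_sub (T : Type) (e e' : rel T) x y :
  subrel e e' -> reaches e x y -> reaches e' x y.
Proof. by move=> ee' [p xp <-]; exists p => //; apply: sub_path xp. Qed.

(** * Simultaneous triangularization of rank one maps *)

Section rank_one_families.
Variable F : fieldType.

(** The family may be infinite, so its span is taken as a matrix of maximal rank among those
    contained in every upper bound of the family; adjoining a further [w] cannot raise this rank. *)
Lemma span_pred n (P : 'rV[F]_n -> Prop) : exists B : 'M[F]_n,
  (forall w, P w -> (w <= B)%MS) /\
  (forall C : 'M_n, (forall w, P w -> (w <= C)%MS) -> (B <= C)%MS).
Proof.
pose good (B : 'M[F]_n) :=
  forall C : 'M_n, (forall w, P w -> (w <= C)%MS) -> (B <= C)%MS.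
have [m [[B [gB rB]] mmax]] : exists m, (exists B, good B /\ \rank B = m) /\
    forall m', (exists B, good B /\ \rank B = m') -> (m' <= m)%N.
  have ex : exists m, `[< exists B, good B /\ \rank B = m >].
    by exists 0%N; apply/asboolP; exists 0; split; rewrite ?mxrank0// => C _; exact: sub0mx.
  have ub m : `[< exists B, good B /\ \rank B = m >] -> (m <= n)%N.
    by move=> /asboolP[B [_ <-]]; exact: rank_leq_row.
  case: (ex_maxnP ex ub) => m /asboolP mP mmax; exists m; split=> // m' m'P.
  by apply: mmax; apply/asboolP.
exists B; split=> // w Pw.
have gBw : good (B + w)%MS.
  by move=> C CP; rewrite addsmx_sub gB//= CP.
have := mmax _ (ex_intro _ _ (conj gBw erefl)); rewrite -rB => le.
have : (B == B + w)%MS by rewrite -(geq_leqif (mxrank_leqif_eq (addsmxSl B w))).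
by move=> /eqmxP h; rewrite h addsmxSr.
Qed.

Definition pairing n (u v : 'rV[F]_n) : F := (u *m v^T) 0 0.

Lemma pairing_eq0 n (u v : 'rV[F]_n) : (pairing u v == 0) = (u *m v^T == 0).
Proof.
apply/eqP/eqP => [h|]; last by rewrite /pairing => ->; rewrite mxE.
by apply/matrixP => i j; rewrite !ord1 [RHS]mxE.
Qed.

Lemma pairing_sub n m (u w : 'rV[F]_n) (B : 'M_(m, n)) :
  (w <= B)%MS -> u *m B^T = 0 -> pairing u w = 0.
Proof.
move=> /submxP[D ->] uB; apply/eqP.
by rewrite pairing_eq0 trmx_mul mulmxA uB mul0mx.
Qed.

Section invariant_line.
Variables (T : Type) (n : nat) (u v : T -> 'rV[F]_n).
Let e : rel T := fun i j => pairing (u j) (v i) != 0.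
Hypothesis acyclic : forall i j, reaches e i j -> reaches e j i -> i = j.

(** The line is invariant under all maps sending [w] to [pairing (u i) w *: v i]. If some nonzero
    vector is killed by all of them, it serves. Otherwise take a minimal nonzero invariant [B]. For
    nonzero [v j] in [B], the span of the [v k] with [k] reachable from [j] is invariant, hence
    equals [B]; so every map that does not vanish on [B] is entered by an edge from a vertex
    reachable from [j]. Consequently each vertex [l] entered from a suitable [k], with [v l]
    nonzero, leads back to [k], and acyclicity gives [l = k]: the line of [v k] is invariant. *)
Lemma rank_one_invariant_line : (0 < n)%N -> exists2 w : 'rV[F]_n, w != 0 &
  forall i, pairing (u i) w = 0 \/ (v i <= w)%MS.
Proof.
move=> n0; have [[w [w0 h]]|nc] := pselect (exists w : 'rV[F]_n, w != 0 /\
    forall i, pairing (u i) w = 0 \/ v i = 0).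
  by exists w => // i; case: (h i) => [->|->]; [left|right; exact: sub0mx].
have {}nc w : w != 0 -> exists i, pairing (u i) w != 0 /\ v i != 0.
  move=> w0; apply/not_existsP => h; apply: nc; exists w; split => // i.
  have [|u0] := eqVneq (pairing (u i) w) 0; first by left.
  by right; apply/eqP/negPn/negP => vi; apply: (h i).
pose inv (B : 'M[F]_n) := forall i, u i *m B^T = 0 \/ (v i <= B)%MS.
have [B [B0 iB Bmin]] : exists B, [/\ B != 0, inv B &
    forall C, C != 0 -> inv C -> (\rank B <= \rank C)%N].
  have ex : exists m, `[< exists B, [/\ B != 0, inv B & \rank B = m] >].
    exists n; apply/asboolP; exists 1%:M; split; rewrite ?mxrank1//.
      by case: (n) n0 => // n' _; exact: oner_neq0.
    by move=> i; right; exact: submx1.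
  case: (ex_minnP ex) => m /asboolP[B [B0 iB rB]] mmin; exists B; split=> // C C0 iC.
  by rewrite rB; apply: mmin; apply/asboolP; exists C.
have step i j : e i j -> (v i <= B)%MS -> (v j <= B)%MS.
  by move=> eij vi; case: (iB j) => // ujB; move: eij; rewrite /e (pairing_sub vi ujB) eqxx.
have reachB i j : reaches e i j -> (v i <= B)%MS -> (v j <= B)%MS.
  move=> [p + <-]; elim: p i => //= k p IH i /andP[eik kp] vi.
  exact: IH kp (step _ _ eik vi).
have key j i : v j != 0 -> (v j <= B)%MS -> u i *m B^T != 0 ->
    exists2 k, reaches e j k & e k i.
  move=> vj0 vjB uiB.
  have [S [S1 S2]] := span_pred (fun w => exists2 k, reaches e j k & w = v k).
  have jS : (v j <= S)%MS by apply: S1; exists j => //; exists [::].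
  have S0 : S != 0 by apply: contraNneq vj0 => S0; move: jS; rewrite S0 submx0.
  have hit l : u l *m S^T != 0 -> exists2 k, reaches e j k & e k l.
    move=> ulS; apply: contrapT => h; case/eqP: ulS.
    have : (S <= kermx (u l)^T)%MS.
      apply: S2 => w [k jk ->]; apply/sub_kermxP.
      have [/eqP|nz] := eqVneq (pairing (u l) (v k)) 0; last by case: h; exists k.
      by rewrite pairing_eq0 => /eqP/(congr1 trmx); rewrite trmx_mul trmxK trmx0.
    by move=> /sub_kermxP/(congr1 trmx); rewrite trmx_mul trmxK trmx0.
  have iS : inv S.
    move=> l; have [|ulS] := eqVneq (u l *m S^T) 0; [by left|right].
    have [k jk kl] := hit _ ulS; apply: S1; exists l => //.
    exact: reaches_trans jk (reaches1 kl).
  have SB : (S <= B)%MS.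
    by apply: S2 => w [k jk ->]; exact: reachB jk vjB.
  have /eqmxP SBe : (S == B)%MS.
    by rewrite -(geq_leqif (mxrank_leqif_eq SB)) Bmin.
  apply: (hit i); apply: contraNneq uiB => uiS.
  have /submxP[D ->] : (B <= S)%MS by rewrite SBe.
  by rewrite trmx_mul mulmxA uiS mul0mx.
have B_u i w : (w <= B)%MS -> pairing (u i) w != 0 -> u i *m B^T != 0.
  by move=> wB; apply: contraNneq => h; rewrite (pairing_sub wB h).
have w0 : nz_row B != 0 by rewrite nz_row_eq0.
have [j [ujw vj0]] := nc _ w0.
have uj := B_u _ _ (nz_row_sub B) ujw.
have vjB : (v j <= B)%MS by case: (iB j) => // h; rewrite h eqxx in uj.
have [k [ukj vk0]] := nc _ vj0.
have vkB : (v k <= B)%MS by apply: step vjB.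
have ukB := B_u _ _ vjB ukj.
have loop : e k k.
  have [l kl lk] := key _ _ vk0 vkB ukB.
  by rewrite {1}(acyclic kl (reaches1 lk)).
exists (v k) => // l.
have [|ulk] := eqVneq (pairing (u l) (v k)) 0; [by left|right].
have [->|vl0] := eqVneq (v l) 0; first exact: sub0mx.
have vlB : (v l <= B)%MS by apply: step vkB.
have [k' lk' k'k] := key _ _ vl0 vlB ukB.
rewrite (@acyclic l k)//; first exact: reaches_trans lk' (reaches1 k'k).
exact: reaches1.
Qed.

End invariant_line.

(** Induction on the dimension: make an invariant line the first basis vector and pass to the
    quotient. The hypothesis permits loops, which become the diagonal entries. *)
Lemma rank_one_triangularization (T : Type) n (u v : T -> 'rV[F]_n) :
  (forall i j, reaches (fun i j => pairing (u j) (v i) != 0) i j ->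
    reaches (fun i j => pairing (u j) (v i) != 0) j i -> i = j) ->
  exists2 P : 'M[F]_n, P \in unitmx &
    forall i (k l : 'I_n), (l < k)%N ->
      (v i *m P) 0 k * (u i *m (invmx P)^T) 0 l = 0.
Proof.
elim: n u v => [|n IH] u v acyc.
  by exists 1%:M; rewrite ?unitmx1// => i [].
have [w w0 hw] := rank_one_invariant_line acyc (ltn0Sn n).
(* Completes [w] to a basis; the rank normal form of the single row [w] supplies the invertible
   matrix. *)
have [P0 [c [P0u c0 wP0]]] : exists (P0 : 'M[F]_n.+1) c,
    [/\ P0 \in unitmx, c != 0 & w = c *: row 0 P0].
  exists (row_ebase w), (col_ebase w 0 0); rewrite row_ebase_unit; split => //.
    have := col_ebase_unit w; rewrite unitmxE unitfE.
    by rewrite {1}[col_ebase w]mx11_scalar det_scalar1.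
  have rw : \rank w = 1%N by apply/eqP; rewrite eqn_leq rank_leq_row lt0n mxrank_eq0.
  rewrite -[LHS]mulmx_ebase rw {1}[col_ebase w]mx11_scalar mul_scalar_mx -scalemxAl.
  congr (_ *: _); rewrite rowE; congr (_ *m _).
  by apply/matrixP => i j; rewrite !mxE !ord1 eq_sym ltnS andbT.
pose v1 i := (v i *m invmx P0 : 'rV_(1 + n)); pose u1 i := (u i *m P0^T : 'rV_(1 + n)).
have uv1 i j : pairing (u1 i) (v1 j) = pairing (u i) (v j).
  rewrite /pairing /u1 /v1 trmx_mul trmx_inv mulmxA -(mulmxA (u i)).
  by rewrite mulmxV ?mulmx1// unitmx_tr.
have h1 i : u1 i 0 0 = 0 \/ forall k : 'I_n, v1 i 0 (rshift 1 k) = 0.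
  case: (hw i) => [h|/sub_rVP[a va]]; [left|right => k].
    move: h; rewrite /pairing wP0 linearZ /= -scalemxAr mxE => /eqP.
    rewrite mulf_eq0 (negbTE c0) /= => /eqP h; rewrite -[RHS]h /u1 !mxE.
    by apply: eq_bigr => j _; rewrite !mxE.
  rewrite /v1 va wP0 scalerA -scalemxAl mxE -row_mul mulmxV// !mxE.
  by rewrite mulr0.
(* If [v2 i] vanishes, the map induced on the quotient is 0, yet the truncated [u1 i] could create
   edges absent from the given relation; so [u2 i] is set to 0. If not, [h1] makes the dropped entry
   of [u1 i] zero and the pairings are unchanged. Either way no edge is added and acyclicity
   persists. *)
pose v2 i := rsubmx (v1 i); pose u2 i := if v2 i == 0 then 0 else rsubmx (u1 i).
have uv2 i j : v2 i != 0 -> pairing (u2 i) (v2 j) = pairing (u i) (v j).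
  move=> vi0; rewrite -uv1 /pairing /u2 (negbTE vi0) [LHS]mxE [RHS]mxE big_ord_recl.
  have -> : u1 i 0 ord0 = 0.
    case: (h1 i) => // h; case/eqP: vi0; apply/matrixP => a b.
    by rewrite [LHS]mxE [RHS]mxE ord1 h.
  rewrite mul0r add0r; apply: eq_bigr => k _.
  rewrite [rsubmx _ 0 k]mxE [(v2 j)^T k 0]mxE [v2 j 0 k]mxE [(v1 j)^T _ 0]mxE.
  by congr (u1 i _ _ * v1 j _ _); apply: val_inj.
have acyc2 i j : reaches (fun i j => pairing (u2 j) (v2 i) != 0) i j ->
    reaches (fun i j => pairing (u2 j) (v2 i) != 0) j i -> i = j.
  move=> ij ji; apply: acyc.
    apply: reaches_sub ij => k l; have [vl0|vl0] := eqVneq (v2 l) 0; last by rewrite uv2.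
    by rewrite /u2 vl0 eqxx /pairing mul0mx mxE eqxx.
  apply: reaches_sub ji => k l; have [vl0|vl0] := eqVneq (v2 l) 0; last by rewrite uv2.
  by rewrite /u2 vl0 eqxx /pairing mul0mx mxE eqxx.
have [P2 P2u h2] := IH u2 v2 acyc2.
pose Q := block_mx 1%:M 0 0 P2 : 'M_(1 + n).
have Qu : Q \in unitmx by rewrite unitmxE det_ublock det1 mul1r -unitmxE.
have Qi : invmx Q = block_mx 1%:M 0 0 (invmx P2).
  apply: (can_inj (mulKmx Qu)); rewrite mulmxV// mulmx_block.
  by rewrite !mulmx1 !mulmx0 !mul0mx !addr0 add0r mulmxV// -scalar_mx_block.
pose P : 'M_(1 + n) := invmx P0 *m Q.
have Pu : P \in unitmx by rewrite unitmx_mul unitmx_inv P0u.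
have Pi : invmx P = invmx Q *m P0.
  apply: (can_inj (mulKmx Pu)); rewrite mulmxV// -mulmxA (mulmxA Q) mulmxV//.
  by rewrite mul1mx mulVmx.
exists P => // i k l lk.
have -> : v i *m P = row_mx (lsubmx (v1 i)) (v2 i *m P2).
  have -> : v i *m P = row_mx (lsubmx (v1 i)) (rsubmx (v1 i)) *m Q.
    by rewrite hsubmxK mulmxA.
  by rewrite mul_row_block mulmx1 !mulmx0 addr0 add0r.
have -> : u i *m (invmx P)^T = row_mx (lsubmx (u1 i)) (rsubmx (u1 i) *m (invmx P2)^T).
  have -> : u i *m (invmx P)^T = row_mx (lsubmx (u1 i)) (rsubmx (u1 i)) *m (invmx Q)^T.
    by rewrite hsubmxK Pi trmx_mul mulmxA.
  by rewrite Qi tr_block_mx !trmx0 trmx1 mul_row_block mulmx1 !mulmx0 addr0 add0r.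
case: (@split_ordP 1 n k) lk => k' ->; first by rewrite ord1.
case: (@split_ordP 1 n l) => l' -> lk.
  rewrite [X in _ * X](row_mxEl (lsubmx (u1 i))) [X in X * _](row_mxEr (lsubmx (v1 i))).
  case: (h1 i) => [h|h].
    have -> : lsubmx (u1 i) 0 l' = 0.
      by rewrite mxE -[RHS]h; congr (u1 i _ _); apply: val_inj; rewrite /= ord1.
    by rewrite mulr0.
  have -> : v2 i = 0 by apply/rowP => a; rewrite [LHS]mxE [RHS]mxE h.
  by rewrite mul0mx [(0 : 'rV_n) 0 k']mxE mul0r.
rewrite [X in _ * X](row_mxEr (lsubmx (u1 i))) [X in X * _](row_mxEr (lsubmx (v1 i))).
move: (h2 i k' l'); rewrite /u2; have [->|_] := eqVneq (v2 i) 0.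
  by move=> _; rewrite mul0mx [(0 : 'rV_n) 0 k']mxE mul0r.
by apply; rewrite /= !add1n ltnS in lk.
Qed.

End rank_one_families.

(** * Traces of products *)

(* Inclusion-exclusion: only the words whose letters are exactly those of `S` survive. *)
Lemma polarization (V : zmodType) (I J : finType) (t : {ffun J -> I} -> V) (i0 : I) :
  (forall S : {set I}, \sum_(w in ffun_on (mem S)) t w =
                       \sum_(w in ffun_on (mem (S :\ i0))) t w) ->
  forall S : {set I}, i0 \in S -> \sum_(w : {ffun J -> I} | w @: setT == S) t w = 0.
Proof.
move=> h; pose H S := \sum_(w : {ffun J -> I} | w @: [set: J] == S) t w.
have G (S : {set I}) : \sum_(w in ffun_on (mem S)) t w = \sum_(T : {set I} | T \subset S) H T.
  rewrite (partition_big (fun w : {ffun J -> I} => w @: [set: J]) (fun T : {set I} => T \subset S)).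
    apply: eq_bigr => T TS; apply: eq_bigl => w; rewrite andb_idl// => /eqP wT.
    apply/ffun_onP => j; have /= := subsetP TS (w j); apply; rewrite -wT; exact: imset_f.
  move=> w /ffun_onP wS; apply/subsetP => _ /imsetP[j _ ->]; exact: wS.
suff : forall m (S : {set I}), (#|S| < m)%N -> i0 \in S -> H S = 0.
  by move=> hh S; exact: (hh #|S|.+1).
elim=> // m IH S; rewrite ltnS => Sm iS.
have := h S; rewrite !G (bigID (fun T : {set I} => i0 \in T))/=.
rewrite [X in _ + X](eq_bigl (fun T : {set I} => T \subset S :\ i0)); last first.
  by move=> T; rewrite subsetD1.
move=> /(canRL (addrK _)); rewrite subrr (bigD1 S)/=; last by rewrite subxx.
rewrite big1 ?addr0// => T /andP[/andP[TS iT] nTS].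
by apply: IH => //; apply: leq_trans Sm; rewrite proper_card// properEneq nTS.
Qed.

(** A word of length [#|I|] that uses every letter of [I] is a permutation. *)
Lemma polarization_inj (V : zmodType) (I : finType) (t : {ffun I -> I} -> V) (i0 : I) :
  (forall S : {set I}, \sum_(w in ffun_on (mem S)) t w =
                       \sum_(w in ffun_on (mem (S :\ i0))) t w) ->
  \sum_(w : {ffun I -> I} | injectiveb w) t w = 0.
Proof.
move=> h; rewrite -[RHS](polarization h (in_setT i0)); apply: eq_bigl => w.
apply/injectiveP/eqP => [winj|wT].
  by apply/eqP; rewrite eqEcard subsetT card_imset/=.
have /imset_injP winj : #|w @: [set: I]| == #|[set: I]| by rewrite wT.
by move=> x y; apply: winj; rewrite inE.
Qed.

Section trace_powers.
Variable C : numClosedFieldType.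

Lemma trig_mulmx n (A B : 'M[C]_n) : is_trig_mx A -> is_trig_mx B ->
  is_trig_mx (A *m B) /\ forall i, (A *m B) i i = A i i * B i i.
Proof.
move=> /is_trig_mxP tA /is_trig_mxP tB; split.
  apply/is_trig_mxP => i j ij; rewrite mxE big1// => k _.
  have [ik|ki] := ltnP i k; first by rewrite tA// mul0r.
  by rewrite tB ?mulr0//; apply: leq_ltn_trans ij.
move=> i; rewrite mxE (bigD1 i)//= big1 ?addr0// => k ki.
have [ik|] := ltnP i k; first by rewrite tA// mul0r.
rewrite leq_eqVlt => /orP[/eqP/val_inj/eqP|]; first by rewrite (negbTE ki).
by move=> kli; rewrite tB ?mulr0.
Qed.

Lemma trig_exp n (A : 'M[C]_n.+1) m : is_trig_mx A ->
  is_trig_mx (A ^+ m) /\ forall i, (A ^+ m) i i = A i i ^+ m.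
Proof.
move=> tA; elim: m => [|m [IH1 IH2]].
  by rewrite expr0; split=> [|i]; rewrite ?scalar_mx_is_trig// mxE eqxx.
rewrite exprS; have [h1 h2] := trig_mulmx tA IH1; split=> // i.
by rewrite [LHS]h2 IH2 exprS.
Qed.

(** After unitary triangularization the trace is a power sum of diagonal entries, all of them
    eigenvalues. The resulting finite list depends on [s], [n] and [m] but not on [A], which is what
    makes sequences of traces discrete. *)
Lemma mxtrace_exp_eigenvalues n (A : 'M[C]_n.+1) (s : seq C) m :
  (forall z, eigenvalue A z -> z \in s) ->
  \tr (A ^+ m) \in [seq \sum_i (val (f i)) ^+ m | f : {ffun 'I_n.+1 -> seq_sub s}].
Proof.
move=> As; have [P Pu] := Schur A (ltn0Sn n).
have {}Pu : P \in unitmx by apply: unitarymx_unit.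
rewrite /similar_to; set T := conjmx P A => tT.
have TE : T = P *m A *m invmx P by rewrite /T conjumx.
have eT i : T i i \in s.
  apply: As; rewrite eigenvalue_root_char.
  have -> : char_poly A = char_poly T.
    rewrite /char_poly /char_poly_mx TE !map_mxM/= map_invmx.
    set PX := map_mx _ P; have PXu : PX \in unitmx by rewrite map_unitmx.
    have -> : 'X%:M - PX *m map_mx polyC A *m invmx PX =
       PX *m ('X%:M - map_mx polyC A) *m invmx PX.
      by rewrite mulmxBr mulmxBl scalar_mxC -(mulmxA _%:M) mulmxV// mulmx1.
    by rewrite !det_mulmx mulrAC -det_mulmx mulmxV// det1 mul1r.
  rewrite char_poly_trig// /root horner_prod (bigD1 i)//= hornerXsubC subrr mul0r//.
have -> : \tr (A ^+ m) = \tr (T ^+ m).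
  have -> : T ^+ m = P *m A ^+ m *m invmx P.
    rewrite TE; elim: m => [|m IH]; first by rewrite !expr0 mulmx1 mulmxV.
    by rewrite exprS IH exprS -!mulmxE !mulmxA mulmxKV.
  by rewrite -mulmxA mxtrace_mulC -mulmxA mulVmx// mulmx1.
apply/mapP; exists [ffun i => SeqSub (eT i)]; first by rewrite mem_enum.
by apply: eq_bigr => i _; rewrite ffunE (proj2 (trig_exp m tT)).
Qed.

Lemma prod_rank_one n r (u v : nat -> 'rV[C]_n.+1) :
  \prod_(j < r.+1) ((v j)^T *m u j) =
  (\prod_(j < r) pairing (u j) (v j.+1)) *: ((v 0)^T *m u r).
Proof.
elim: r => [|r IH]; first by rewrite big_ord1 big_ord0 scale1r.
rewrite big_ord_recr/= IH big_ord_recr/= -scalerAl -scalerA; congr (_ *: _).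
rewrite -mulmxE mulmxA -(mulmxA _ (u r)) [u r *m _]mx11_scalar.
by rewrite -/(pairing _ _) -mulmxA mul_scalar_mx -scalemxAr.
Qed.

(** The product telescopes to scalars times a single outer product, and the trace closes the chain.
    In this way kernel values around a cycle appear in traces. *)
Lemma mxtrace_prod_rank_one n r (u v : 'I_r.+1 -> 'rV[C]_n.+1) :
  \tr (\prod_j ((v j)^T *m u j)) = \prod_j pairing (u j) (v (ordS j)).
Proof.
pose u' j := u (inord j); pose v' j := v (inord j).
transitivity (\tr (\prod_(j < r.+1) ((v' j)^T *m u' j))).
  by congr mxtrace; apply: eq_bigr => j _; rewrite /u' /v' inord_val.
rewrite prod_rank_one linearZ/= mxtrace_mulC [RHS]big_ord_recr/= [u' r *m _]mx11_scalar.
rewrite mxtrace_scalar mulr1n; congr (_ * _); last first.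
  rewrite /u' /v' /pairing; congr ((u _ *m (v _)^T) _ _); apply: val_inj; rewrite /= inordK//.
  by rewrite modnn.
apply: eq_bigr => j _; rewrite /u' /v'; congr (pairing (u _) (v _)); apply: val_inj => /=.
  by rewrite inordK//= ltnW// ltnS.
by rewrite inordK ?modn_small ?ltnS.
Qed.
End trace_powers.

From mathcomp Require Import all_classical all_reals all_analysis measurable_realfun ess_sup_inf.
From mathcomp Require Import complex ring lra zify.

Import Order.TTheory GRing.Theory Num.Theory.
Import numFieldTopology.Exports numFieldNormedType.Exports.

Local Open Scope classical_set_scope.
Local Open Scope ring_scope.
Local Open Scope complex_scope.

(** * From traces of compressions to products around a cycle *)

Section cycle_limit.
Variable C : numClosedFieldType.
Implicit Types u : nat -> C.

Lemma cvg_finite_range u (s : seq C) :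
  (forall k, u k \in s) -> u @ \oo --> (0 : C) -> \forall k \near \oo, u k = 0.
Proof.
move=> us u0.
have [e e0 es] : exists2 e : C, 0 < e & forall z, z \in s -> z != 0 -> e <= `|z|.
  elim: s {us} => [|z s [e e0 IH]]; first by exists 1.
  have [->|z0] := eqVneq z 0.
    by exists e => // w; rewrite in_cons => /orP[/eqP->|]; [rewrite eqxx|exact: IH].
  have zr : `|z| \is Num.real by exact: normr_real.
  have er : e \is Num.real by exact: gtr0_real.
  have [le|le] := real_leP er zr.
    by exists e => // w; rewrite in_cons => /orP[/eqP->//|]; exact: IH.
  exists `|z|; rewrite ?normr_gt0// => w; rewrite in_cons => /orP[/eqP->//|ws w0].
  exact: le_trans (ltW le) (IH w ws w0).
near=> k; have : `|0 - u k| < e by near: k; exact: cvgr_dist_lt.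
rewrite sub0r normrN => uk; apply/eqP/negPn/negP => uk0.
by have := lt_le_trans uk (es _ (us k) uk0); rewrite ltxx.
Unshelve. all: by end_near. Qed.

Lemma cvg_sum_fin (I : Type) (r : seq I) (P : pred I) (f : I -> nat -> C) (a : I -> C) :
  (forall i, P i -> f i @ \oo --> a i) ->
  (fun k => \sum_(i <- r | P i) f i k) @ \oo --> (\sum_(i <- r | P i) a i).
Proof.
move=> h; elim: r => [|i r IH].
  by rewrite big_nil; under eq_fun do rewrite big_nil; exact: cvg_cst.
rewrite big_cons; under eq_fun do rewrite big_cons.
by case: ifPn => // Pi; apply: cvgD => //; exact: h.
Qed.

Definition mxcvg n (A : nat -> 'M[C]_n.+1) (B : 'M[C]_n.+1) :=
  forall a b, (fun k => A k a b) @ \oo --> B a b.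

Lemma mxcvg_sum n (I : Type) (r : seq I) (P : pred I) (A : I -> nat -> 'M[C]_n.+1)
    (B : I -> 'M[C]_n.+1) : (forall i, P i -> mxcvg (A i) (B i)) ->
  mxcvg (fun k => \sum_(i <- r | P i) A i k) (\sum_(i <- r | P i) B i).
Proof.
move=> h a b; rewrite summxE; under eq_fun do rewrite summxE.
by apply: cvg_sum_fin => i Pi; exact: h.
Qed.

Lemma mxcvg_prod n (I : Type) (r : seq I) (A : I -> nat -> 'M[C]_n.+1)
    (B : I -> 'M[C]_n.+1) : (forall i, mxcvg (A i) (B i)) ->
  mxcvg (fun k => \prod_(i <- r) A i k) (\prod_(i <- r) B i).
Proof.
move=> h; elim: r => [|i r IH] a b.
  by rewrite big_nil; under eq_fun do rewrite big_nil; exact: cvg_cst.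
rewrite big_cons mxE; under eq_fun do rewrite big_cons mxE.
by apply: cvg_sum_fin => c _; apply: cvgM; [exact: h|exact: IH].
Qed.

Lemma mxcvg_trace n (A : nat -> 'M[C]_n.+1) (B : 'M[C]_n.+1) :
  mxcvg A B -> (fun k => \tr (A k)) @ \oo --> (\tr B).
Proof. by move=> h; apply: cvg_sum_fin => i _; exact: h. Qed.

Lemma exprE_ord (S : pzRingType) (x : S) r : x ^+ r = \prod_(j < r) x.
Proof. by rewrite prodr_const card_ord. Qed.

Lemma mxtrace_expE n r (M : 'I_r -> 'M[C]_n.+1) (S : {set 'I_r}) :
  \tr ((\sum_(i in S) M i) ^+ r) =
  \sum_(w : {ffun 'I_r -> 'I_r} | w \in ffun_on (mem S)) \tr (\prod_j M (w j)).
Proof.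
rewrite -raddf_sum /= exprE_ord; congr mxtrace.
by rewrite (bigA_distr_big (mem S) (fun _ i => M i)).
Qed.

(** Here [M k i] stands for the compression matrix of the k-th cell around the i-th point, [mu k i]
    for the measure of this cell and [m i] for its limit. Words of length r+1 come from the (r+1)-st
    power of the sum over the cells in [S]. After polarization only permutations remain; they all
    carry the same factor, the product of the [mu k i], so it can be divided out before passing to
    the limit. *)
Lemma chordless_cycle_prod0 n r (M : nat -> 'I_r.+1 -> 'M[C]_n.+1)
    (mu : nat -> 'I_r.+1 -> C) (m : 'I_r.+1 -> C) (u v : 'I_r.+1 -> 'rV[C]_n.+1)
    (s : seq C) (i0 : 'I_r.+1) :
  (forall k i, mu k i != 0) ->
  (forall i, mu ^~ i @ \oo --> m i) -> m i0 = 0 ->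
  (forall i, mxcvg (fun k => (mu k i)^-1 *: M k i) ((v i)^T *m u i)) ->
  (forall k (S : {set 'I_r.+1}) z, eigenvalue (\sum_(i in S) M k i) z -> z \in s) ->
  (forall i j, pairing (u i) (v j) != 0 -> i != j -> j = ordS i) ->
  \prod_i pairing (u i) (v (ordS i)) = 0.
Proof.
move=> mu0 mum m0 MN Ms chord.
pose N k i := (mu k i)^-1 *: M k i.
have MNE k i : M k i = mu k i *: N k i by rewrite /N scalerA divff ?scale1r.
have McvgS (S : {set 'I_r.+1}) : mxcvg (fun k => \sum_(i in S) M k i)
    (\sum_(i in S) m i *: ((v i)^T *m u i)).
  apply: mxcvg_sum => i _ a b; under eq_fun do rewrite MNE mxE.
  by rewrite mxE; apply: cvgM => //; exact: MN.
have trcvg (S : {set 'I_r.+1}) : (fun k => \tr ((\sum_(i in S) M k i) ^+ r.+1) -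
      \tr ((\sum_(i in S :\ i0) M k i) ^+ r.+1)) @ \oo --> (0 : C).
  have -> : (0 : C) = \tr ((\sum_(i in S) m i *: ((v i)^T *m u i)) ^+ r.+1) -
      \tr ((\sum_(i in S :\ i0) m i *: ((v i)^T *m u i)) ^+ r.+1).
    (* As [m i0 = 0], removing [i0] does not change the limit matrix, so the difference of the
       traces tends to 0. *)
    have -> : \sum_(i in S) m i *: ((v i)^T *m u i) =
        \sum_(i in S :\ i0) m i *: ((v i)^T *m u i).
      have [iS|iS] := boolP (i0 \in S).
        by rewrite (big_setD1 _ iS) /= m0 scale0r add0r.
      apply: eq_bigl => i; rewrite in_setD1 andb_idl//.
      by apply: contraTneq => ->.
    by rewrite subrr.
  apply: cvgB; apply: mxcvg_trace.
    by under eq_fun do rewrite exprE_ord; rewrite exprE_ord; apply: mxcvg_prod.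
  by under eq_fun do rewrite exprE_ord; rewrite exprE_ord; apply: mxcvg_prod.
pose X := [seq \sum_i (val (f i)) ^+ r.+1 | f : {ffun 'I_n.+1 -> seq_sub s}].
have treq (S : {set 'I_r.+1}) : \forall k \near \oo, \tr ((\sum_(i in S) M k i) ^+ r.+1) =
      \tr ((\sum_(i in S :\ i0) M k i) ^+ r.+1).
  have := @cvg_finite_range _ [seq a - b | a <- X, b <- X] _ (trcvg S).
  have mem k : \tr ((\sum_(i in S) M k i) ^+ r.+1) -
      \tr ((\sum_(i in S :\ i0) M k i) ^+ r.+1) \in [seq a - b | a <- X, b <- X].
    by apply: allpairs_f; apply: mxtrace_exp_eigenvalues; exact: Ms.
  by move=> /(_ mem); apply: filterS => k /eqP; rewrite subr_eq0 => /eqP.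
have {treq}treq : \forall k \near \oo, forall S : {set 'I_r.+1},
    \tr ((\sum_(i in S) M k i) ^+ r.+1) = \tr ((\sum_(i in S :\ i0) M k i) ^+ r.+1).
  by apply: filter_forall => S; exact: treq.
have sum0 : \forall k \near \oo,
    \sum_(w : {ffun 'I_r.+1 -> 'I_r.+1} | injectiveb w) \tr (\prod_j N k (w j)) = 0.
  apply: filterS treq => k treq.
  have h (S : {set 'I_r.+1}) : \sum_(w : {ffun 'I_r.+1 -> 'I_r.+1} | w \in ffun_on (mem S)) \tr (\prod_j M k (w j)) =
      \sum_(w : {ffun 'I_r.+1 -> 'I_r.+1} | w \in ffun_on (mem (finset.setD S (finset.set1 i0)))) \tr (\prod_j M k (w j)).
    by rewrite -!mxtrace_expE treq.
  have c0 : \prod_j mu k j != 0 by apply/prodf_neq0 => j _; exact: mu0.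
  apply: (mulfI c0); rewrite mulr0 -[RHS](polarization_inj h) mulr_sumr.
  apply: eq_bigr => w /injectiveP winj.
  have -> : \prod_j M k (w j) = (\prod_j mu k (w j)) *: \prod_j N k (w j).
    by rewrite -scaler_prod; apply: eq_bigr => j _; exact: MNE.
  rewrite linearZ/=; congr (_ * _).
  by rewrite (reindex w)//=; exact/onW_bij/injF_bij.
pose t (w : {ffun 'I_r.+1 -> 'I_r.+1}) := \prod_j pairing (u (w j)) (v (w (ordS j))).
have t0 : \sum_(w : {ffun 'I_r.+1 -> 'I_r.+1} | injectiveb w) t w = 0.
  have : (fun k => \sum_(w : {ffun 'I_r.+1 -> 'I_r.+1} | injectiveb w)
      \tr (\prod_j N k (w j))) @ \oo -->
      (\sum_(w : {ffun 'I_r.+1 -> 'I_r.+1} | injectiveb w) t w).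
    apply: cvg_sum_fin => w _; rewrite /t -(mxtrace_prod_rank_one (u \o w) (v \o w)).
    by apply: mxcvg_trace; apply: mxcvg_prod => j; exact: MN.
  have c0 : (fun k => \sum_(w : {ffun 'I_r.+1 -> 'I_r.+1} | injectiveb w)
      \tr (\prod_j N k (w j))) @ \oo --> (0 : C).
    apply: cvg_near_cst; exact: sum0.
  by move=> c1; apply: cvg_unique c1 c0.
apply/eqP/negPn/negP => c0; set c := \prod_i _ in c0.
(* A permutation with nonzero term follows edges only, so the absence of chords gives
   [w (ordS j) = ordS (w j)]: it is a rotation, and its term is the same product [c]. *)
have tc (w : {ffun 'I_r.+1 -> 'I_r.+1}) : injective w -> t w != 0 -> t w = c.
  move=> winj; rewrite /t => tw0; rewrite /c [RHS](reindex w)/=; last first.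
    exact/onW_bij/injF_bij.
  apply: eq_bigr => j _; congr (pairing _ (v _)).
  have [wj|] := eqVneq (w j) (w (ordS j)).
    have /(congr1 val)/= jj := winj _ _ wj.
    have r0 : r = 0%N.
      apply/eqP/negPn/negP => r0; have := ltn_ord j; rewrite ltnS leq_eqVlt => /orP[/eqP jr|jr].
        by move: jj; rewrite jr modnn => r0'; rewrite r0' in r0.
      by move: jj; rewrite modn_small ?ltnS// => /eqP; rewrite ltn_eqF.
    by move: (w (ordS j)) (w j); rewrite r0 => a b; rewrite !ord1.
  by move=> /(chord _ _); apply; move: tw0 => /prodf_neq0; apply.
have tid : t [ffun i => i] = c.
  by rewrite /t /c; apply: eq_bigr => j _; rewrite !ffunE.
(* The limit sum is [c] times the number of permutations with nonzero term. The identity is one of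
   them, so in characteristic 0 the vanishing of the sum contradicts [c != 0]. *)
have : \sum_(w : {ffun 'I_r.+1 -> 'I_r.+1} | injectiveb w) (t w != 0)%:R * c = 0.
  rewrite -[RHS]t0; apply: eq_bigr => w /injectiveP winj.
  by have [->|/(tc _ winj) ->] := eqVneq (t w) 0; rewrite ?mul0r ?mul1r.
rewrite -mulr_suml => /eqP; rewrite mulf_eq0 (negbTE c0) orbF -natr_sum pnatr_eq0.
rewrite sum_nat_eq0 => /forallP/(_ [ffun i => i]); rewrite tid c0 implybF => /negP; apply.
by apply/injectiveP => a b; rewrite !ffunE.
Qed.

End cycle_limit.

(** * The Hilbert space L^2 *)

Section modulus.
Variable R : realType.
Implicit Types z w : R[i].

Lemma sqr_modc z : modc z ^+ 2 = complex.Re z ^+ 2 + complex.Im z ^+ 2.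
Proof. by case: z => a b /=; rewrite sqr_sqrtr// addr_ge0// sqr_ge0. Qed.

Lemma mulcJ_modc z : z * z^*%C = ((modc z) ^+ 2)%:C.
Proof. by rewrite sqr_modc; case: z => a b; simpc => /=; congr (_ +i* _); ring. Qed.

Lemma ler_normRe z : `|complex.Re z| <= modc z.
Proof.
rewrite -[leRHS]ger0_norm ?modc_ge0// -ler_sqr ?nnegrE ?normr_ge0//.
by rewrite !real_normK ?num_real// sqr_modc lerDl sqr_ge0.
Qed.

Lemma ler_normIm z : `|complex.Im z| <= modc z.
Proof.
rewrite -[leRHS]ger0_norm ?modc_ge0// -ler_sqr ?nnegrE ?normr_ge0//.
by rewrite !real_normK ?num_real// sqr_modc lerDr sqr_ge0.
Qed.

Lemma modcJ z : modc z^*%C = modc z.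
Proof. by case: z => a b /=; rewrite sqrrN. Qed.

Lemma modc_real (a : R) : modc a%:C = `|a|.
Proof. by rewrite /= expr0n/= addr0 sqrtr_sqr. Qed.

Lemma ReD z w : complex.Re (z + w) = complex.Re z + complex.Re w.
Proof. by case: z w => ? ? []. Qed.

Lemma ImD z w : complex.Im (z + w) = complex.Im z + complex.Im w.
Proof. by case: z w => ? ? []. Qed.

Lemma ReM z w : complex.Re (z * w) = complex.Re z * complex.Re w - complex.Im z * complex.Im w.
Proof. by case: z w => ? ? []. Qed.

Lemma ImM z w : complex.Im (z * w) = complex.Re z * complex.Im w + complex.Im z * complex.Re w.
Proof. by case: z w => ? ? []. Qed.

Lemma conjcD z w : (z + w)^*%C = z^*%C + w^*%C.
Proof. by apply/eqP; case: z w => a b [c e]; rewrite eq_complex /=; apply/andP; split; apply/eqP; ring. Qed.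

Lemma conjcM z w : (z * w)^*%C = z^*%C * w^*%C.
Proof. by apply/eqP; case: z w => a b [c e]; rewrite eq_complex /=; apply/andP; split; apply/eqP; ring. Qed.

Lemma conjcN z : (- z)^*%C = - z^*%C.
Proof. by case: z. Qed.

Lemma complexE z : z = complex.Re z +i* complex.Im z.
Proof. by case: z. Qed.

End modulus.

(** * Integrals of complex functions and square-integrability *)

Section complex_integral.
Context d (X : measurableType d) (R : realType) (mu : {measure set X -> \bar R}).
Implicit Types h k : X -> R[i].

Definition cintegrable h := cmeasurable h /\
  (mu.-integrable setT (EFin \o (fun x => complex.Re (h x))) /\
   mu.-integrable setT (EFin \o (fun x => complex.Im (h x)))).

Lemma cmeasurableJ h : cmeasurable h -> cmeasurable (fun x => (h x)^*%C).
Proof.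
move=> [mr mi]; split.
  by rewrite (_ : (fun _ => _) = (fun x => complex.Re (h x)))//; apply/funext => x; case: (h x).
rewrite (_ : (fun _ => _) = (fun x => - complex.Im (h x))); last first.
  by apply/funext => x; case: (h x).
exact: measurableT_comp.
Qed.

Lemma cintegrableD h k : cintegrable h -> cintegrable k -> cintegrable (fun x => h x + k x).
Proof.
move=> [mh [hr hi]] [mk [kr ki]]; split; first exact: cmeasurableD.
split.
  rewrite (_ : _ \o _ = (EFin \o (fun x => complex.Re (h x))) \+ (EFin \o (fun x => complex.Re (k x)))).
    exact: integrableD.
  by apply/funext => x /=; rewrite ReD.
rewrite (_ : _ \o _ = (EFin \o (fun x => complex.Im (h x))) \+ (EFin \o (fun x => complex.Im (k x)))).
  exact: integrableD.
by apply/funext => x /=; rewrite ImD.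
Qed.

Lemma cintegralD h k : cintegrable h -> cintegrable k ->
  cintegral mu (fun x => h x + k x) = cintegral mu h + cintegral mu k.
Proof.
move=> [mh [hr hi]] [mk [kr ki]]; rewrite /cintegral.
under eq_Rintegral do rewrite ReD.
under [in X in _ +i* X]eq_Rintegral do rewrite ImD.
by rewrite !RintegralD.
Qed.

Lemma cintegrableZ (z : R[i]) h : cintegrable h -> cintegrable (fun x => z * h x).
Proof.
move=> [mh [hr hi]]; split; first by apply: cmeasurableM => //; exact: cmeasurable_cst.
split.
  rewrite (_ : _ \o _ = ((fun x => (complex.Re z)%:E * (complex.Re (h x))%:E) \-
      (fun x => (complex.Im z)%:E * (complex.Im (h x))%:E))%E).
    by apply: integrableB => //; exact: integrableZl.
  by apply/funext => x /=; rewrite ReM EFinB !EFinM.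
rewrite (_ : _ \o _ = ((fun x => (complex.Re z)%:E * (complex.Im (h x))%:E) \+
    (fun x => (complex.Im z)%:E * (complex.Re (h x))%:E))%E).
  by apply: integrableD => //; exact: integrableZl.
by apply/funext => x /=; rewrite ImM EFinD !EFinM.
Qed.

Lemma cintegralZ (z : R[i]) h : cintegrable h ->
  cintegral mu (fun x => z * h x) = z * cintegral mu h.
Proof.
move=> [mh [hr hi]]; rewrite /cintegral.
under eq_Rintegral do rewrite ReM.
under [in X in _ +i* X]eq_Rintegral do rewrite ImM.
have I (c : R) f : mu.-integrable setT (EFin \o f) -> mu.-integrable setT (EFin \o (fun x : X => c * f x)).
  by move=> fi; rewrite (_ : _ \o _ = (fun x => c%:E * (f x)%:E)%E)//; exact: integrableZl.
rewrite RintegralB ?RintegralD//; try exact: I.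
by rewrite !RintegralZl//; case: (z).
Qed.

Lemma cintegralJ h : cintegrable h -> cintegral mu (fun x => (h x)^*%C) = (cintegral mu h)^*%C.
Proof.
move=> [mh [hr hi]]; rewrite /cintegral /=; congr (_ +i* _).
  by apply: eq_Rintegral => x _; case: (h x).
rewrite -mulN1r -RintegralZl//; apply: eq_Rintegral => x _.
by case: (h x) => a b; rewrite mulN1r.
Qed.

Lemma eq_cintegral h k : cmeasurable h -> cmeasurable k -> h = k %[ae mu] ->
  cintegral mu h = cintegral mu k.
Proof.
move=> [hr hi] [kr ki] hk; rewrite /cintegral /Rintegral; congr (fine _ +i* fine _).
  apply: ae_eq_integral => //; try exact/measurable_EFinP.
  by apply: filterS hk => x /= /(_ I) -> _.
apply: ae_eq_integral => //; try exact/measurable_EFinP.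
by apply: filterS hk => x /= /(_ I) -> _.
Qed.

Definition sqi h : \bar R := (\int[mu]_x ((modc (h x)) ^+ 2)%:E)%E.

Lemma poweR_Lnorm2 h : ('N[mu]_2%:E[EFin \o (fun x => modc (h x))] `^ 2 = sqi h)%E.
Proof.
rewrite powR_Lnorm ?pnatr_eq0//; apply: eq_integral => x _ /=.
by rewrite ger0_norm ?modc_ge0// powR_mulrn ?modc_ge0.
Qed.

Lemma Lp2P h : Lp mu 2%:E h <-> cmeasurable h /\ (sqi h < +oo)%E.
Proof.
rewrite /Lp /finite_norm /= -poweR_Lnorm2; split=> -[mh nh]; split=> //.
  exact: poweR_lty.
by apply: lty_poweRy nh; rewrite pnatr_eq0.
Qed.

Lemma L2norm_sqr (f : L2 mu) : ((L2norm f ^+ 2)%:E = sqi (L2fun f))%E.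
Proof.
rewrite -poweR_Lnorm2 -L2normE poweR_EFin powR_mulrn//.
by rewrite fine_ge0// Lnorm_ge0.
Qed.

Lemma measurable_sqr_modc h : cmeasurable h -> measurable_fun setT (fun x => ((modc (h x)) ^+ 2)%:E).
Proof. by move=> mh; apply/measurable_EFinP; apply: measurable_funX; exact: measurable_modc. Qed.

Lemma Lp2_integrable h : Lp mu 2%:E h -> mu.-integrable setT (fun x => ((modc (h x)) ^+ 2)%:E).
Proof.
move=> /Lp2P[mh hoo]; apply/integrableP; split; first exact: measurable_sqr_modc.
under eq_integral do rewrite gee0_abs ?lee_fin ?sqr_ge0//.
exact: hoo.
Qed.

Lemma cintegrableM h k : Lp mu 2%:E h -> Lp mu 2%:E k -> cintegrable (fun x => h x * k x).
Proof.
move=> hL kL; have [mh _] := hL; have [mk _] := kL.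
have mhk := cmeasurableM mh mk.
have I2 := integrableD measurableT (Lp2_integrable hL) (Lp2_integrable kL).
have le x : modc (h x * k x) <= modc (h x) ^+ 2 + modc (k x) ^+ 2.
  rewrite Normc.normcM; have := sqr_ge0 (modc (h x) - modc (k x)); have := sqr_ge0 (modc (h x) + modc (k x)); nra.
have dom (g : X -> R) : measurable_fun setT g -> (forall x, `|g x| <= modc (h x * k x)) ->
    mu.-integrable setT (EFin \o g).
  move=> mg gle; apply: (le_integrable measurableT _ _ I2); first exact/measurable_EFinP.
  move=> x _ /=; rewrite lee_fin (le_trans (gle x))// (le_trans (le x))//.
  by rewrite ger0_norm// addr_ge0// sqr_ge0.
split=> //; case: (mhk) => mr mi; split; apply: dom => // x; [exact: ler_normRe|exact: ler_normIm].
Qed.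

Lemma Lp2J h : Lp mu 2%:E h -> Lp mu 2%:E (fun x => (h x)^*%C).
Proof.
move=> /Lp2P[mh hoo]; apply/Lp2P; split; first exact: cmeasurableJ.
by apply: le_lt_trans hoo; rewrite /sqi; under eq_integral do rewrite modcJ.
Qed.

Lemma L2fun_Lp (f : L2 mu) : Lp mu 2%:E (L2fun f).
Proof. by have := sqvalP (L2fun f); rewrite inE. Qed.

Lemma L2_ext (f g : L2 mu) : L2fun f = L2fun g %[ae mu] -> f = g.
Proof. by move=> fg; rewrite (L2funK f) (L2funK g); apply/eqP/L2_piP. Qed.

End complex_integral.

Section L2_inner.
Context d (X : measurableType d) (R : realType) (mu : {measure set X -> \bar R}).
Local Notation L2 := (L2 mu).
Implicit Types f g h : L2.

Lemma normL2E f : `|f| = (L2norm f)%:C.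
Proof. by []. Qed.

Lemma L2norm_ge0 f : 0 <= L2norm f.
Proof. by rewrite fine_ge0// Lnorm_ge0. Qed.

Lemma L2inner_cintegrable f g : cintegrable mu (fun x => L2fun f x * (L2fun g x)^*%C).
Proof. by apply: cintegrableM; [|apply: Lp2J]; exact: L2fun_Lp. Qed.

Lemma L2innerDl f g h : L2inner (f + g) h = L2inner f h + L2inner g h.
Proof.
rewrite /L2inner -cintegralD; try exact: L2inner_cintegrable.
apply: eq_cintegral.
- exact: (proj1 (L2inner_cintegrable _ _)).
- by apply: (proj1 (cintegrableD _ _)); exact: L2inner_cintegrable.
- by apply: filterS (L2funD f g) => x /(_ I) -> _; rewrite mulrDl.
Qed.

Lemma L2innerZl z f g : L2inner (z *: f) g = z * L2inner f g.
Proof.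
rewrite /L2inner -cintegralZ; try exact: L2inner_cintegrable.
apply: eq_cintegral.
- exact: (proj1 (L2inner_cintegrable _ _)).
- by apply: (proj1 (cintegrableZ _ _)); exact: L2inner_cintegrable.
- by apply: filterS (L2funZ z f) => x /(_ I) -> _; rewrite mulrA.
Qed.

Lemma L2innerJ f g : L2inner g f = (L2inner f g)^*%C.
Proof.
rewrite /L2inner -cintegralJ; last exact: L2inner_cintegrable.
by congr cintegral; apply/funext => x; rewrite conjcM conjcK mulrC.
Qed.

Lemma L2innerDr f g h : L2inner f (g + h) = L2inner f g + L2inner f h.
Proof. by rewrite L2innerJ L2innerDl conjcD -!L2innerJ. Qed.

Lemma L2innerZr z f g : L2inner f (z *: g) = z^*%C * L2inner f g.
Proof. by rewrite L2innerJ L2innerZl conjcM -L2innerJ. Qed.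

Lemma L2inner_self f : L2inner f f = (L2norm f ^+ 2)%:C.
Proof.
rewrite /L2inner; under [in LHS]eq_fun do rewrite mulcJ_modc.
rewrite /cintegral /=; congr (_ +i* _); last by rewrite (Rintegral_cst _ measurableT) mul0r.
by rewrite /Rintegral -[X in fine X]/(sqi mu (L2fun f)) -L2norm_sqr.
Qed.

Lemma L2inner0l g : L2inner 0 g = 0.
Proof. by rewrite -(scale0r (0 : L2)) L2innerZl mul0r. Qed.

Lemma L2inner0r g : L2inner g 0 = 0.
Proof. by rewrite L2innerJ L2inner0l conjc0. Qed.

Lemma L2innerNl f g : L2inner (- f) g = - L2inner f g.
Proof. by rewrite -scaleN1r L2innerZl mulN1r. Qed.

Lemma L2innerNr f g : L2inner f (- g) = - L2inner f g.
Proof. by rewrite L2innerJ L2innerNl conjcN -L2innerJ. Qed.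

Lemma L2innerBl f g h : L2inner (f - g) h = L2inner f h - L2inner g h.
Proof. by rewrite L2innerDl L2innerNl. Qed.

Lemma L2inner_suml (I : Type) (r : seq I) (P : pred I) (F : I -> L2) g :
  L2inner (\sum_(i <- r | P i) F i) g = \sum_(i <- r | P i) L2inner (F i) g.
Proof.
by elim/big_rec2: _ => [|i a b _ <-]; rewrite ?L2inner0l// L2innerDl.
Qed.

Lemma L2inner_sumr (I : Type) (r : seq I) (P : pred I) (F : I -> L2) g :
  L2inner g (\sum_(i <- r | P i) F i) = \sum_(i <- r | P i) L2inner g (F i).
Proof.
by elim/big_rec2: _ => [|i a b _ <-]; rewrite ?L2inner0r// L2innerDr.
Qed.

Lemma L2norm_eq0E f : L2norm f = 0 -> f = 0.
Proof. by move=> f0; apply: L2norm_eq0; rewrite f0. Qed.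

Lemma L2normZ_real (z : R[i]) f : L2norm (z *: f) = modc z * L2norm f.
Proof. by have := L2normZ z f; rewrite modcE -rmorphM => -[]. Qed.

Lemma L2normN f : L2norm (- f) = L2norm f.
Proof. by rewrite -scaleN1r L2normZ_real -(rmorphN1 (real_complex R)) modc_real normrN normr1 mul1r. Qed.

Lemma L2norm0 : L2norm (0 : L2) = 0.
Proof. by rewrite -(scale0r (0 : L2)) L2normZ_real modc_real normr0 mul0r. Qed.

Lemma sqr_L2normD f g :
  L2norm (f + g) ^+ 2 = L2norm f ^+ 2 + 2 * complex.Re (L2inner f g) + L2norm g ^+ 2.
Proof.
have := L2inner_self (f + g); rewrite L2innerDl !L2innerDr !L2inner_self (L2innerJ f g).
move=> /(congr1 (@complex.Re R)); rewrite !ReD.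
by case: (L2inner f g) => a b /= <-; ring.
Qed.

Lemma sqr_L2normB f g :
  L2norm (f - g) ^+ 2 = L2norm f ^+ 2 - 2 * complex.Re (L2inner f g) + L2norm g ^+ 2.
Proof.
by rewrite sqr_L2normD L2normN L2innerNr; case: (L2inner f g) => a b /=; ring.
Qed.

Lemma L2normD f g : L2norm (f + g) <= L2norm f + L2norm g.
Proof. by have := ler_L2normD f g; rewrite -rmorphD lecR. Qed.

Lemma cauchy_schwarz f g : modc (L2inner f g) <= L2norm f * L2norm g.
Proof.
have [g0|g0] := eqVneq (L2norm g) 0.
  by rewrite (L2norm_eq0E g0) L2inner0r L2norm0 mulr0 modc_real normr0.
have gp : 0 < L2norm g by rewrite lt_neqAle eq_sym g0 L2norm_ge0.
(* [t *: g] is the orthogonal projection of [f] on the line of [g], the choice that makes the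
   squared distance smallest. *)
pose z := L2inner f g; pose t := z * ((L2norm g ^+ 2)^-1)%:C.
have := sqr_ge0 (L2norm (f - t *: g)).
rewrite sqr_L2normB L2innerZr L2normZ_real -/z.
have -> : t^*%C * z = (modc z ^+ 2 / L2norm g ^+ 2)%:C.
  rewrite /t conjcM mulrAC [_^*%C * z]mulrC mulcJ_modc; apply/eqP.
  by rewrite eq_complex /=; apply/andP; split; apply/eqP; ring.
have -> : modc t = modc z / L2norm g ^+ 2.
  by rewrite /t Normc.normcM modc_real ger0_norm// invr_ge0 sqr_ge0.
move=> H; rewrite -ler_sqr ?nnegrE ?modc_ge0// ?mulr_ge0 ?L2norm_ge0//.
rewrite exprMn -ler_pdivrMr ?exprn_gt0//; move: H.
have -> : (modc z / L2norm g ^+ 2 * L2norm g) ^+ 2 = modc z ^+ 2 / L2norm g ^+ 2.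
  by field.
by rewrite /=; lra.
Qed.

End L2_inner.

(** * Multiplication operators and standard projections *)

Section multiplication.
Context d (X : measurableType d) (R : realType) (mu : {measure set X -> \bar R}).
Local Notation L2 := (L2 mu).
Implicit Types f g h : L2.

Lemma aeI (A B : X -> Prop) : {ae mu, forall x, A x} -> {ae mu, forall x, B x} ->
  {ae mu, forall x, A x /\ B x}.
Proof. by move=> a b; apply: filterS2 a b. Qed.

Lemma L2funDx f g : {ae mu, forall x, L2fun (f + g) x = L2fun f x + L2fun g x}.
Proof. by apply: filterS (L2funD f g) => x /(_ I). Qed.

Lemma L2funZx z f : {ae mu, forall x, L2fun (z *: f) x = z * L2fun f x}.
Proof. by apply: filterS (L2funZ z f) => x /(_ I). Qed.

Lemma L2funBx f g : {ae mu, forall x, L2fun (f - g) x = L2fun f x - L2fun g x}.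
Proof.
rewrite -scaleN1r; apply: filterS2 (L2funDx f (-1 *: g)) (L2funZx (-1) g) => x -> ->.
by rewrite mulN1r.
Qed.

Lemma mulopx phi f : Lp mu +oo phi -> {ae mu, forall x, L2fun (mulop mu phi f) x = phi x * L2fun f x}.
Proof. by move=> hp; apply: filterS (mulopE f hp) => x /(_ I). Qed.

Lemma LinftyP (phi : X -> R[i]) : Lp mu +oo phi <->
  cmeasurable phi /\ exists M : R, {ae mu, forall x, modc (phi x) <= M}.
Proof.
split=> [H|[mphi [M hM]]]; first by split; [case: H|exact: Linfty_bounded].
split=> //; rewrite /finite_norm unlock /Lnorm; case: ifPn => // _.
apply: (@le_lt_trans _ _ M%:E); last by rewrite ltry.
apply/ess_supP; apply: filterS hM => x /= hx.
by rewrite lee_fin ger0_norm// modc_ge0.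
Qed.

Lemma LinftyM (phi psi : X -> R[i]) : Lp mu +oo phi -> Lp mu +oo psi ->
  Lp mu +oo (fun x => phi x * psi x).
Proof.
move=> /LinftyP[mp [M hM]] /LinftyP[mq [N hN]]; apply/LinftyP; split.
  exact: cmeasurableM.
exists (M * N); apply: filterS2 hM hN => x hM hN.
by rewrite Normc.normcM ler_pM ?modc_ge0.
Qed.

Lemma LinftyJ (phi : X -> R[i]) : Lp mu +oo phi -> Lp mu +oo (fun x => (phi x)^*%C).
Proof.
move=> /LinftyP[mp [M hM]]; apply/LinftyP; split; first exact: cmeasurableJ.
by exists M; apply: filterS hM => x; rewrite modcJ.
Qed.

Lemma mulopP phi z f g : Lp mu +oo phi ->
  mulop mu phi (z *: f + g) = z *: mulop mu phi f + mulop mu phi g.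
Proof.
move=> hp; apply: L2_ext.
have e1 := aeI (mulopx (z *: f + g) hp) (aeI (mulopx f hp) (mulopx g hp)).
have e2 := aeI (L2funDx (z *: mulop mu phi f) (mulop mu phi g)) (L2funZx z (mulop mu phi f)).
have e3 := aeI (L2funDx (z *: f) g) (L2funZx z f).
apply: filterS3 e1 e2 e3 => x [-> [e2 e3]] [-> ->] [-> ->] _.
by rewrite e2 e3 mulrDr !mulrA (mulrC z).
Qed.

Lemma mulopM phi psi f : Lp mu +oo phi -> Lp mu +oo psi ->
  mulop mu phi (mulop mu psi f) = mulop mu (fun x => phi x * psi x) f.
Proof.
move=> hp hq; apply: L2_ext.
apply: filterS3 (mulopE (mulop mu psi f) hp) (mulopE f hq) (mulopE f (LinftyM hp hq)) => x.
by move=> /(_ I) e1 /(_ I) e2 /(_ I) e3 _; rewrite e1 e2 e3 mulrA.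
Qed.

Lemma mulopC phi psi f : Lp mu +oo phi -> Lp mu +oo psi ->
  mulop mu phi (mulop mu psi f) = mulop mu psi (mulop mu phi f).
Proof.
move=> hp hq; rewrite !mulopM//; congr mulop.
by apply/funext => x; rewrite mulrC.
Qed.

Lemma L2inner_mulop phi f g : Lp mu +oo phi ->
  L2inner (mulop mu phi f) g = L2inner f (mulop mu (fun x => (phi x)^*%C) g).
Proof.
move=> hp; rewrite /L2inner; apply: eq_cintegral.
- exact: (proj1 (L2inner_cintegrable _ _)).
- exact: (proj1 (L2inner_cintegrable _ _)).
- apply: filterS2 (mulopE f hp) (mulopE g (LinftyJ hp)) => x /(_ I) e1 /(_ I) e2 _.
  by rewrite e1 e2 conjcM conjcK mulrA (mulrC (phi x)).
Qed.

Lemma L2norm_mulop phi f (M : R) : Lp mu +oo phi -> {ae mu, forall x, modc (phi x) <= M} ->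
  0 <= M -> L2norm (mulop mu phi f) <= M * L2norm f.
Proof.
move=> hp hM M0; rewrite -ler_sqr ?nnegrE ?mulr_ge0 ?L2norm_ge0//.
rewrite -lee_fin L2norm_sqr exprMn EFinM L2norm_sqr /sqi -ge0_integralZl//; last 3 first.
- exact/measurable_sqr_modc/sqfun_cmeasurable.
- by move=> x _; rewrite lee_fin sqr_ge0.
- by rewrite lee_fin sqr_ge0.
apply: ae_ge0_le_integral => //.
- by move=> x _; rewrite lee_fin sqr_ge0.
- exact/measurable_sqr_modc/sqfun_cmeasurable.
- by move=> x _; rewrite mule_ge0// lee_fin sqr_ge0.
- by apply: measurable_funeM; exact/measurable_sqr_modc/sqfun_cmeasurable.
apply: filterS2 hM (mulopE f hp) => x hM /(_ I) -> _.
by rewrite -EFinM lee_fin Normc.normcM exprMn ler_wpM2r ?sqr_ge0// lerXn2r ?nnegrE ?modc_ge0.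
Qed.

End multiplication.

Section projections.
Context d (X : measurableType d) (R : realType) (mu : {measure set X -> \bar R}).
Local Notation L2 := (L2 mu).
Local Notation P := (stdproj mu).
Implicit Types (f g h : L2) (E F : set X).

Lemma stdprojE E f : measurable E ->
  {ae mu, forall x, L2fun (P E f) x = if x \in E then L2fun f x else 0}.
Proof.
move=> mE; apply: filterS (mulopE f (Linfty_indic mu mE)) => x /(_ I) ->.
by rewrite indicE; case: ifP => _; rewrite ?mul1r ?mul0r.
Qed.

Lemma stdprojP E z f g : measurable E -> P E (z *: f + g) = z *: P E f + P E g.
Proof. by move=> mE; apply/mulopP/Linfty_indic. Qed.

Lemma stdproj0 E : measurable E -> P E 0 = 0.
Proof. by move=> mE; have := stdprojP (-1) 0 0 mE; rewrite scaler0 addr0 scaleN1r addNr. Qed.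

Lemma stdprojD E f g : measurable E -> P E (f + g) = P E f + P E g.
Proof. by move=> mE; have := stdprojP 1 f g mE; rewrite !scale1r. Qed.

Lemma stdprojZ E z f : measurable E -> P E (z *: f) = z *: P E f.
Proof. by move=> mE; have := stdprojP z f 0 mE; rewrite stdproj0// !addr0. Qed.

Lemma stdprojB E f g : measurable E -> P E (f - g) = P E f - P E g.
Proof. by move=> mE; rewrite stdprojD// -scaleN1r stdprojZ// scaleN1r. Qed.

Lemma stdproj_sum E (I : Type) (r : seq I) (Q : pred I) (F : I -> L2) : measurable E ->
  P E (\sum_(i <- r | Q i) F i) = \sum_(i <- r | Q i) P E (F i).
Proof.
by move=> mE; elim/big_rec2: _ => [|i a b _ <-]; rewrite ?stdproj0// stdprojD.
Qed.

Lemma stdprojI E F f : measurable E -> measurable F -> P E (P F f) = P (E `&` F) f.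
Proof.
move=> mE mF; apply: L2_ext.
apply: filterS3 (stdprojE (P F f) mE) (stdprojE f mF) (stdprojE f (measurableI _ _ mE mF)) => x.
by move=> -> -> -> _; rewrite in_setI; case: (x \in E); case: (x \in F).
Qed.

Lemma stdproj_id E f : measurable E -> P E (P E f) = P E f.
Proof. by move=> mE; rewrite stdprojI// setIid. Qed.

Lemma stdprojT f : P setT f = f.
Proof. by apply: L2_ext; apply: filterS (stdprojE f measurableT) => x -> _; rewrite in_setT. Qed.

Lemma L2inner_stdproj E f g : measurable E -> L2inner (P E f) g = L2inner f (P E g).
Proof.
move=> mE; rewrite [LHS]L2inner_mulop; last exact: Linfty_indic.
by congr (L2inner f (mulop mu _ g)); apply/funext => x; rewrite /= oppr0.
Qed.

Lemma L2norm_stdproj E f : measurable E -> L2norm (P E f) <= L2norm f.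
Proof.
move=> mE; rewrite -[leRHS]mul1r; apply: L2norm_mulop => //; first exact: Linfty_indic.
by apply: aeW => x; rewrite modc_real ger0_norm//; rewrite indicE; case: (x \in E).
Qed.

Lemma eq_stdproj E f g : measurable E ->
  {ae mu, forall x, E x -> L2fun f x = L2fun g x} -> P E f = P E g.
Proof.
move=> mE h; apply: L2_ext.
apply: filterS3 h (stdprojE f mE) (stdprojE g mE) => x h -> -> _.
by case: ifPn => // /set_mem/h.
Qed.

Lemma stdproj_null E f : measurable E -> mu E = 0%E -> P E f = 0.
Proof.
move=> mE E0; rewrite -(stdproj0 mE); apply: eq_stdproj => //.
by exists E; split => // x /= h; apply: contrapT => nE; apply: h.
Qed.

Lemma stdproj_fixP E f : measurable E ->
  P E f = f <-> {ae mu, forall x, ~ E x -> L2fun f x = 0}.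
Proof.
move=> mE; split=> [<-|h].
  by apply: filterS (stdprojE f mE) => x -> nE; rewrite memNset.
apply: L2_ext; apply: filterS2 h (stdprojE f mE) => x h -> _.
by case: ifPn => // /negP nE; rewrite h// => /mem_set.
Qed.

Lemma range_stdprojP E f : measurable E -> range (P E) f <-> P E f = f.
Proof. by move=> mE; split=> [[g _ <-]|<-]; [exact: stdproj_id|exists f]. Qed.

Lemma stdprojU E F f : measurable E -> measurable F -> E `&` F = set0 ->
  P (E `|` F) f = P E f + P F f.
Proof.
move=> mE mF EF; apply: L2_ext.
have e := aeI (L2funDx (P E f) (P F f)) (stdprojE f (measurableU _ _ mE mF)).
apply: filterS3 e (stdprojE f mE) (stdprojE f mF) => x [-> ->] eE eF _.
rewrite eE eF in_setU.
have [xE|] := boolP (x \in E); have [xF|] := boolP (x \in F) => //=; rewrite ?addr0 ?add0r//.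
by have : set0 x by rewrite -EF; split; exact: set_mem.
Qed.

Lemma stdproj_sub E F f : measurable E -> measurable F -> E `<=` F -> P E f = f -> P F f = f.
Proof.
move=> mE mF EF /(stdproj_fixP _ mE) h; apply/stdproj_fixP => //.
by apply: filterS h => x h nF; apply: h => /EF.
Qed.

End projections.

(** * Completeness and Riesz representation *)

Section real_sequences.
Variable R : realType.

Lemma half_pow_lt (c e : R) : 0 < e -> exists N, c * 2^-1 ^+ N < e.
Proof.
move=> e0; have [c0|c0] := leP c 0.
  by exists 0%N; rewrite expr0 mulr1 (le_lt_trans c0).
exists (Num.Def.archi_bound (c / e)); set N := Num.Def.archi_bound _.
rewrite exprVn ltr_pdivrMr ?exprn_gt0// mulrC -ltr_pdivrMr//.
have := archi_boundP (ltW (divr_gt0 c0 e0)); rewrite -/N => /lt_le_trans; apply.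
by rewrite -natrX ler_nat ltnW// ltn_expl.
Qed.

Lemma half_pow_cauchy (u : nat -> R) (c : R) :
  (forall m l, (m <= l)%N -> `|u l - u m| <= c * 2^-1 ^+ m) ->
  exists2 a, u @ \oo --> a & forall m, `|a - u m| <= c * 2^-1 ^+ m.
Proof.
move=> uc; have cu : cvgn u.
  have cF : cauchy_ex (u @ \oo).
    move=> e e0; have [N Ne] := half_pow_lt c e0; exists (u N); exists N => // l /= Nl.
    by rewrite /ball /= distrC; apply: le_lt_trans Ne; exact: uc.
  apply: R_complete; exact: cauchy_exP cF.
exists (limn u) => // m; apply: (@ler_cvg_to _ \oo _ R (fun l => `|u l - u m|) (cst (c * 2^-1 ^+ m))).
- by apply: cvg_norm; apply: cvgB => //; exact: cvg_cst.
- exact: cvg_cst.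
- by exists m => // l /= ml; exact: uc.
Qed.

End real_sequences.

Section completeness.
Context d (X : measurableType d) (R : realType) (mu : {measure set X -> \bar R}).
Local Notation L2 := (L2 mu).

Lemma eq_sqi (h k : X -> R[i]) : cmeasurable h -> cmeasurable k ->
  {ae mu, forall x, h x = k x} -> sqi mu h = sqi mu k.
Proof.
move=> mh mk hk; apply: ge0_ae_eq_integral => //; try exact: measurable_sqr_modc.
- by move=> x _; rewrite lee_fin sqr_ge0.
- by move=> x _; rewrite lee_fin sqr_ge0.
- by apply: filterS hk => x -> _.
Qed.

Lemma L2norm_class_le (h : X -> R[i]) (c : R) : cmeasurable h -> (sqi mu h <= c%:E)%E ->
  Lp mu 2%:E h /\ L2norm (L2class mu h) ^+ 2 <= c.
Proof.
move=> mh hc; have hL : Lp mu 2%:E h by apply/Lp2P; split=> //; exact: le_lt_trans hc (ltry _).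
split=> //; rewrite -lee_fin L2norm_sqr (@eq_sqi _ h)//; first exact: sqfun_cmeasurable.
by apply: filterS (L2classK hL) => x /(_ I).
Qed.

Lemma telescope_bound (phi : nat -> R[i]) (h : R) : 0 <= h ->
  (forall k, 4 ^+ k * modc (phi k.+1 - phi k) ^+ 2 <= h) ->
  forall m l, (m <= l)%N -> modc (phi l - phi m) <= 2 * Num.sqrt h * 2^-1 ^+ m.
Proof.
move=> h0 hh m l ml; set s := Num.sqrt h.
have s0 : 0 <= s by rewrite sqrtr_ge0.
have step k : modc (phi k.+1 - phi k) <= s * 2^-1 ^+ k.
  rewrite -ler_sqr ?nnegrE ?modc_ge0 ?mulr_ge0 ?exprn_ge0 ?invr_ge0//.
  rewrite exprMn sqr_sqrtr// exprVn exprVn ler_pdivlMr ?exprn_gt0// mulrC.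
  by rewrite -exprM mulnC exprM -natrX hh.
(* Subtracting the tail beyond [l] gives a bound that is additive in the increments, hence suited to
   induction. *)
suff : modc (phi l - phi m) <= 2 * s * (2^-1 ^+ m - 2^-1 ^+ l).
  move=> /le_trans; apply; rewrite ler_wpM2l ?mulr_ge0// lerBlDr lerDl.
  by rewrite exprn_ge0// invr_ge0.
rewrite -(subnK ml); elim: (l - m)%N => [|k IH].
  by rewrite add0n !subrr mulr0 modc_real normr0.
rewrite addSn; set j := (k + m)%N in IH *.
rewrite -(subrKA (phi j)) (le_trans (modcD _ _))//.
apply: (le_trans (lerD (step j) IH)); rewrite exprS; lra.
Qed.

Lemma cmeasurableB (h k : X -> R[i]) : cmeasurable h -> cmeasurable k ->
  cmeasurable (fun x => h x - k x).
Proof.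
move=> mh mk; have -> : (fun x => h x - k x) = h + (fun x => (-1) * k x).
  by apply/funext => x; rewrite -[RHS]/(h x + (-1) * k x) mulN1r.
by apply: cmeasurableD => //; apply: cmeasurableM => //; exact: cmeasurable_cst.
Qed.

(** Only rapidly converging sequences are treated, with an explicit rate. The factor [8 ^+ k] of the
    hypothesis absorbs the weight [4 ^+ k] in [D] and leaves a geometric series, so that [H] has
    integral at most 2. Pointwise the increments are at most [2^-1 ^+ k] times the square root of
    [H]. Summing a tail doubles this, which gives 4 in the square; real and imaginary parts together
    give 8, and integrating [H] gives 16. *)
Lemma L2_complete (f : nat -> L2) :
  (forall k, 8 ^+ k * L2norm (f k.+1 - f k) ^+ 2 <= 1) ->
  exists g, forall m, L2norm (g - f m) ^+ 2 <= 16 * 4^-1 ^+ m.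
Proof.
move=> hf; pose phi k := L2fun (f k) : X -> R[i].
have mphi k : cmeasurable (phi k) by exact: sqfun_cmeasurable.
have mdphi k l : cmeasurable (fun x => phi k x - phi l x).
  exact: cmeasurableB.
pose D k x : \bar R := (4 ^+ k * modc (phi k.+1 x - phi k x) ^+ 2)%:E.
have mD k : measurable_fun setT (D k).
  apply/measurable_EFinP; apply: measurable_funM => //.
  by apply: measurable_funX; exact: measurable_modc.
have D0 k x : (0 <= D k x)%E by rewrite lee_fin mulr_ge0 ?exprn_ge0 ?sqr_ge0 ?modc_ge0.
pose H x : \bar R := (\sum_(0 <= k <oo) D k x)%E.
have mH : measurable_fun setT H.
  by apply: ge0_emeasurable_sum => [k x _ _|k _]; [exact: D0|exact: mD].
have H0 x : (0 <= H x)%E by apply: nneseries_ge0.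
have iH : (\int[mu]_x H x <= 2%:E)%E.
  rewrite integral_nneseries//; apply: le_trans (epsilon_trick0 xpredT (ler0n R 2)).
  apply: lee_nneseries => k _; first by rewrite integral_ge0.
  rewrite /D; under eq_integral do rewrite EFinM.
  rewrite ge0_integralZl//; last 2 first.
  - exact: (measurable_sqr_modc (mdphi _ _)).
  - by move=> x _; rewrite lee_fin sqr_ge0.
  rewrite -/(sqi mu (fun x => phi k.+1 x - phi k x)).
  rewrite -(@eq_sqi (L2fun (f k.+1 - f k)))//; first last.
  - exact: L2funBx.
  - exact: sqfun_cmeasurable.
  rewrite -L2norm_sqr -EFinM lee_fin ler_pdivlMr ?ltr0n ?expn_gt0// natrX [2 ^+ k.+1]exprS.
  have := hf k; rewrite (_ : 8 ^+ k = 4 ^+ k * 2 ^+ k).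
    move: (4 ^+ k) (2 ^+ k) (L2norm _) => a b c h.
    by lra.
  by rewrite -exprMn -natrM.
have [A [mA A0 AH]] : exists A, [/\ measurable A, mu A = 0%E & forall x, ~ A x -> (H x < +oo)%E].
  have Hi : mu.-integrable setT H.
    apply/integrableP; split=> //; under eq_integral do rewrite gee0_abs//.
    exact: le_lt_trans iH (ltry _).
  have [A [mA A0 AH]] := integrable_ae measurableT Hi.
  exists A; split=> // x nA; apply: contrapT => Hx; apply: nA; apply: AH => /= /(_ I).
  by rewrite ge0_fin_numE.
have nA k x : ~ A x -> 4 ^+ k * modc (phi k.+1 x - phi k x) ^+ 2 <= fine (H x).
  move=> nA; rewrite -lee_fin fineK ?ge0_fin_numE ?AH//.
  apply: le_trans (nneseries_lim_ge k.+1 _); last by move=> i _ _; exact: D0.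
  by rewrite big_nat_recr//= leeDr// sume_ge0.
have fH0 x : 0 <= fine (H x) by rewrite fine_ge0.
(* On the null set where [H] may be infinite the representatives are replaced by 0, so that
   convergence holds at every point and the limit is measurable. *)
pose psi k x := if x \in A then 0 else phi k x.
have bnd x m l : (m <= l)%N -> modc (psi l x - psi m x) <= 2 * Num.sqrt (fine (H x)) * 2^-1 ^+ m.
  rewrite /psi; case: ifPn => [_ _|/negP xA].
    by rewrite subrr modc_real normr0 !mulr_ge0 ?sqrtr_ge0 ?exprn_ge0 ?invr_ge0.
  by apply: (@telescope_bound (phi^~ x)) => // k; apply: nA => /mem_set.
have Hgr x : exists a : R, (fun k => complex.Re (psi k x)) @ \oo --> a /\
    forall m, `|a - complex.Re (psi m x)| <= 2 * Num.sqrt (fine (H x)) * 2^-1 ^+ m.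
  have [m l ml|a] := @half_pow_cauchy R (fun k => complex.Re (psi k x)) (2 * Num.sqrt (fine (H x))).
    apply: le_trans (bnd x m l ml); apply: le_trans (ler_normRe _); rewrite ReD.
    by case: (psi m x).
  by exists a.
have [gr grP] := choice Hgr.
have Hgi x : exists a : R, (fun k => complex.Im (psi k x)) @ \oo --> a /\
    forall m, `|a - complex.Im (psi m x)| <= 2 * Num.sqrt (fine (H x)) * 2^-1 ^+ m.
  have [m l ml|a] := @half_pow_cauchy R (fun k => complex.Im (psi k x)) (2 * Num.sqrt (fine (H x))).
    apply: le_trans (bnd x m l ml); apply: le_trans (ler_normIm _); rewrite ImD.
    by case: (psi m x).
  by exists a.
have [gi giP] := choice Hgi.
have mpsi k : cmeasurable (psi k).
  rewrite (_ : psi k = fun x => (\1_(~` A) x)%:C * phi k x).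
    by apply: cmeasurableM => //; case: (Linfty_indic mu (measurableC mA)).
  by apply/funext => x; rewrite /psi indicE in_setC; case: (x \in A); rewrite ?mul0r ?mul1r.
pose g x := gr x +i* gi x.
have mg : cmeasurable g.
  split; rewrite /g /=.
    by apply: (@measurable_fun_cvg _ _ _ _ (fun k x => complex.Re (psi k x))) => [k|x _]; [case: (mpsi k)|case: (grP x)].
  by apply: (@measurable_fun_cvg _ _ _ _ (fun k x => complex.Im (psi k x))) => [k|x _]; [case: (mpsi k)|case: (giP x)].
have gpsi m x : modc (g x - psi m x) ^+ 2 <= 8 * 4^-1 ^+ m * fine (H x).
  have b0 : 0 <= 2 * Num.sqrt (fine (H x)) * 2^-1 ^+ m.
    by rewrite !mulr_ge0 ?sqrtr_ge0 ?exprn_ge0 ?invr_ge0.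
  have sq (a : R) : `|a| <= 2 * Num.sqrt (fine (H x)) * 2^-1 ^+ m -> a ^+ 2 <= 4 * 4^-1 ^+ m * fine (H x).
    rewrite -ler_sqr ?nnegrE// real_normK ?num_real// !exprMn sqr_sqrtr// => /le_trans; apply.
    rewrite -exprM mulnC exprM (_ : (2^-1 ^+ 2) = 4^-1 :> R); last by rewrite exprVn -natrX.
    by rewrite -natrX mulrAC.
  rewrite sqr_modc !ReD !ImD.
  have -> : complex.Re (- psi m x) = - complex.Re (psi m x) by case: (psi m x).
  have -> : complex.Im (- psi m x) = - complex.Im (psi m x) by case: (psi m x).
  have [_ /(_ m)/sq h1] := grP x; have [_ /(_ m)/sq h2] := giP x.
  by rewrite /g /=; move: h1 h2; lra.
have mgphi m : cmeasurable (fun x => g x - phi m x).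
  exact: cmeasurableB.
have gphi m : (sqi mu (fun x => (g x - phi m x)%R) <= (16 * 4^-1 ^+ m)%:E)%E.
  apply: (@le_trans _ _ (\int[mu]_x ((8 * 4^-1 ^+ m)%:E * H x))%E).
    apply: ae_ge0_le_integral => //.
    - by move=> x _; rewrite lee_fin sqr_ge0.
    - exact: measurable_sqr_modc.
    - by move=> x _; rewrite mule_ge0// lee_fin mulr_ge0// exprn_ge0// invr_ge0.
    - exact: measurable_funeM.
    - exists A; split=> // x /= h; apply: contrapT => nAx; apply: h => _.
      have := gpsi m x; rewrite /psi memNset// => le.
      by rewrite -[H x]fineK ?ge0_fin_numE ?AH// -EFinM lee_fin.
  rewrite ge0_integralZl//.
  rewrite (_ : 16 * _ = 8 * 4^-1 ^+ m * 2); last by ring.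
  by rewrite [leRHS]EFinM lee_pmul// ?integral_ge0// lee_fin mulr_ge0// exprn_ge0// invr_ge0.
have [gL _] := L2norm_class_le (mgphi 0%N) (gphi 0%N).
(* What the estimate shows to be square-integrable is [g - phi 0], not yet [g]; the limit is
   assembled from the class of this difference. *)
exists (L2class mu (fun x => g x - phi 0 x) + f 0) => m.
rewrite -lee_fin L2norm_sqr; apply: le_trans (gphi m).
rewrite (@eq_sqi _ (fun x => g x - phi m x))//; first exact: sqfun_cmeasurable.
have e1 := aeI (L2funBx (L2class mu (fun x => g x - phi 0 x) + f 0) (f m))
  (L2funDx (L2class mu (fun x => g x - phi 0 x)) (f 0)).
apply: filterS2 e1 (L2classK gL) => x [-> ->] /(_ I) ->.
by rewrite /phi subrK.
Qed.

End completeness.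

Section riesz.
Context d (X : measurableType d) (R : realType) (mu : {measure set X -> \bar R}).
Local Notation L2 := (L2 mu).
Local Notation N := (@L2norm _ _ _ mu).

(** The representing vector maximizes [Q f = 2 * re f - N f ^+ 2], which is bounded by [M ^+ 2]. The
    parallelogram law makes a maximizing sequence converge, and stationarity of [Q] at the maximum
    is the identity for real parts. Applying it to ['i%C *: h] yields the imaginary parts. *)
Theorem riesz_representation (c : L2 -> R[i]) (M : R) :
  (forall z f g, c (z *: f + g) = z * c f + c g) ->
  (forall f, modc (c f) <= M * N f) ->
  exists g, forall f, c f = L2inner f g.
Proof.
move=> clin cM; pose re (f : L2) : R := complex.Re (c f).
have c0 : c 0 = 0 by have := clin (-1) 0 0; rewrite scaler0 addr0 mulN1r addNr.
have cD f g : c (f + g) = c f + c g by have := clin 1 f g; rewrite scale1r mul1r.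
have cZ z f : c (z *: f) = z * c f by have := clin z f 0; rewrite !addr0 c0 addr0.
have reD f g : re (f + g) = re f + re g by rewrite /re cD ReD.
have reZ (t : R) f : re (t%:C *: f) = t * re f by rewrite /re cZ ReM /= mul0r subr0.
have reM f : `|re f| <= M * N f by apply: le_trans (cM f); exact: ler_normRe.
pose Q f := 2 * re f - N f ^+ 2.
have Qub f : Q f <= M ^+ 2.
  have := sqr_ge0 (M - N f); have := reM f; rewrite ler_norml => /andP[_].
  by rewrite /Q; move: (re f) (N f) => a b; nra.
pose s := sup (range Q).
have hs : has_sup (range Q).
  by split; [exists (Q 0), 0|exists (M ^+ 2) => _ [f _ <-]].
have Qs f : Q f <= s by apply: (ub_le_sup hs.2); exists f.
(* The defect [8^-1 ^+ k.+1] is chosen so that [par] gives the increments the decay demanded by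
   [L2_complete]. *)
have Hf k : exists h : L2, s - 8^-1 ^+ k.+1 < Q h.
  have p8 : 0 < 8^-1 ^+ k.+1 :> R by rewrite exprn_gt0// invr_gt0.
  by have [_ [h _ <-] hs'] := sup_adherent p8 hs; exists h.
have [f fP] := choice Hf.
have par f1 f2 : N (f1 - f2) ^+ 2 <= 4 * s - 2 * (Q f1 + Q f2).
  have := Qs ((2^-1 : R)%:C *: (f1 + f2)).
  rewrite /Q reZ reD L2normZ_real modc_real ger0_norm ?invr_ge0// exprMn sqr_L2normD sqr_L2normB.
  move: (complex.Re _) (re f1) (re f2) (N f1 ^+ 2) (N f2 ^+ 2) => a b e p q; lra.
have fc k : 8 ^+ k * N (f k.+1 - f k) ^+ 2 <= 1.
  have h8 : 0 < 8 ^+ k :> R by rewrite exprn_gt0.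
  rewrite -ler_pdivlMl// mulr1.
  apply: (le_trans (par _ _)); have := fP k; have := fP k.+1.
  rewrite -exprVn !exprS; have : 0 < 8^-1 ^+ k :> R by rewrite exprn_gt0// invr_gt0.
  move: (8^-1 ^+ k) (Q (f k)) (Q (f k.+1)) => a b e; lra.
have [g gP] := L2_complete fc.
have Qg : s <= Q g.
  rewrite -subr_le0 leNgt; apply/negP => e0.
  (* With [e = g - f m] and [N e <= 4 * 2^-1 ^+ m], the constant collects the defect of [f m] (1),
     the terms linear in [N e] (factor 4) and three copies of [N e ^+ 2] (16 each), all measured in
     units of [2^-1 ^+ m]. *)
  pose C := 1 + (2 * `|M| + 2 * N g) * 4 + 3 * 16.
  have [m] := half_pow_lt C e0; apply/negP; rewrite -leNgt.
  set e := g - f m; have ge : g = f m + e by rewrite /e addrC subrK.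
  have Ne : N e <= 4 * 2^-1 ^+ m.
    rewrite -ler_sqr ?nnegrE ?L2norm_ge0 ?mulr_ge0 ?exprn_ge0 ?invr_ge0//.
    apply: (le_trans (gP m)); rewrite exprMn -exprM mulnC exprM.
    rewrite (_ : (2^-1 ^+ 2) = 4^-1 :> R); last by rewrite exprVn -natrX.
    by rewrite -natrX.
  have h1 : 0 < 2^-1 ^+ m :> R by rewrite exprn_gt0// invr_gt0.
  have h2 : 2^-1 ^+ m <= 1 :> R by rewrite exprn_ile1// ?invr_ge0// invf_le1// ler1n.
  have h8 : 8^-1 ^+ m.+1 <= 2^-1 ^+ m :> R.
    rewrite exprS; have : 8^-1 ^+ m <= 2^-1 ^+ m :> R.
      by rewrite lerXn2r ?nnegrE ?invr_ge0// lef_pV2 ?posrE// ler_nat.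
    have : 0 < 8^-1 ^+ m :> R by rewrite exprn_gt0// invr_gt0.
    move: (8^-1 ^+ m) (2^-1 ^+ m) => a b; lra.
  have e0' := L2norm_ge0 e; have g0 := L2norm_ge0 g; have M0 := normr_ge0 M.
  have h3 := fP m; have h4 : Q g = Q (f m) + 2 * re e - 2 * complex.Re (L2inner (f m) e) - N e ^+ 2.
    by rewrite /Q {1 2}ge reD sqr_L2normD; ring.
  have h5 : - (`|M| * N e) <= re e.
    have := reM e; rewrite ler_norml => /andP[+ _].
    by apply: le_trans; rewrite lerN2 ler_wpM2r// ler_norm.
  have h6 : complex.Re (L2inner (f m) e) <= (N g + N e) * N e.
    apply: (le_trans (ler_norm _)); apply: (le_trans (ler_normRe _)).
    apply: (le_trans (cauchy_schwarz _ _)); rewrite ler_wpM2r//.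
    have -> : f m = g + (- e) by rewrite ge addrK.
    by apply: (le_trans (L2normD _ _)); rewrite L2normN.
  have h7 : `|M| * N e <= `|M| * (4 * 2^-1 ^+ m) by rewrite ler_wpM2l.
  have h9 : N g * N e <= N g * (4 * 2^-1 ^+ m) by rewrite ler_wpM2l.
  have h10 : N e ^+ 2 <= 16 * 2^-1 ^+ m.
    apply: (@le_trans _ _ ((4 * 2^-1 ^+ m) ^+ 2)).
      by rewrite lerXn2r ?nnegrE// mulr_ge0// ltW.
    rewrite exprMn -natrX ler_wpM2l// expr2 ler_piMr// ltW.
  rewrite /C h4; move: h3 h5 h6 h7 h8 h9 h10 h1.
  move: (8^-1 ^+ m.+1) (2^-1 ^+ m) (N e) (N g) `|M| (re e) (complex.Re _) (Q (f m)) => a b n1 n2 k1 k2 k3 k4; nra.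
exists g.
have key h : re h = complex.Re (L2inner h g).
  pose a := re h - complex.Re (L2inner h g); pose b := N h ^+ 2.
  have b0 : 0 <= b by exact: sqr_ge0.
  have ht (t : R) : 2 * t * a - t ^+ 2 * b <= 0.
    have : Q (g + t%:C *: h) <= Q g by exact: le_trans (Qs _) Qg.
    rewrite /Q reD reZ sqr_L2normD L2normZ_real modc_real exprMn real_normK ?num_real//.
    have -> : complex.Re (L2inner g (t%:C *: h)) = t * complex.Re (L2inner h g).
      by rewrite L2innerJ L2innerZl; case: (L2inner h g) => p q /=; ring.
    by rewrite /a /b; move: (re g) (re h) (complex.Re _) => p q r; lra.
  suff a0 : a = 0 by apply/eqP; rewrite -subr_eq0 -/a a0.
  have b1 : 0 < b + 1 by rewrite ltr_wpDl.
  (* The quadratic in [t] is nonpositive everywhere; the near-optimal [t] has [b + 1] in place of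
     [b] so that [b = 0] needs no separate case. *)
  have := ht (a / (b + 1)).
  have -> : 2 * (a / (b + 1)) * a - (a / (b + 1)) ^+ 2 * b = a ^+ 2 * (b + 2) / (b + 1) ^+ 2.
    by field; rewrite gt_eqF.
  rewrite pmulr_lle0 ?invr_gt0 ?exprn_gt0// pmulr_lle0 ?ltr_wpDl//.
  by move=> h0; apply/eqP; rewrite -sqrf_eq0 eq_le h0 sqr_ge0.
move=> h; have hr := key h; have hi := key ('i%C *: h).
move: hi; rewrite /re cZ L2innerZl => hi.
rewrite [LHS]complexE [RHS]complexE -/(re h) hr; congr (_ +i* _).
by move: hi; rewrite !ReM /=; lra.
Qed.

End riesz.

(** * Finite rank operators and their compressions *)

Section finite_rank.
Context d (X : measurableType d) (R : realType) (mu : {measure set X -> \bar R}).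
Local Notation L2 := (L2 mu).
Local Notation N := (@L2norm _ _ _ mu).
Local Notation P := (stdproj mu).
Implicit Types (f g h : L2) (E F : set X).

Definition norm_bounded (A : L2 -> L2) := exists M : R, forall f, N (A f) <= M * N f.

Lemma norm_boundedP (V : set L2) A : norm_bounded A ->
  exists M : R, forall f, V f -> `|A f| <= M%:C * `|f|.
Proof. by move=> [M hM]; exists M => f _; have := hM f; rewrite !normL2E -rmorphM lecR. Qed.

Lemma norm_boundedD A B : norm_bounded A -> norm_bounded B ->
  norm_bounded (fun f => A f + B f).
Proof.
move=> [M hM] [M' hM']; exists (M + M') => f.
by apply: (le_trans (L2normD _ _)); rewrite mulrDl lerD.
Qed.

Lemma norm_boundedZ z A : norm_bounded A -> norm_bounded (fun f => z *: A f).
Proof.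
move=> [M hM]; exists (modc z * M) => f.
by rewrite L2normZ_real -mulrA ler_wpM2l ?modc_ge0.
Qed.

Lemma norm_bounded_id : norm_bounded id.
Proof. by exists 1 => f; rewrite mul1r. Qed.

Lemma norm_bounded_rank_one g b : norm_bounded (fun f => L2inner f g *: b).
Proof.
exists (N g * N b) => f; rewrite L2normZ_real (_ : N g * N b * N f = N f * N g * N b); last by ring.
by rewrite ler_wpM2r ?L2norm_ge0//; exact: cauchy_schwarz.
Qed.

Lemma norm_bounded_sum (I : Type) (r : seq I) (A : I -> L2 -> L2) :
  (forall i, norm_bounded (A i)) -> norm_bounded (fun f => \sum_(i <- r) A i f).
Proof.
move=> hA; elim: r => [|i r [M hM]].
  by exists 0 => f; rewrite big_nil L2norm0 mul0r.
have [M' hM'] := norm_boundedD (hA i) (ex_intro _ M hM).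
by exists M' => f; rewrite big_cons.
Qed.

Lemma L2inner_Zsumr (I : Type) (r : seq I) (a : I -> R[i]) (F : I -> L2) g :
  L2inner g (\sum_(i <- r) (a i)^*%C *: F i) = \sum_(i <- r) a i * L2inner g (F i).
Proof. by rewrite L2inner_sumr; apply: eq_bigr => i _; rewrite L2innerZr conjcK. Qed.

Lemma L2inner_Zsuml (I : Type) (r : seq I) (a : I -> R[i]) (F : I -> L2) g :
  L2inner (\sum_(i <- r) a i *: F i) g = \sum_(i <- r) a i * L2inner (F i) g.
Proof. by rewrite L2inner_suml; apply: eq_bigr => i _; rewrite L2innerZl. Qed.

(** The Gram matrix of the independent [b j] is invertible and yields the dual vectors [dd i]. The
    coordinates of [K f] are then the bounded functionals [L2inner (K f) (dd i)], represented by
    vectors [g i]. *)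
Lemma finite_rank_representation n (K : L2 -> L2) :
  bounded_operator K -> has_dim (range K) n ->
  exists b g : 'I_n -> L2, forall f, K f = \sum_i L2inner f (g i) *: b i.
Proof.
move=> [_ Klin [M hM]] [b [bfree Kb]].
have KM f : N (K f) <= M * N f by have := hM f I; rewrite !normL2E -rmorphM lecR.
have Kspan f : exists c : 'I_n -> R[i], K f = \sum_i c i *: b i.
  have : lin_span (range b) (K f) by rewrite -Kb; exists f.
  move=> [m [c [s [hs ->]]]].
  have {}hs k : exists j, b j = s k by have [j _ <-] := hs k; exists j.
  have [j jP] := choice hs.
  exists (fun i => \sum_(k | j k == i) c k).
  rewrite (partition_big j predT)//=; apply: eq_bigr => i _; rewrite scaler_suml.
  by apply: eq_bigr => k /eqP <-; rewrite jP.
pose G := \matrix_(j, k) L2inner (b j) (b k).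
have Gu : G \in unitmx.
  rewrite -row_free_unit; apply/row_freeP; apply/row_freeP/inj_row_free => v vG.
  have v0 : \sum_j v 0 j *: b j = 0.
    apply: L2norm_eq0E; apply/eqP; rewrite -sqrf_eq0; apply/eqP.
    apply: (@complexI R); rewrite -L2inner_self L2inner_sumr big1// => k _.
    rewrite L2innerZr L2inner_Zsuml; have /rowP/(_ k) := vG; rewrite !mxE => e.
    by rewrite (_ : \sum_i _ = 0) ?mulr0// -[RHS]e; apply: eq_bigr => i _; rewrite mxE.
  by apply/rowP => j; rewrite mxE (bfree _ v0).
pose dd i := \sum_k (invmx G k i)^*%C *: b k.
have bd j i : L2inner (b j) (dd i) = (j == i)%:R.
  rewrite L2inner_Zsumr; have /matrixP/(_ j i) := mulmxV Gu; rewrite !mxE => <-.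
  by apply: eq_bigr => k _; rewrite mxE mulrC.
have riesz i : exists g, forall f, L2inner (K f) (dd i) = L2inner f g.
  apply: (@riesz_representation _ _ _ _ _ (M * N (dd i))).
    by move=> z f g; rewrite Klin// L2innerDl L2innerZl.
  move=> f; apply: (le_trans (cauchy_schwarz _ _)).
  by rewrite mulrAC ler_wpM2r ?L2norm_ge0.
have [g gP] := choice riesz.
exists b, g => f; have [c cP] := Kspan f.
rewrite {1}cP; apply: eq_bigr => i _; rewrite -gP cP L2inner_Zsuml.
by rewrite (bigD1 i)//= bd eqxx mulr1 big1 ?addr0// => j ji; rewrite bd (negbTE ji) mulr0.
Qed.

End finite_rank.

Lemma eigenvalueE (F : fieldType) n (A : 'M[F]_n) z :
  eigenvalue A z = (A - z%:M \notin unitmx).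
Proof. by rewrite /eigenvalue /eigenspace kermx_eq0 row_free_unit. Qed.

(** * Spectra of compressions and eigenvalues of small matrices *)

Section spectrum.
Context d (X : measurableType d) (R : realType) (mu : {measure set X -> \bar R}).
Local Notation L2 := (L2 mu).
Local Notation N := (@L2norm _ _ _ mu).
Local Notation P := (stdproj mu).
Implicit Types (f h : L2) (E F : set X).
Variables (n : nat) (b g : 'I_n -> L2) (K : L2 -> L2).
Hypothesis KE : forall f, K f = \sum_i L2inner f (g i) *: b i.

(* The matrix of `P_E K` on the span of the `P_E b_j`. *)
Definition compression_mx E : 'M[R[i]]_n := \matrix_(i, j) L2inner (P E (b j)) (g i).

Lemma compression_eigenvector E z (y : 'I_n -> R[i]) : measurable E ->
  (forall i, \sum_j y j * compression_mx E i j = z * y i) ->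
  let f := \sum_j y j *: P E (b j) in
  [/\ P E f = f, P E (K f) = z *: f & forall i, L2inner f (g i) = z * y i].
Proof.
move=> mE hy f.
have cf i : L2inner f (g i) = z * y i.
  by rewrite -hy L2inner_Zsuml; apply: eq_bigr => j _; rewrite mxE.
split=> //.
  by rewrite stdproj_sum//; apply: eq_bigr => j _; rewrite stdprojZ// stdproj_id.
rewrite KE stdproj_sum// scaler_sumr; apply: eq_bigr => i _.
by rewrite stdprojZ// cf scalerA.
Qed.

Lemma eigenvalue_col (A : 'M[R[i]]_n) z : eigenvalue A z ->
  exists y : 'I_n -> R[i], (exists i, y i != 0) /\
    forall i, \sum_j y j * A i j = z * y i.
Proof.
have -> : eigenvalue A z = eigenvalue A^T z.
  by rewrite !eigenvalueE -unitmx_tr linearB/= tr_scalar_mx.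
move=> /eigenvalueP[v vA v0]; exists (v 0); split.
  by have [i vi] := rV0Pn _ v0; exists i.
move=> i; have /rowP/(_ i) := vA; rewrite !mxE => <-.
by apply: eq_bigr => j _; rewrite mxE.
Qed.

Lemma not_spectrum_inj (V : set L2) (A : L2 -> L2) z f : 
  ~ spectrum_on V A z -> V f -> A f = z *: f -> V 0 -> f = 0.
Proof.
move=> /contrapT[B [_ Blin _] Binv] Vf Af V0.
have [<- _] := Binv f Vf; rewrite Af subrr.
have := Blin (-1) 0 0 V0 V0; rewrite scaler0 addr0 scaleN1r addNr; exact.
Qed.

(** Since [z != 0], the vector built from [y] cannot vanish: its inner products with the [g i] are
    [z * y i]. *)
Lemma eigenvalue_spectrum E z : measurable E -> z != 0 ->
  eigenvalue (compression_mx E) z -> spectrum_on (range (P E)) (P E \o K) z.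
Proof.
move=> mE z0 /eigenvalue_col[y [[i yi] hy]]; apply: contrapT => ns.
have [f1 f2 f3] := compression_eigenvector mE hy.
have f0 := @not_spectrum_inj _ _ _ _ ns _ f2.
move: (f3 i); rewrite f0 ?L2inner0l.
- by move=> /esym/eqP; rewrite mulf_eq0 (negbTE z0) (negbTE yi).
- exact/range_stdprojP.
- by apply/range_stdprojP => //; exact: stdproj0.
Qed.

(** The resolvent of a finite rank operator is explicit: once [W] is invertible, solving for the
    inner products with the [g i] gives the inverse [z^-1 *: (\sum_i L2inner f (gg i) *: b i - f)].
    The whole space suffices because increasing spectrum transports every compression there. *)
Lemma spectrum_eigenvalue z : z != 0 ->
  spectrum_on (range (P setT)) (P setT \o K) z -> eigenvalue (compression_mx setT) z.
Proof.
move=> z0; apply: contraPT => ne; apply.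
pose W := (compression_mx setT) - z%:M.
have Wu : W \in unitmx.
  by move: ne; rewrite eigenvalueE negbK.
have mulW (w : 'cV_n) i : (W *m w) i 0 = \sum_j compression_mx setT i j * w j 0 - z * w i 0.
  by rewrite /W mulmxBl mul_scalar_mx !mxE.
pose gg i := \sum_j (invmx W i j)^*%C *: g j.
have ggE f i : L2inner f (gg i) = \sum_j invmx W i j * L2inner f (g j) by rewrite L2inner_Zsumr.
exists (fun f => z^-1 *: (\sum_i L2inner f (gg i) *: b i - f)).
  split.
  - by move=> f _; apply/range_stdprojP => //; exact: stdprojT.
  - move=> c f h _ _; rewrite scalerA (mulrC c) -scalerA -scalerDr; congr (_ *: _).
    rewrite scalerBr addrACA -opprD; congr (_ - _).
    rewrite scaler_sumr -big_split/=; apply: eq_bigr => i _.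
    by rewrite L2innerDl L2innerZl scalerDl scalerA.
  - apply: norm_boundedP; apply: norm_boundedZ; apply: norm_boundedD.
      by apply: norm_bounded_sum => i; exact: norm_bounded_rank_one.
    have [M hM] := norm_boundedZ (-1) (@norm_bounded_id _ _ _ mu).
    by exists M => f; rewrite -scaleN1r.
have cK f i : L2inner (K f) (g i) = \sum_j compression_mx setT i j * L2inner f (g j).
  rewrite KE L2inner_Zsuml; apply: eq_bigr => j _.
  by rewrite mxE stdprojT mulrC.
move=> f _; rewrite /= !stdprojT; split.
  have cW i : L2inner (K f - z *: f) (gg i) = L2inner f (g i).
    have : invmx W *m (W *m \col_j L2inner f (g j)) = \col_j L2inner f (g j) by rewrite mulKmx.
    move=> /colP/(_ i); rewrite ![in RHS]mxE mxE => <-.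
    rewrite ggE; apply: eq_bigr => j _; congr (_ * _).
    rewrite L2innerBl L2innerZl cK /W mulmxBl mul_scalar_mx !mxE; congr (_ - _).
    by apply: eq_bigr => k _; rewrite !mxE.
  under eq_bigr do rewrite cW; rewrite -KE opprB addrC subrK scalerA mulVf// scale1r.
by [].
set y := \sum_i L2inner f (gg i) *: b i; set B := z^-1 *: _.
have cB i : L2inner B (g i) = L2inner f (gg i).
  have : W *m (invmx W *m \col_j L2inner f (g j)) = \col_j L2inner f (g j) by rewrite mulKVmx.
  set w := invmx W *m _; have wE j : w j 0 = L2inner f (gg j).
    by rewrite ggE mxE; apply: eq_bigr => k _; rewrite mxE.
  move=> /colP/(_ i); rewrite mulW wE [RHS]mxE => e.
  rewrite /B L2innerZl L2innerBl -e opprB /y L2inner_Zsuml.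
  rewrite (_ : \sum_j _ * _ = \sum_j compression_mx setT i j * w j 0); last first.
    by apply: eq_bigr => j _; rewrite wE mxE stdprojT mulrC.
  by rewrite addrC subrK mulrA mulVf// mul1r.
rewrite KE; under eq_bigr do rewrite cB; rewrite -/y /B scalerA divff// scale1r.
by rewrite opprB addrC subrK.
Qed.

Hypothesis Kincr : increasing_spectrum K.

Lemma compression_eigenvalues E z : measurable E -> z != 0 ->
  eigenvalue (compression_mx E) z -> eigenvalue (compression_mx setT) z.
Proof.
move=> mE z0 Ez; apply: spectrum_eigenvalue => //.
apply: (Kincr _ _ _ (eigenvalue_spectrum mE z0 Ez)).
- by exists E.
- by exists setT.
- by move=> f _; apply/range_stdprojP => //; exact: stdprojT.
Qed.

Lemma compression_eigenvalues_finite : exists s : seq R[i],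
  forall E z, measurable E -> eigenvalue (compression_mx E) z -> z \in s.
Proof.
have [s sP] := closed_field_poly_normal (char_poly (compression_mx setT)).
(* Nonzero eigenvalues of the compression matrices are among the roots for the whole space; nothing
   is known about 0, so it is added by hand. *)
exists (0 :: s) => E z mE Ez; rewrite in_cons; have [//|z0] := eqVneq z 0.
have := compression_eigenvalues mE z0 Ez; rewrite eigenvalue_root_char sP rootZ ?root_prod_XsubC//.
by rewrite lead_coef_eq0 monic_neq0// char_poly_monic.
Qed.

Lemma compression_is_eigenvalue z : z != 0 ->
  eigenvalue (compression_mx setT) z -> is_eigenvalue K z.
Proof.
move=> z0 /eigenvalue_col[y [[i yi] hy]].
have [f1 f2 f3] := compression_eigenvector measurableT hy.
exists (\sum_j y j *: P setT (b j)); last by rewrite -[LHS]stdprojT.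
apply/eqP => f0; move: (f3 i); rewrite f0 L2inner0l => /esym/eqP.
by rewrite mulf_eq0 (negbTE z0) (negbTE yi).
Qed.

End spectrum.

(** * Indicators and dyadic codes *)

Section indicator.
Context d (X : measurableType d) (R : realType) (mu : {measure set X -> \bar R}).
Local Notation L2 := (L2 mu).
Local Notation N := (@L2norm _ _ _ mu).
Local Notation P := (stdproj mu).
Implicit Types (f g h : L2) (E F : set X).

Lemma Lp2_indic E : measurable E -> (mu E < +oo)%E -> Lp mu 2%:E (fun x => (\1_E x)%:C).
Proof.
move=> mE Eoo; apply/Lp2P; split; first by case: (Linfty_indic mu mE).
rewrite /sqi (_ : (fun x => _) = (fun x => (\1_E x)%:E)) ?integral_indic ?setIT//.
apply/funext => x; rewrite modc_real indicE.
by case: (x \in E); rewrite ?normr1 ?normr0 ?expr1n ?expr0n.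
Qed.

Definition ind E : L2 := L2class mu (fun x => (\1_E x)%:C).

Lemma indE E : measurable E -> (mu E < +oo)%E ->
  {ae mu, forall x, L2fun (ind E) x = (\1_E x)%:C}.
Proof. by move=> mE Eoo; apply: filterS (L2classK (Lp2_indic mE Eoo)) => x /(_ I). Qed.

Lemma sqr_L2norm_ind E : measurable E -> (mu E < +oo)%E -> ((N (ind E) ^+ 2)%:E = mu E)%E.
Proof.
move=> mE Eoo; rewrite L2norm_sqr (@eq_sqi _ _ _ _ _ (fun x => (\1_E x)%:C)).
- rewrite /sqi (_ : (fun x => _) = (fun x => (\1_E x)%:E)) ?integral_indic ?setIT//.
  apply/funext => x; rewrite modc_real indicE.
  by case: (x \in E); rewrite ?normr1 ?normr0 ?expr1n ?expr0n.
- exact: sqfun_cmeasurable.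
- by case: (Linfty_indic mu mE).
- exact: indE.
Qed.

Lemma L2inner_ind E : measurable E -> (mu E < +oo)%E ->
  L2inner (ind E) (ind E) = (fine (mu E))%:C.
Proof. by move=> mE Eoo; rewrite L2inner_self -sqr_L2norm_ind. Qed.

Lemma stdproj_ind E F : measurable E -> measurable F -> (mu F < +oo)%E ->
  P E (ind F) = ind (E `&` F).
Proof.
move=> mE mF Foo; have EFoo : (mu (E `&` F) < +oo)%E.
  by apply: le_lt_trans Foo; apply: le_measure; rewrite ?inE//; exact: measurableI.
apply: L2_ext; apply: filterS3 (stdprojE (ind F) mE) (indE mF Foo) (indE (measurableI _ _ mE mF) EFoo).
by move=> x -> -> -> _; rewrite !indicE in_setI; case: (x \in E).
Qed.

Lemma mu_indic E : measurable E -> mu E = (\int[mu]_x (\1_E x)%:E)%E.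
Proof. by move=> mE; rewrite integral_indic// setIT. Qed.

Lemma L2norm_le_on E f (e : R) : measurable E -> (mu E < +oo)%E -> 0 <= e -> P E f = f ->
  {ae mu, forall x, E x -> modc (L2fun f x) <= e} -> N f ^+ 2 <= e ^+ 2 * fine (mu E).
Proof.
move=> mE Eoo e0 /(stdproj_fixP _ mE) fE fe.
rewrite -lee_fin L2norm_sqr EFinM fineK ?ge0_fin_numE//.
rewrite mu_indic// -ge0_integralZl//;
  [|exact/measurable_EFinP/measurable_indic|by rewrite lee_fin sqr_ge0].
apply: ae_ge0_le_integral => //.
- by move=> x _; rewrite lee_fin sqr_ge0.
- exact/measurable_sqr_modc/sqfun_cmeasurable.
- by move=> x _; rewrite mule_ge0// lee_fin ?sqr_ge0.
- by apply: measurable_funeM; exact/measurable_EFinP/measurable_indic.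
apply: filterS2 fE fe => x fE fe _; rewrite indicE.
have [/set_mem/fe le|/negP xE] := boolP (x \in E).
  by rewrite mule1 lee_fin lerXn2r ?nnegrE ?modc_ge0.
by rewrite fE ?mule0 ?modc_real ?normr0 ?expr0n// => /mem_set.
Qed.

Lemma chebyshev_L2 E f (e : R) : measurable E -> 0 < e ->
  {ae mu, forall x, E x -> e <= modc (L2fun f x)} -> ((e ^+ 2)%:E * mu E <= (N f ^+ 2)%:E)%E.
Proof.
move=> mE e0 fe; rewrite L2norm_sqr mu_indic// -ge0_integralZl//;
  [|exact/measurable_EFinP/measurable_indic|by rewrite lee_fin sqr_ge0].
apply: ae_ge0_le_integral => //.
- by move=> x _; rewrite mule_ge0// lee_fin ?sqr_ge0.
- by apply: measurable_funeM; exact/measurable_EFinP/measurable_indic.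
- by move=> x _; rewrite lee_fin sqr_ge0.
- exact/measurable_sqr_modc/sqfun_cmeasurable.
apply: filterS fe => x fe _; rewrite indicE.
have [/set_mem/fe le|xE] := boolP (x \in E).
  by rewrite mule1 lee_fin lerXn2r ?nnegrE ?modc_ge0// ltW.
by rewrite mule0 lee_fin sqr_ge0.
Qed.

Lemma chebyshev_L2_finite E f (e : R) : measurable E -> 0 < e ->
  (forall x, E x -> e <= modc (L2fun f x)) -> (mu E < +oo)%E.
Proof.
move=> mE e0 fe; have := @chebyshev_L2 E f e mE e0 (aeW _ fe).
rewrite ltey; apply: contraTneq => ->; rewrite gt0_muley ?lte_fin ?exprn_gt0//.
Qed.

End indicator.

Section codes.
Context d (X : measurableType d).
Variables (B : nat -> set X) (p : X -> nat).

(** Binary digits with [p] as leading part: the numerical order is lexicographic, [p] first and then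
    membership in [B 0], [B 1] and so on. With [p] constant it defines the cells, with [p] the block
    label it defines the chain. *)
Fixpoint code k x : nat := if k is k'.+1 then ((code k' x).*2 + (x \in B k'))%N else p x.

Lemma codeS k x : code k.+1 x = ((code k x).*2 + (x \in B k))%N.
Proof. by []. Qed.

Lemma odd_codeS k x : odd (code k.+1 x) = (x \in B k).
Proof. by rewrite codeS oddD odd_double; case: (x \in B k). Qed.

Lemma half_codeS k x : (code k.+1 x)./2 = code k x.
Proof. by rewrite codeS addnC half_bit_double. Qed.

Lemma codeS_eq k x y : code k.+1 x = code k.+1 y <->
  code k x = code k y /\ (x \in B k) = (y \in B k).
Proof.
split=> [e|[e1 e2]]; last by rewrite !codeS e1 e2.
by rewrite -(half_codeS k x) e half_codeS -(odd_codeS k x) e odd_codeS.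
Qed.

Lemma code_eq_le k l x y : (k <= l)%N -> code l x = code l y -> code k x = code k y.
Proof.
move=> kl; rewrite -(subnK kl); elim: (l - k)%N => // j IH.
by rewrite addSn => /codeS_eq[/IH].
Qed.

Lemma code_eq_mem k j x y : (j < k)%N -> code k x = code k y -> (x \in B j) = (y \in B j).
Proof. by move=> jk /(code_eq_le jk)/codeS_eq[]. Qed.

(* Hence initial segments of the codes of two levels are nested. *)
Lemma code_shift k j x : exists2 r, (r < 2 ^ j)%N &
  code (j + k) x = (2 ^ j * code k x + r)%N.
Proof.
elim: j => [|j [r rj e]].
  by exists 0%N; rewrite ?expn0 ?mul1n ?addn0.
exists (r.*2 + (x \in B (j + k)%N))%N.
  by rewrite expnS mul2n -ltn_half_double addnC half_bit_double.
by rewrite addSn codeS e doubleD expnS -!mul2n mulnA addnA.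
Qed.

Hypothesis mB : forall k, measurable (B k).
Hypothesis mp : forall m, measurable [set x | p x = m].

Lemma measurable_code k m : measurable [set x | code k x = m].
Proof.
elim: k m => // k IH m.
rewrite (_ : [set x | _] =
   ([set x | code k x = m./2] `&` (if odd m then B k else ~` B k))).
  by apply: measurableI => //; case: odd => //; exact: measurableC.
apply/seteqP; split => x /=.
  move=> <-; rewrite odd_codeS half_codeS; split=> //.
  by case: ifPn => [/set_mem|/negP nB]//= xB; apply: nB; exact: mem_set.
move=> [xm xB]; rewrite xm -[RHS]odd_double_half addnC; congr (_ + _)%N.
by case: odd xB => xB; [rewrite mem_set|rewrite memNset].
Qed.

End codes.

Section generating.
Context d (X : measurableType d) (R : realType) (mu : {measure set X -> \bar R}).
Local Notation L2 := (L2 mu).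
Local Notation N := (@L2norm _ _ _ mu).
Local Notation P := (stdproj mu).

(** The [e i] are inserted themselves rather than approximated, since continuity along cells will be
    needed for their very representatives. The disjoint sum enumerates both kinds of terms. *)
Lemma separable_sequence m (e : 'I_m -> L2) : separable_L2 mu ->
  exists h : nat -> L2, (forall i, exists k, h k = e i) /\
    forall f (eps : R), 0 < eps -> exists k, N (f - h k) < eps.
Proof.
move=> [D /countable_injP[r rinj] dD].
pose h0 k : L2 := xget 0 [set x | D x /\ r x = k].
pose h k : L2 := match unpickle k : option (nat + 'I_m) with
  | Some (inl a) => h0 a | Some (inr i) => e i | None => 0 end.
exists h; split=> [i|f eps eps0].
  by exists (pickle (inr i : nat + 'I_m)); rewrite /h pickleK.
have e0 : 0 < eps%:C :> R[i] by rewrite ltcR.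
have [x [fx Dx]] : (interior (ball f eps%:C)) `&` D !=set0.
  apply: dD; last exact: open_interior.
  by exists f; exact: nbhsx_ballx.
have {}fx : ball f eps%:C x by exact: interior_subset fx.
exists (pickle (inl (r x) : nat + 'I_m)); rewrite /h pickleK /h0.
have [Dy ry] := @xgetPex _ 0 [set y | D y /\ r y = r x] (ex_intro _ x (conj Dx erefl)).
have -> : xget 0 [set y | D y /\ r y = r x] = x by apply: rinj; rewrite ?inE.
by move: fx; rewrite -ball_normE /ball_ /= normL2E ltcR.
Qed.

Definition part (c : bool) (z : R[i]) : R := if c then complex.Re z else complex.Im z.

Lemma partB c z w : part c (z - w) = part c z - part c w.
Proof. by rewrite /part; case: c; rewrite ?ReD ?ImD; case: w. Qed.

Lemma le_part c z : `|part c z| <= modc z.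
Proof. by case: c; [exact: ler_normRe|exact: ler_normIm]. Qed.

Lemma modc_le_parts (z : R[i]) : modc z <= `|part true z| + `|part false z|.
Proof.
rewrite -ler_sqr ?nnegrE ?modc_ge0 ?addr_ge0// sqr_modc /part sqrrD !real_normK ?num_real//.
by rewrite addrAC lerDl mulrn_wge0// mulr_ge0.
Qed.

Lemma measurable_part c (f : L2) : measurable_fun setT (fun x => part c (L2fun f x)).
Proof. by case: (sqfun_cmeasurable (L2fun f)) => ? ?; case: c. Qed.

Lemma measurable_part_lt c (f : L2) (a : R) : measurable [set x | part c (L2fun f x) < a].
Proof.
have -> : [set x | part c (L2fun f x) < a] = setT `&` (fun x => part c (L2fun f x)) @^-1` `]-oo, a[.
  by rewrite setTI; apply/seteqP; split => x /=; rewrite in_itv.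
by apply: measurable_part => //; exact: measurable_itv.
Qed.

(** The [B k] are the sets where the real or imaginary part of some [h l] is below a rational. The
    set in the approximation clause is the symmetric difference of [A] and the complement of [B k].
    The last clause is a form of sigma-finiteness: up to a part [S] that carries all of L^2, X is
    covered by sets of finite measure taken from the family and its complements. *)
Lemma generating_family m (e : 'I_m -> L2) : separable_L2 mu ->
  exists (B : nat -> set X) (h : nat -> L2), [/\ forall k, measurable (B k),
    forall l x (eps : R), 0 < eps -> exists K, forall y,
      (forall j, (j < K)%N -> (y \in B j) = (x \in B j)) ->
      modc (L2fun (h l) y - L2fun (h l) x) <= eps,
    forall i, exists l, h l = e i &
    forall f (eps : R), 0 < eps -> exists l, N (f - h l) < eps] /\
  [/\
    forall A, measurable A -> (mu A < +oo)%E -> forall eps : R, 0 < eps ->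
      exists k, (mu ((A `&` B k) `|` (~` B k `\` A)) <= eps%:E)%E &
    exists S, [/\ measurable S, forall f, P S f = f &
      forall x, S x -> exists j,
        (B j x /\ (mu (B j) < +oo)%E) \/ (~ B j x /\ (mu (~` B j) < +oo)%E)]].
Proof.
move=> /(separable_sequence e)[h [he hd]].
pose B k : set X := match unpickle k : option (nat * bool * rat) with
  | Some (l, c, q) => [set x | part c (L2fun (h l) x) < ratr q] | None => set0 end.
have BE l c q : B (pickle (l, c, q)) = [set x | part c (L2fun (h l) x) < ratr q].
  by rewrite /B pickleK.
have mB k : measurable (B k).
  by rewrite /B; case: unpickle => [[[l c] q]|//]; exact: measurable_part_lt.
exists B, h; split; split=> //.
- move=> l x eps eps0.
  have sep c : exists K, forall y, (forall j, (j < K)%N -> (y \in B j) = (x \in B j)) ->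
      `|part c (L2fun (h l) y) - part c (L2fun (h l) x)| <= eps / 2.
    set t := part c (L2fun (h l) x).
    have [q1 /[!in_itv]/= /andP[q1a q1b]] : exists q, ratr q \in `]t - eps / 2, t[.
      by apply: rat_in_itvoo; rewrite ltrBlDr ltrDl divr_gt0.
    have [q2 /[!in_itv]/= /andP[q2a q2b]] : exists q, ratr q \in `]t, t + eps / 2[.
      by apply: rat_in_itvoo; rewrite ltrDl divr_gt0.
    exists (maxn (pickle (l, c, q1)) (pickle (l, c, q2))).+1 => y yx.
    have := yx (pickle (l, c, q1)); rewrite ltnS leq_maxl => /(_ isT).
    have := yx (pickle (l, c, q2)); rewrite ltnS leq_maxr => /(_ isT).
    rewrite !BE [x \in _]mem_set//= => /set_mem/= y2.
    rewrite [x \in _]memNset/=; last by apply/negP; rewrite -leNgt ltW.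
    move=> /negP/negP; rewrite notin_setE /= => /negP; rewrite -leNgt => y1.
    rewrite ler_norml; apply/andP; split; lra.
  have [K1 h1] := sep true; have [K2 h2] := sep false.
  exists (maxn K1 K2) => y yx; apply: (le_trans (modc_le_parts _)).
  rewrite !partB [leRHS]splitr; apply: lerD.
    by apply: h1 => j jK; apply: yx; rewrite leq_max jK.
  by apply: h2 => j jK; apply: yx; rewrite leq_max jK orbT.
- move=> A mA Aoo eps eps0.
  (* If [h l] is close to the indicator of [A], cut it at level 1/2: on the symmetric difference it
     is at least 1/2 away from the indicator, so the measure is at most 4 times the squared
     distance. The minimum with 1 gives [dl ^+ 2 <= dl <= eps / 4]. *)
  pose dl : R := Num.min 1 (eps / 4).
  have d0 : 0 < dl by rewrite lt_min ltr01 divr_gt0.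
  have [l hl] := hd (ind mu A) dl d0.
  exists (pickle (l, true, 2^-1 : rat)); rewrite BE.
  set E := (X in mu X); have mE : measurable E.
    have mBl := measurable_part_lt true (h l) (ratr 2^-1).
    by apply: measurableU; [exact: measurableI|apply: measurableD => //; exact: measurableC].
  have half : ratr (2^-1 : rat) = 2^-1 :> R by rewrite fmorphV rmorph_nat.
  have := @chebyshev_L2 _ _ _ mu E (ind mu A - h l) 2^-1 mE (_ : 0 < 2^-1).
  rewrite invr_gt0 ltr0n => /(_ isT) => H.
  have {H} : ((2^-1 ^+ 2)%:E * mu E <= (N (ind mu A - h l) ^+ 2)%:E)%E.
    apply: H; apply: filterS2 (L2funBx (ind mu A) (h l)) (indE mA Aoo) => x -> ->.
    rewrite indicE => -[[xA]|[xB xA]] /=.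
      rewrite mem_set//= => xB; apply: le_trans (le_part true _); rewrite partB /= /part.
      apply: le_trans (ler_norm _); move: xB; rewrite half /part /=; lra.
    apply: le_trans (le_part true _); rewrite partB /= /part.
    move/negP: xB; rewrite memNset// -leNgt half /part /= => xB.
    by rewrite -normrN; apply: le_trans (ler_norm _); move: xB; lra.
  have Nd : N (ind mu A - h l) ^+ 2 <= eps / 4.
    apply: (@le_trans _ _ (dl ^+ 2)); first by rewrite lerXn2r ?nnegrE ?L2norm_ge0// ltW.
    have d1 : dl <= 1 by rewrite ge_min lexx.
    apply: (@le_trans _ _ dl); first by rewrite expr2 ler_piMl// ltW.
    by rewrite ge_min lexx orbT.
  rewrite -lee_fin in Nd; move=> /le_trans/(_ Nd) => H.
  have := @lee_wpmul2l _ 4%:E _ _ _ H.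
  rewrite lee_fin ler0n muleA -!EFinM => /(_ isT).
  have -> : 4 * 2^-1 ^+ 2 = 1 :> R by rewrite exprVn -natrX divff.
  by rewrite mul1e mulrC divfK.
- pose S0 l c := [set x | part c (L2fun (h l) x) != 0].
  have mS0 l c : measurable (S0 l c).
    have -> : S0 l c = setT `&` (fun x => part c (L2fun (h l) x)) @^-1` (~` [set 0]).
      by rewrite setTI; apply/seteqP; split => x /= /eqP.
    by apply: (measurable_part c (h l) measurableT); apply: measurableC; exact: measurable_set1.
  (* The joint support of the dense sequence. At a point of it some part of some [h l] is nonzero; a
     rational strictly between 0 and that value gives, by Chebyshev, a set of finite measure: the
     level set if the value is negative, its complement if positive. *)
  pose S := \bigcup_l (S0 l true `|` S0 l false).
  have mS : measurable S by apply: bigcup_measurable => l _; exact: measurableU.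
  have Sh l : P S (h l) = h l.
    apply/stdproj_fixP => //; apply: aeW => x nS.
    have H c : part c (L2fun (h l) x) = 0.
      apply/eqP/negPn/negP => nz; apply: nS; exists l => //.
      by case: c nz; [left|right].
    by move: (H true) (H false); rewrite /part /=; case: (sqval _ _) => a b /= -> ->.
  exists S; split=> //.
    move=> f; apply/eqP; rewrite eq_sym -subr_eq0; apply/eqP/L2norm_eq0E.
    apply/eqP; rewrite eq_le L2norm_ge0 andbT; apply/ler_addgt0Pl => eps eps0; rewrite addr0.
    have [l hl] := hd f (eps / 2) (divr_gt0 eps0 (ltr0n _ 2)).
    have -> : f - P S f = (f - h l) - P S (f - h l).
      by rewrite stdprojB// Sh opprB addrA subrK.
    apply: (le_trans (L2normD _ _)); rewrite L2normN [leRHS]splitr lerD// ?ltW//.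
    exact: le_lt_trans (L2norm_stdproj _ mS) hl.
  move=> x [l _ xl].
  have [c xc] : exists c, part c (L2fun (h l) x) != 0.
    by case: xl => ?; [exists true|exists false].
  move: xc; rewrite neq_lt => /orP[xc|xc].
    have [q /[!in_itv]/= /andP[qa qb]] := rat_in_itvoo xc.
    exists (pickle (l, c, q)); left; rewrite BE; split => //.
    apply: (@chebyshev_L2_finite _ _ _ mu _ (h l) (- ratr q)).
    - exact: measurable_part_lt.
    - by rewrite oppr_gt0.
    - move=> y /= yq; apply: le_trans (le_part c _).
      by rewrite ltr0_norm ?lerN2 ?ltW// (lt_trans yq).
  have [q /[!in_itv]/= /andP[qa qb]] := rat_in_itvoo xc.
  exists (pickle (l, c, q)); right; rewrite BE; split => /=.
    by apply/negP; rewrite -leNgt ltW.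
  apply: (@chebyshev_L2_finite _ _ _ mu _ (h l) (ratr q)) => //.
  - by apply: measurableC; exact: measurable_part_lt.
  - move=> y /= /negP; rewrite -leNgt => yq; apply: le_trans (le_part c _).
    exact: le_trans yq (ler_norm _).
Qed.

End generating.

(** * Cells and Lebesgue differentiation along cells *)

Lemma cvg_complex (R : realType) (u : nat -> R[i]) (l : R[i]) :
  (forall eps : R, 0 < eps -> exists K, forall k, (K <= k)%N -> modc (l - u k) <= eps) ->
  (u : nat -> (R[i] : numFieldType)) @ \oo --> (l : (R[i] : numFieldType)).
Proof.
move=> h; apply/cvgrPdist_le => eps eps0.
have e0 : 0 < complex.Re eps by case: (eps) eps0 => a b; rewrite ltcE /= => /andP[].
have eE : eps = (complex.Re eps)%:C.
  by case: (eps) eps0 => a b; rewrite ltcE /= => /andP[/eqP-> _].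
have [K hK] := h _ e0; exists K => // k /= Kk.
by rewrite modcE eE lecR; exact: hK.
Qed.

Section cells.
Context d (X : measurableType d) (R : realType) (mu : {measure set X -> \bar R}).
Local Notation L2 := (L2 mu).
Local Notation N := (@L2norm _ _ _ mu).
Local Notation P := (stdproj mu).
Variables (B : nat -> set X).
Hypothesis mB : forall k, measurable (B k).

Local Notation code := (code B (fun=> 0%N)).
Definition cell k x : set X := [set y | code k y = code k x].
(** These are the atoms of the sigma-algebra generated by the [B k]: the points no [B k] separates
    from [x]. *)
Definition cell_lim x : set X := \bigcap_k cell k x.

Let mcode k m : measurable [set x | code k x = m].
Proof.
apply: measurable_code => // m'; have [<-|ne] := eqVneq 0%N m'.
  by rewrite (_ : [set _ | _] = setT)//; apply/seteqP; split.
by rewrite (_ : [set _ | _] = set0)//; apply/seteqP; split => // x /= /eqP; rewrite (negbTE ne).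
Qed.

Lemma measurable_cell k x : measurable (cell k x).
Proof. exact: mcode. Qed.

Lemma measurable_cell_lim x : measurable (cell_lim x).
Proof. by apply: bigcap_measurable => // k _; exact: measurable_cell. Qed.

Lemma cell_le k l x : (k <= l)%N -> cell l x `<=` cell k x.
Proof. by move=> kl y /=; exact: code_eq_le. Qed.

Lemma cellP k x y : (forall j, (j < k)%N -> (y \in B j) = (x \in B j)) <-> cell k x y.
Proof.
split=> [|h j jk]; last exact: code_eq_mem h.
elim: k => [//|k IH] h; apply/codeS_eq; split; last exact: h.
by apply: IH => j jk; apply: h; exact: ltnW.
Qed.

(** Each level has countably many cells, so the union of the null ones is negligible. *)
Lemma ae_cell_gt0 : {ae mu, forall x k, mu (cell k x) != 0%E}.
Proof.
pose F (i : nat) : set X := match unpickle i : option (nat * nat) with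
  | Some (k, m) => if mu [set x | code k x = m] == 0%E then [set x | code k x = m] else set0
  | None => set0 end.
have : mu.-negligible (\bigcup_i F i).
  apply: negligible_bigcup => i; rewrite /F.
  case: unpickle => [[k m]|]; last exact: negligible_set0.
  case: ifPn => [/eqP e|_]; last exact: negligible_set0.
  by exists [set x | code k x = m]; split.
move=> [A [mA A0 FA]]; exists A; split=> // x /= nx; apply: FA.
have [k /negP/negPn k0] : exists k, ~ (mu (cell k x) != 0%E).
  by apply/existsNP.
by exists (pickle (k, code k x)) => //; rewrite /F pickleK k0.
Qed.

Lemma cvg_mu_cell x K : (mu (cell K x) < +oo)%E ->
  (fun k => (fine (mu (cell (k + K) x)))%:C : (R[i] : numFieldType)) @ \oo -->
  ((fine (mu (cell_lim x)))%:C : (R[i] : numFieldType)).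
Proof.
move=> Koo; have cE : cell_lim x = \bigcap_k cell (k + K) x.
  apply/seteqP; split=> y h k _; first exact: h.
  by apply: (@cell_le k (k + K)); [exact: leq_addr|exact: h].
have h : (mu \o (fun k => cell (k + K) x)) @ \oo --> mu (cell_lim x).
  rewrite cE; apply: nonincreasing_cvg_mu; rewrite ?add0n//.
  - by move=> k; exact: measurable_cell.
  - by rewrite -cE; exact: measurable_cell_lim.
  - by move=> a b ab; apply/subsetPset; apply: cell_le; rewrite leq_add2r.
have fin k : (mu (cell (k + K) x) < +oo)%E.
  apply: le_lt_trans Koo; apply: le_measure; rewrite ?inE; try exact: measurable_cell.
  by apply: cell_le; exact: leq_addl.
have lfin : (mu (cell_lim x) < +oo)%E.
  apply: le_lt_trans Koo; apply: le_measure; rewrite ?inE.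
  - exact: measurable_cell_lim.
  - exact: measurable_cell.
  - by move=> y; apply.
have {}h : (fun k => fine (mu (cell (k + K) x))) @ \oo --> fine (mu (cell_lim x)).
  by apply: fine_cvg; rewrite fineK ?ge0_fin_numE.
apply: cvg_complex => eps eps0.
have [M _ hM] := (@cvgrPdist_le _ _ _ _ _ _ _).1 h _ eps0.
exists M => k Mk; have := hM k Mk.
by rewrite -(rmorphB (real_complex R)) modc_real.
Qed.

(** Replacing [b] and [g] by constants on [A] leaves remainders of norm at most [eps] times the
    square root of [mu A]. Every error term thus carries the full factor [mu A], and the estimate
    survives division by it. *)
Lemma local_inner_estimate A (b g : L2) (w v : R[i]) (eps : R) :
  measurable A -> (mu A < +oo)%E -> 0 <= eps ->
  (forall y, A y -> modc (L2fun b y - w) <= eps) ->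
  (forall y, A y -> modc (L2fun g y - v) <= eps) ->
  modc (w * v^*%C * (fine (mu A))%:C - L2inner (P A b) g) <=
    ((modc w + modc v) * eps + eps ^+ 2) * fine (mu A).
Proof.
move=> mA Aoo e0 hb hg; set m := fine (mu A).
have m0 : 0 <= m by rewrite fine_ge0.
have est (f : L2) z : (forall y, A y -> modc (L2fun f y - z) <= eps) ->
    N (P A f - z *: ind mu A) <= eps * Num.sqrt m.
  move=> hf; rewrite -ler_sqr ?nnegrE ?L2norm_ge0 ?mulr_ge0 ?sqrtr_ge0//.
  rewrite exprMn sqr_sqrtr//; apply: L2norm_le_on => //.
    by rewrite stdprojB// stdprojZ// stdproj_id// stdproj_ind// setIid.
  have e1 := aeI (L2funBx (P A f) (z *: ind mu A)) (L2funZx z (ind mu A)).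
  apply: filterS3 e1 (stdprojE f mA) (indE mA Aoo) => x [-> ->] -> -> xA.
  by rewrite indicE mem_set// mulr1; exact: hf.
have nI : N (ind mu A) = Num.sqrt m.
  by rewrite -[LHS]ger0_norm ?L2norm_ge0// -sqrtr_sqr; congr Num.sqrt; apply: EFin_inj;
    rewrite sqr_L2norm_ind// fineK// ge0_fin_numE.
set be := P A b - w *: ind mu A; set ga := P A g - v *: ind mu A.
have bE : P A b = w *: ind mu A + be by rewrite addrC subrK.
have gE : P A g = v *: ind mu A + ga by rewrite addrC subrK.
have -> : L2inner (P A b) g = w * v^*%C * m%:C + w * L2inner (ind mu A) ga +
    (v^*%C * L2inner be (ind mu A) + L2inner be ga).
  rewrite -(stdproj_id b mA) L2inner_stdproj// bE gE !(L2innerDl, L2innerDr) !L2innerZl !L2innerZr.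
  by rewrite L2inner_ind// -/m; ring.
rewrite -addrA opprD addrA subrr add0r.
have nm : Num.sqrt m * Num.sqrt m = m by rewrite -expr2 sqr_sqrtr.
have modcN (z : R[i]) : modc (- z) = modc z by case: z => p q /=; rewrite !sqrrN.
rewrite modcN; apply: (le_trans (modcD _ _)).
have em : eps * m = eps * Num.sqrt m * Num.sqrt m by rewrite -mulrA nm.
have h1 : modc (w * L2inner (ind mu A) ga) <= modc w * (eps * m).
  rewrite Normc.normcM ler_wpM2l ?modc_ge0//; apply: (le_trans (cauchy_schwarz _ _)).
  by rewrite nI em mulrC ler_wpM2r ?sqrtr_ge0// est.
have h2 : modc (v^*%C * L2inner be (ind mu A)) <= modc v * (eps * m).
  rewrite Normc.normcM modcJ ler_wpM2l ?modc_ge0//; apply: (le_trans (cauchy_schwarz _ _)).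
  by rewrite nI em ler_wpM2r ?sqrtr_ge0// est.
have h3 : modc (L2inner be ga) <= eps ^+ 2 * m.
  apply: (le_trans (cauchy_schwarz _ _)).
  have -> : eps ^+ 2 * m = (eps * Num.sqrt m) * (eps * Num.sqrt m) by rewrite mulrACA nm.
  by apply: ler_pM; rewrite ?L2norm_ge0// est.
have := lerD h2 h3; move/(le_trans (modcD _ _)) => h4.
by apply: (le_trans (lerD h1 h4)); rewrite !mulrDl !mulrA addrA.
Qed.

(** A property of the chosen representative, required at every point; it is not invariant under
    changes on null sets. *)
Definition continuous_on_cells (f : L2) := forall x (eps : R), 0 < eps ->
  exists K, forall y, cell K x y -> modc (L2fun f y - L2fun f x) <= eps.

Lemma cell_lim_eq f x y : continuous_on_cells f -> cell_lim x y -> L2fun f y = L2fun f x.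
Proof.
move=> cf xy; apply/eqP; rewrite -subr_eq0; apply/eqP/Normc.eq0_normc/eqP.
rewrite eq_le modc_ge0 andbT; apply/ler_addgt0Pl => eps eps0; rewrite addr0.
by have [K hK] := cf x eps eps0; exact/hK/xy.
Qed.

(** Cells of low level may have infinite measure, so the sequence starts at a level [K] where the
    measure is finite. *)
Lemma cvg_cell_inner (b g : L2) x K : continuous_on_cells b -> continuous_on_cells g ->
  (mu (cell K x) < +oo)%E -> (forall k, mu (cell k x) != 0%E) ->
  (fun k => ((fine (mu (cell (k + K) x)))%:C)^-1 * L2inner (P (cell (k + K) x) b) g : (R[i] : numFieldType)) @ \oo -->
  (((L2fun g x)^*%C * L2fun b x) : (R[i] : numFieldType)).
Proof.
move=> cb cg Koo k0; apply: cvg_complex => eps eps0.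
set w := L2fun b x; set v := L2fun g x.
pose C := modc w + modc v + 1.
have C0 : 0 < C by rewrite ltr_wpDl// addr_ge0// modc_ge0.
pose de : R := Num.min 1 (eps / C).
have de0 : 0 < de by rewrite lt_min ltr01 divr_gt0.
have de1 : de <= 1 by rewrite ge_min lexx.
have [K1 h1] := cb x de de0; have [K2 h2] := cg x de de0.
exists (maxn K1 K2) => k Kk.
set A := cell (k + K) x; have mA : measurable A by exact: measurable_cell.
have Aoo : (mu A < +oo)%E.
  apply: le_lt_trans Koo; apply: le_measure; rewrite ?inE//; first exact: measurable_cell.
  by apply: cell_le; exact: leq_addl.
have m0 : 0 < fine (mu A).
  by rewrite fine_gt0// Aoo andbT lt0e k0 measure_ge0.
have := @local_inner_estimate A b g w v de mA Aoo (ltW de0).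
have -> : (forall y, A y -> modc (L2fun b y - w) <= de) <-> True.
  split=> // _ y Ay; apply: h1; apply: cell_le Ay; apply: leq_trans (leq_addr _ _).
  exact: leq_trans (leq_maxl _ _) Kk.
have -> : (forall y, A y -> modc (L2fun g y - v) <= de) <-> True.
  split=> // _ y Ay; apply: h2; apply: cell_le Ay; apply: leq_trans (leq_addr _ _).
  exact: leq_trans (leq_maxr _ _) Kk.
move=> /(_ I I); set m := fine (mu A) => H.
have mC : m%:C != 0 :> R[i] by rewrite (inj_eq (@complexI R)) gt_eqF.
have -> : v^*%C * w - (m%:C)^-1 * L2inner (P A b) g =
    (m%:C)^-1 * (w * v^*%C * m%:C - L2inner (P A b) g) by field.
rewrite Normc.normcM -(fmorphV (real_complex R)) modc_real ger0_norm; last by rewrite invr_ge0 ltW.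
rewrite ler_pdivrMl//; apply: (le_trans H); rewrite [leRHS]mulrC ler_wpM2r //; first exact: ltW.
apply: (@le_trans _ _ (C * de)).
  by rewrite /C [leRHS]mulrDl mul1r lerD2l expr2 ler_piMl// ltW.
by rewrite mulrC -ler_pdivlMr// ge_min lexx orbT.
Qed.

End cells.

(** * Cycles of kernel entries vanish *)

Section atoms.
Context d (X : measurableType d) (R : realType) (mu : {measure set X -> \bar R}).
Local Notation L2 := (L2 mu).
Local Notation N := (@L2norm _ _ _ mu).
Local Notation P := (stdproj mu).
Variables (B : nat -> set X).
Hypothesis mB : forall k, measurable (B k).

Lemma cell_lim_mem x y k : cell_lim B x y -> (y \in B k) = (x \in B k).
Proof. by move=> /(_ k.+1 I); exact: code_eq_mem. Qed.

Lemma cell_lim_sym x y : cell_lim B x y -> cell_lim B y x.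
Proof. by move=> h k _; have := h k I; rewrite /cell /= => ->. Qed.

Lemma cell_lim_eq_set x y : cell_lim B x y -> cell_lim B y = cell_lim B x.
Proof.
move=> h; apply/seteqP; split => z hz k _.
  by have := hz k I; have := h k I; rewrite /cell /= => -> ->.
by have := hz k I; have := h k I; rewrite /cell /= => -> ->.
Qed.

(** Each [B k] contains the whole cell limit or misses it. Hence the symmetric difference that
    measures the approximation of a subset [E] contains [E] or its complement in the cell limit, and
    cannot be small unless one of them is null. *)
Lemma cell_lim_is_atom x :
  (forall A, measurable A -> (mu A < +oo)%E -> forall eps : R, 0 < eps ->
      exists k, (mu ((A `&` B k) `|` (~` B k `\` A)) <= eps%:E)%E) ->
  (0 < mu (cell_lim B x))%E -> (mu (cell_lim B x) < +oo)%E -> is_atom mu (cell_lim B x).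
Proof.
move=> dens A0 Aoo; set A := cell_lim B x in A0 Aoo *.
have mA : measurable A by exact: measurable_cell_lim.
split=> // E mE EA.
have Eoo : (mu E < +oo)%E by apply: le_lt_trans Aoo; apply: le_measure; rewrite ?inE.
have mAE : measurable (A `\` E) by exact: measurableD.
have AEoo : (mu (A `\` E) < +oo)%E.
  by apply: le_lt_trans Aoo; apply: le_measure; rewrite ?inE//; exact: subDsetl.
apply: contrapT => /not_orP[/eqP E0 /eqP AE0].
have pE : 0 < fine (mu E) by rewrite fine_gt0// Eoo lt0e E0 measure_ge0.
have pAE : 0 < fine (mu (A `\` E)) by rewrite fine_gt0// AEoo lt0e AE0 measure_ge0.
pose eps : R := Num.min (fine (mu E)) (fine (mu (A `\` E))) / 2.
have eps0 : 0 < eps by rewrite divr_gt0// lt_min pE.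
have [k] := dens E mE Eoo eps eps0; apply/negP; rewrite -ltNge.
have mU : measurable ((E `&` B k) `|` (~` B k `\` E)).
  by apply: measurableU; [exact: measurableI|apply: measurableD => //; exact: measurableC].
have hmin : eps < Num.min (fine (mu E)) (fine (mu (A `\` E))).
  by rewrite /eps ltr_pdivrMr// ltr_pMr ?ltr1n// lt_min pE.
have [xB|xB] := boolP (x \in B k).
  apply: (@lt_le_trans _ _ (mu E)).
    rewrite -[mu E]fineK ?ge0_fin_numE// lte_fin (lt_le_trans hmin)// ge_min lexx//.
  apply: le_measure; rewrite ?inE// => y Ey; left; split=> //.
  by apply: set_mem; rewrite (cell_lim_mem k (EA _ Ey)).
apply: (@lt_le_trans _ _ (mu (A `\` E))).
  by rewrite -[mu (A `\` E)]fineK ?ge0_fin_numE// lte_fin (lt_le_trans hmin)// ge_min lexx orbT.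
apply: le_measure; rewrite ?inE// => y [Ay nEy]; right; split=> //.
by move=> /mem_set; rewrite (cell_lim_mem k Ay); exact/negP.
Qed.

Lemma stdproj_cell_lim x (f : L2) : (mu (cell_lim B x) < +oo)%E -> continuous_on_cells B f ->
  P (cell_lim B x) f = L2fun f x *: ind mu (cell_lim B x).
Proof.
move=> Aoo cf; have mA := measurable_cell_lim mB x.
apply: L2_ext; have e := L2funZx (L2fun f x) (ind mu (cell_lim B x)).
apply: filterS3 e (stdprojE f mA) (indE mA Aoo) => y -> -> -> _.
rewrite indicE; case: ifPn => [/set_mem|_]; last by rewrite mulr0.
by move=> yx; rewrite mulr1; exact: cell_lim_eq yx.
Qed.

Hypothesis dense : forall (f : L2) (eps : R), 0 < eps ->
  exists2 h, continuous_on_cells B h & N (f - h) < eps.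

(** Functions continuous along cells are constant on the cell limit and dense. The coefficient given
    is that of the orthogonal projection on the indicator, so it approximates at least as well as
    any of these constants, and the distance is 0. *)
Lemma stdproj_atom x (f : L2) : (0 < mu (cell_lim B x))%E -> (mu (cell_lim B x) < +oo)%E ->
  P (cell_lim B x) f =
    (L2inner f (ind mu (cell_lim B x)) / (fine (mu (cell_lim B x)))%:C) *: ind mu (cell_lim B x).
Proof.
move=> A0 Aoo; have mA := measurable_cell_lim mB x; set A := cell_lim B x in mA A0 Aoo *.
set m := fine (mu A); set z := _ / _.
have m0 : 0 < m by rewrite fine_gt0// A0.
have mC : m%:C != 0 :> R[i] by rewrite (inj_eq (@complexI R)) gt_eqF.
apply/eqP; rewrite -subr_eq0; apply/eqP; apply: L2norm_eq0E; apply/eqP.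
rewrite eq_le L2norm_ge0 andbT; apply/ler_addgt0Pl => eps eps0; rewrite addr0.
have [h ch hf] := dense f eps0.
set w := L2fun h x.
have orth : L2inner (P A f - z *: ind mu A) (ind mu A) = 0.
  rewrite L2innerBl L2innerZl L2inner_ind// -/m L2inner_stdproj// stdproj_ind// setIid.
  by rewrite /z divfK// subrr.
have pyth : N (P A f - w *: ind mu A) ^+ 2 =
    N (P A f - z *: ind mu A) ^+ 2 + N ((z - w) *: ind mu A) ^+ 2.
  have -> : P A f - w *: ind mu A = (P A f - z *: ind mu A) + (z - w) *: ind mu A.
    by rewrite scalerBl addrA subrK.
  by rewrite sqr_L2normD L2innerZr orth mulr0 /= mulr0 addr0.
rewrite -ler_sqr ?nnegrE ?L2norm_ge0 ?(ltW eps0)//.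
apply: (@le_trans _ _ (N (P A f - w *: ind mu A) ^+ 2)); first by rewrite pyth lerDl sqr_ge0.
rewrite ler_sqr ?nnegrE ?L2norm_ge0 ?(ltW eps0)// -stdproj_cell_lim// -stdprojB//.
exact: le_trans (L2norm_stdproj _ mA) (ltW hf).
Qed.

End atoms.

Section cycles.
Context d (X : measurableType d) (R : realType) (mu : {measure set X -> \bar R}).
Local Notation L2 := (L2 mu).
Local Notation N := (@L2norm _ _ _ mu).
Local Notation P := (stdproj mu).
Variables (n : nat) (b g : 'I_n.+1 -> L2) (K : L2 -> L2).
Hypothesis KE : forall f, K f = \sum_i L2inner f (g i) *: b i.
Hypothesis Kincr : increasing_spectrum K.
Variables (B : nat -> set X).
Hypothesis mB : forall k, measurable (B k).
Hypothesis cb : forall i, continuous_on_cells B (b i).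
Hypothesis cg : forall i, continuous_on_cells B (g i).

Local Notation code := (code B (fun=> 0%N)).
Local Notation cell := (cell B).
Local Notation cell_lim := (cell_lim B).

Definition urow x : 'rV[R[i]]_n.+1 := \row_j L2fun (b j) x.
Definition vrow x : 'rV[R[i]]_n.+1 := \row_i (L2fun (g i) x)^*%C.

Definition regular x := (forall k, mu (cell k x) != 0%E) /\ exists k, (mu (cell k x) < +oo)%E.

Lemma stdproj_bigU (I : choiceType) (r : seq I) (A : I -> set X) (f : L2) :
  (forall i, measurable (A i)) -> (forall i j, i != j -> A i `&` A j = set0) -> uniq r ->
  P (\big[setU/set0]_(i <- r) A i) f = \sum_(i <- r) P (A i) f.
Proof.
move=> mA dA; elim: r => [_|i r IH /= /andP[ir ur]].
  by rewrite !big_nil stdproj_null.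
rewrite !big_cons stdprojU ?IH//; first by apply: bigsetU_measurable.
rewrite -subset0 => x [Ax]; rewrite -bigcup_seq => -[j /= jr Ajx].
have ij : i != j by apply: contraNneq ir => ->.
by have := dA i j ij; rewrite -subset0 => /(_ x); apply.
Qed.

Lemma compression_mx_bigU (I : choiceType) (r : seq I) (A : I -> set X) :
  (forall i, measurable (A i)) -> (forall i j, i != j -> A i `&` A j = set0) -> uniq r ->
  compression_mx b g (\big[setU/set0]_(i <- r) A i) = \sum_(i <- r) compression_mx b g (A i).
Proof.
move=> mA dA ur; apply/matrixP => i j; rewrite summxE mxE stdproj_bigU// L2inner_suml.
by apply: eq_bigr => k _; rewrite mxE.
Qed.

(** Disjoint cells make the compression matrix of a union the sum of the matrices of the cells. The
    case [r = 0] is included and excludes loops at nonatomic points. *)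
Lemma nonatomic_cycle r (x : 'I_r.+1 -> X) (i0 : 'I_r.+1) :
  (forall i, regular (x i)) -> (forall i j, cell_lim (x i) (x j) -> i = j) ->
  mu (cell_lim (x i0)) = 0%E ->
  (forall i j, pairing (urow (x i)) (vrow (x j)) != 0 -> i != j -> j = ordS i) ->
  \prod_i pairing (urow (x i)) (vrow (x (ordS i))) = 0.
Proof.
move=> xreg xinj x0 chord.
have [Kf hKf] := choice (fun i => (xreg i).2).
have sep (ij : 'I_r.+1 * 'I_r.+1) : exists k, ij.1 != ij.2 -> code k (x ij.1) <> code k (x ij.2).
  have [eq|ne] := eqVneq ij.1 ij.2; first by exists 0%N.
  have [k hk] : exists k, ~ cell k (x ij.1) (x ij.2).
    apply/existsNP => h; case/eqP: ne; apply: xinj => k _; exact: h.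
  by exists k => _; move=> e; apply: hk; rewrite /cell /=.
have [Ks hKs] := choice sep.
(* From this level on, all the cells have finite measure and are pairwise disjoint. *)
pose K0 := maxn (\max_i Kf i) (\max_ij Ks ij).
have fin i : (mu (cell K0 (x i)) < +oo)%E.
  apply: le_lt_trans (hKf i); apply: le_measure; rewrite ?inE; try exact: measurable_cell.
  by apply: cell_le; apply: leq_trans (leq_maxl _ _); exact: leq_bigmax.
have disj k i j : i != j -> cell (k + K0) (x i) `&` cell (k + K0) (x j) = set0.
  move=> ij; rewrite -subset0 => y [yi yj]; apply: (hKs (i, j) ij) => /=.
  have le : (Ks (i, j) <= k + K0)%N.
    apply: leq_trans (leq_addl _ _); apply: leq_trans (leq_maxr _ _).
    exact: (leq_bigmax (i, j)).
  by rewrite -(code_eq_le le yi) -(code_eq_le le yj).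
have [s hs] := compression_eigenvalues_finite KE Kincr.
apply: (@chordless_cycle_prod0 _ n r (fun k i => compression_mx b g (cell (k + K0) (x i)))
  (fun k i => (fine (mu (cell (k + K0) (x i))))%:C) (fun i => (fine (mu (cell_lim (x i))))%:C)
  (fun i => urow (x i)) (fun i => vrow (x i)) s i0) => //.
- move=> k i; rewrite (inj_eq (@complexI R)) fine_eq0 ?ge0_fin_numE//; first exact: (xreg i).1.
  apply: le_lt_trans (fin i); apply: le_measure; rewrite ?inE; try exact: measurable_cell.
  by apply: cell_le; exact: leq_addl.
- by move=> i; apply: cvg_mu_cell.
- by rewrite x0.
- move=> i a c; rewrite !mxE big_ord1 !mxE.
  under eq_fun do rewrite !mxE.
  exact: cvg_cell_inner (fin i) (xreg i).1.
- move=> k S z; rewrite -big_enum -compression_mx_bigU ?enum_uniq//.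
  + by apply: hs; apply: bigsetU_measurable => i _; exact: measurable_cell.
  + by move=> i; exact: measurable_cell.
  + by move=> i j ij; exact: disj.
Qed.

Hypothesis dense : forall (f : L2) (eps : R), 0 < eps ->
  exists2 h, continuous_on_cells B h & N (f - h) < eps.

Lemma finite_rank_sum (I : Type) (r : seq I) (a : I -> R[i]) (F : I -> L2) :
  K (\sum_(i <- r) a i *: F i) = \sum_(i <- r) a i *: K (F i).
Proof.
rewrite KE; under eq_bigr do rewrite L2inner_Zsuml scaler_suml.
rewrite exchange_big/=; apply: eq_bigr => i _; rewrite KE scaler_sumr.
by apply: eq_bigr => k _; rewrite scalerA.
Qed.

Lemma regular_cell_lim_fin x : regular x -> (mu (cell_lim x) < +oo)%E.
Proof.
move=> [_ [k koo]]; apply: le_lt_trans koo; apply: le_measure; rewrite ?inE.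
- exact: measurable_cell_lim.
- exact: measurable_cell.
- by move=> y /(_ k I).
Qed.

Lemma stdproj_K_ind x y : regular x -> regular y ->
  P (cell_lim y) (K (ind mu (cell_lim x))) =
  ((fine (mu (cell_lim x)))%:C * pairing (urow y) (vrow x)) *: ind mu (cell_lim y).
Proof.
move=> /regular_cell_lim_fin xoo /regular_cell_lim_fin yoo.
have mx := measurable_cell_lim mB x; have my := measurable_cell_lim mB y.
rewrite KE stdproj_sum// /pairing mxE mulr_sumr scaler_suml; apply: eq_bigr => k _.
rewrite stdprojZ// stdproj_cell_lim// scalerA; congr (_ *: _); rewrite !mxE mulrCA mulrC; congr (_ * _).
have {1}-> : ind mu (cell_lim x) = P (cell_lim x) (ind mu (cell_lim x)).
  by rewrite stdproj_ind// setIid.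
by rewrite L2inner_stdproj// stdproj_cell_lim// L2innerZr L2inner_ind// mulrC.
Qed.

(* Otherwise the diagonal value at x_0, which is in the spectrum of the compression to one
   atom, would not be in that of the compression to all of them. *)
Lemma atomic_cycle r (x : 'I_r.+2 -> X) :
  (forall i, regular (x i)) -> (forall i j, cell_lim (x i) (x j) -> i = j) ->
  (forall i, mu (cell_lim (x i)) != 0%E) ->
  (forall i j, pairing (urow (x i)) (vrow (x j)) != 0 -> i != j -> j = ordS i) ->
  \prod_i pairing (urow (x i)) (vrow (x (ordS i))) = 0.
Proof.
move=> xreg xinj xpos chord.
pose A i := cell_lim (x i); have mA i : measurable (A i) by exact: measurable_cell_lim.
have Aoo i : (mu (A i) < +oo)%E by exact: regular_cell_lim_fin.
have A0 i : (0 < mu (A i))%E by rewrite lt0e xpos measure_ge0.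
pose m i := fine (mu (A i)); have m0 i : 0 < m i by rewrite fine_gt0// A0 Aoo.
have mC i : (m i)%:C != 0 :> R[i] by rewrite (inj_eq (@complexI R)) gt_eqF.
pose e i := ind mu (A i).
have dA i j : i != j -> A i `&` A j = set0.
  move=> ij; rewrite -subset0 => y [yi yj]; case/eqP: ij; apply: xinj.
  by rewrite -(cell_lim_eq_set yi) (cell_lim_eq_set yj); move=> k _.
have ee i j : L2inner (e i) (e j) = if i == j then (m i)%:C else 0.
  case: eqVneq => [->|ij]; first exact: L2inner_ind.
  have {1}-> : e i = P (A i) (e i) by rewrite /e stdproj_ind// setIid.
  have ind0 : ind mu set0 = 0.
    by rewrite -(set0I (A j)) -stdproj_ind// stdproj_null.
  by rewrite L2inner_stdproj// /e stdproj_ind// dA// ind0 L2inner0r.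
pose S := \big[setU/set0]_(i <- index_enum 'I_r.+2) A i.
have mS : measurable S by apply: bigsetU_measurable.
have PS f : P S f = \sum_i P (A i) f by rewrite stdproj_bigU ?index_enum_uniq.
have Pe i j : P (A i) (e j) = if i == j then e j else 0.
  have -> : P (A i) (e j) = (L2inner (e j) (e i) / (m i)%:C) *: e i by exact: (stdproj_atom mB dense _ (A0 i) (Aoo i)).
  rewrite ee eq_sym; case: eqVneq => [->|ij].
    by rewrite divff// scale1r.
  by rewrite mul0r scale0r.
have PSe j : P S (e j) = e j.
  rewrite PS (bigD1 j)//= Pe eqxx big1 ?addr0// => i ij; by rewrite Pe (negbTE ij).
pose T j i := (m i)%:C * pairing (urow (x j)) (vrow (x i)).
have PK i j : P (A j) (K (e i)) = T j i *: e j by exact: stdproj_K_ind.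
pose d0 := T ord0 ord0.
(* [T] is the matrix of the compression to [S] in the basis of indicators [e], so invertibility of
   [Q] will place [d0] outside its spectrum. *)
pose Q : 'M[R[i]]_r.+2 := \matrix_(j, i) (T j i) - d0%:M.
apply/eqP/negPn/negP => /prodf_neq0 edge.
(* Without chords, row [j] involves only [a j] and its successor. The row of 0 has cancelling
   diagonal terms and forces [a 1 = 0]; going around the cycle kills all further entries, and the
   last row kills [a 0]. Length at least 2 keeps [ordS j] different from [j]. *)
have Qinj (a : 'cV[R[i]]_r.+2) : Q *m a = 0 -> a = 0.
  move=> Qa.
  have row j : T j j * a j 0 + T j (ordS j) * a (ordS j) 0 = d0 * a j 0.
    have jS : ordS j != j.
      apply/eqP => /(congr1 val)/= ej; have := ltn_ord j; rewrite ltnS leq_eqVlt => /orP[/eqP jr|jr].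
        by move: ej; rewrite jr modnn.
      by move: ej; rewrite modn_small ?ltnS// => /eqP; rewrite gtn_eqF.
    have := congr1 (fun M : 'cV_ _ => M j 0) Qa; rewrite mulmxBl mul_scalar_mx !mxE => /eqP.
    rewrite subr_eq0 => /eqP <-; rewrite (bigD1 j)//= (bigD1 (ordS j))//= big1 ?addr0 ?mxE//.
    move=> i /andP[ij iS]; rewrite mxE /T.
    have [->|nz] := eqVneq (pairing (urow (x j)) (vrow (x i))) 0; first by rewrite mulr0 mul0r.
    by move: iS; rewrite (chord _ _ nz) ?eqxx// eq_sym.
  have T0 j : T j (ordS j) != 0 by rewrite mulf_neq0// edge.
  have az (j : nat) (jr : (j < r.+2)%N) : (0 < j)%N -> a (Ordinal jr) 0 = 0.
    elim: j jr => // j IH jr _.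
    have jr' : (j < r.+2)%N by exact: ltnW.
    have -> : Ordinal jr = ordS (Ordinal jr') by apply: val_inj; rewrite /= modn_small.
    apply: (mulfI (T0 (Ordinal jr'))); rewrite mulr0; have := row (Ordinal jr').
    case: (posnP j) => [j0|j0]; last by rewrite IH// !mulr0 add0r.
    have -> : Ordinal jr' = ord0 by apply: val_inj.
    by move=> /eqP; rewrite -subr_eq0 addrAC subrr add0r => /eqP.
  have a0 : a ord0 0 = 0.
    have -> : ord0 = ordS (@ord_max r.+1) by apply: val_inj; rewrite /= modnn.
    apply: (mulfI (T0 ord_max)); rewrite mulr0; have := row ord_max.
    have -> : a ord_max 0 = 0.
      by rewrite (_ : ord_max = Ordinal (ltnSn r.+1)) ?az//; apply: val_inj.
    by rewrite !mulr0 add0r.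
  apply/colP => -[[|j] jr]; rewrite mxE; last exact: az.
  by rewrite -[RHS]a0; congr (a _ _); apply: val_inj.
have Qu : Q \in unitmx.
  rewrite -unitmx_tr -row_free_unit; apply/row_freeP/row_freeP/inj_row_free => v vQ.
  have /Qinj : Q *m v^T = 0 by rewrite -[Q]trmxK -trmx_mul vQ trmx0.
  by move=> /(congr1 trmx); rewrite trmxK trmx0.
have d0spec : spectrum_on (range (P (A ord0))) (P (A ord0) \o K) d0.
  apply: contrapT => ns; have : e ord0 = 0.
    apply: (not_spectrum_inj ns); last by apply/range_stdprojP => //; exact: stdproj0.
      by apply/range_stdprojP => //; rewrite Pe eqxx.
    exact: PK.
  move=> e0; have := ee ord0 ord0; rewrite eqxx e0 L2inner0l => /eqP.
  by rewrite eq_sym (negbTE (mC _)).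
have := @Kincr (P (A ord0)) (P S) (ex_intro2 _ _ (A ord0) (mA _) erefl) (ex_intro2 _ _ S mS erefl) _ _ d0spec.
case.
  move=> f /(range_stdprojP _ (mA _)) fA; apply/range_stdprojP => //.
  apply: stdproj_sub fA => //; rewrite /S -bigcup_seq => y Ay; exists ord0 => //=.
  exact: mem_index_enum.
pose co f i := L2inner f (e i) / (m i)%:C.
pose w j := \sum_i (invmx Q j i / (m i)%:C)^*%C *: e i.
have wE f j : L2inner f (w j) = \sum_i invmx Q j i * co f i.
  by rewrite L2inner_Zsumr; apply: eq_bigr => i _; rewrite /co mulrAC mulrA.
have coE f : P S f = f -> f = \sum_i co f i *: e i.
  by move=> {1}<-; rewrite PS; apply: eq_bigr => i _; exact: (stdproj_atom mB dense _ (A0 i) (Aoo i)).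
have co_sum (a : 'I_r.+2 -> R[i]) i : co (\sum_j a j *: e j) i = a i.
  rewrite /co L2inner_Zsuml (bigD1 i)//= ee eqxx big1 ?addr0 ?mulfK// => j ji.
  by rewrite ee (negbTE ji) mulr0.
have QE (a : 'I_r.+2 -> R[i]) : P S (K (\sum_i a i *: e i)) - d0 *: \sum_i a i *: e i =
    \sum_j (Q *m \col_i a i) j 0 *: e j.
  rewrite finite_rank_sum PS.
  have PAj j : P (A j) (\sum_i a i *: K (e i)) = (\sum_i T j i * a i) *: e j.
    rewrite stdproj_sum// scaler_suml; apply: eq_bigr => i _.
    by rewrite stdprojZ// PK scalerA mulrC.
  under eq_bigr do rewrite PAj.
  rewrite scaler_sumr -sumrB; apply: eq_bigr => j _; rewrite scalerA -scalerBl; congr (_ *: _).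
  rewrite mulmxBl mul_scalar_mx !mxE; congr (_ - _).
  by apply: eq_bigr => i _; rewrite !mxE.
(* The inverse of [Q] read on coordinates: [co f i] is the i-th coordinate of [f] and [w] expresses
   the rows of [invmx Q] as functionals. *)
exists (fun f => \sum_j L2inner f (w j) *: e j).
  split.
  - move=> f _; apply/range_stdprojP => //; rewrite stdproj_sum//.
    by apply: eq_bigr => j _; rewrite stdprojZ// PSe.
  - move=> c f h _ _; rewrite scaler_sumr -big_split/=; apply: eq_bigr => j _.
    by rewrite L2innerDl L2innerZl scalerDl scalerA.
  - apply: norm_boundedP; apply: norm_bounded_sum => j; exact: norm_bounded_rank_one.
move=> f /(range_stdprojP _ mS) /coE fE; rewrite [(_ \o _) _]/=; split.
  rewrite {1 2}fE QE [RHS]fE; apply: eq_bigr => j _; rewrite wE; congr (_ *: _).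
  under eq_bigr do rewrite co_sum.
  have := mulKmx Qu (\col_i co f i) => /colP/(_ j); rewrite mxE [RHS]mxE => <-.
  by apply: eq_bigr.
rewrite /= QE [RHS]fE; apply: eq_bigr => j _; congr (_ *: _).
have := mulKVmx Qu (\col_i co f i) => /colP/(_ j); rewrite [RHS]mxE => <-.
congr ((_ *m _) _ _); apply/colP => i; rewrite !mxE wE.
by apply: eq_bigr => k _; rewrite mxE.
Qed.

End cycles.

Lemma next_nth_ordS (T : eqType) (t : seq T) (x0 : T) r (i : 'I_r.+1) :
  uniq t -> size t = r.+1 -> next t (nth x0 t i) = nth x0 t (ordS i).
Proof.
move=> ut st; rewrite next_nth mem_nth ?st//.
have -> : index (nth x0 t i) t = i by rewrite index_uniq ?st.
case: t ut st => [//|y t] ut [st] /=.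
have := ltn_ord i; rewrite ltnS leq_eqVlt => /orP[/eqP ->|ir].
  by rewrite modnn nth_default ?st.
by rewrite modn_small ?ltnS//=; apply: set_nth_default; rewrite st.
Qed.

Lemma reaches_rev (T : Type) (e : rel T) x y :
  reaches e x y -> reaches (fun z => e^~ z) y x.
Proof.
move=> [p xp <-]; exists (rev (belast x p)); first by rewrite rev_path.
by case: p {xp} => [|z p] //=; rewrite rev_cons last_rcons.
Qed.

(** * Acyclicity of the kernel relation *)

Section acyclic.
Context d (X : measurableType d) (R : realType) (mu : {measure set X -> \bar R}).
Local Notation L2 := (L2 mu).
Local Notation N := (@L2norm _ _ _ mu).
Local Notation P := (stdproj mu).
Variables (n : nat) (b g : 'I_n.+1 -> L2) (K : L2 -> L2).
Hypothesis KE : forall f, K f = \sum_i L2inner f (g i) *: b i.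
Hypothesis Kincr : increasing_spectrum K.
Variables (B : nat -> set X).
Hypothesis mB : forall k, measurable (B k).
Hypothesis cb : forall i, continuous_on_cells B (b i).
Hypothesis cg : forall i, continuous_on_cells B (g i).
Hypothesis dense : forall (f : L2) (eps : R), 0 < eps ->
  exists2 h, continuous_on_cells B h & N (f - h) < eps.

Local Notation u := (urow b).
Local Notation v := (vrow g).
Local Notation reg := (regular mu B).

(** The choice depends on the set [cell_lim B x] only, hence is the same for all points of one cell
    limit. *)
Definition cell_rep x : X := xget point (cell_lim B x).

Lemma cell_repP x : cell_lim B x (cell_rep x).
Proof. by apply: (@xgetPex _ point); exists x => k _. Qed.

Lemma eq_cell_rep x y : cell_lim B x y -> cell_rep y = cell_rep x.
Proof. by move=> /cell_lim_eq_set xy; rewrite /cell_rep xy. Qed.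

Lemma regular_rep x y : cell_lim B x y -> reg x -> reg y.
Proof.
move=> xy; have cE k : cell B k y = cell B k x by have := xy k I; rewrite /cell /= => ->.
by move=> [h1 [k h2]]; split=> [j|]; [|exists k]; rewrite cE.
Qed.

Lemma urow_cell_lim x y : cell_lim B x y -> u y = u x.
Proof. by move=> xy; apply/rowP => j; rewrite !mxE; apply: cell_lim_eq xy. Qed.

Lemma vrow_cell_lim x y : cell_lim B x y -> v y = v x.
Proof. by move=> xy; apply/rowP => j; rewrite !mxE; congr (_^*%C); apply: cell_lim_eq xy. Qed.

(** One regular point per cell limit, because acyclicity is an equality of vertices while
    unseparated points have the same [u] and [v]. *)
Definition vertex := {x : X | `[< reg x /\ cell_rep x = x >]}.

Lemma vertex_inj (i j : vertex) : cell_lim B (val i) (val j) -> i = j.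
Proof.
have /asboolP[_ ri] := valP i; have /asboolP[_ rj] := valP j.
by move=> /eq_cell_rep; rewrite ri rj => /esym/val_inj.
Qed.

(** The triangularization orients edges opposite to the order of factors in the kernel, hence the
    reversal. Two mutually reachable vertices lie on a closed walk; its chordless shortening has all
    kernel values nonzero, against the vanishing of the product for cycles with a nonatomic point
    and for cycles of atoms. *)
Lemma acyclic_vertices (i j : vertex) :
  reaches (fun i j : vertex => pairing (u (val j)) (v (val i)) != 0) i j ->
  reaches (fun i j : vertex => pairing (u (val j)) (v (val i)) != 0) j i -> i = j.
Proof.
pose e : rel vertex := fun k l => pairing (u (val k)) (v (val l)) != 0.
move=> ij' ji'; have [q jq lq] : reaches e j i := reaches_rev ij'.
have [p ip lp] : reaches e i j := reaches_rev ji'.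
apply/eqP/negPn/negP => ij.
have iin : i \in q by move: lq ij; case: (q) => [/= ->|a s /= <- _]; rewrite ?eqxx// mem_last.
have jin : j \in p by move: lp ij; case: (p) => [/= ->|a s /= <- _]; rewrite ?eqxx// mem_last.
have cs : cycle e (p ++ q).
  have last_i : last i (p ++ q) = i by rewrite last_cat lp.
  by rewrite (cycle_path i) last_i cat_path ip lp jq.
have iS : i \in p ++ q by rewrite mem_cat iin orbT.
have jS : j \in p ++ q by rewrite mem_cat jin.
have [t [ut st ct chord]] := chordless_cycle cs iS jS ij.
have [r sr] : exists r, size t = r.+2 by case: (size t) st => [|[|r]] // _; exists r.
pose y (k : 'I_r.+2) := nth i t k; pose x k := val (y k).
have yin k : y k \in t by rewrite mem_nth ?sr.
have xreg k : reg (x k) by have /asboolP[] := valP (y k).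
have yinj k l : y k = y l -> k = l.
  by move=> /eqP; rewrite nth_uniq ?sr// => /eqP/val_inj.
have xinj k l : cell_lim B (x k) (x l) -> k = l by move=> /vertex_inj/yinj.
have nx k : next t (y k) = y (ordS k) by exact: next_nth_ordS.
have xchord k l : pairing (u (x k)) (v (x l)) != 0 -> k != l -> l = ordS k.
  move=> kl nkl; have yinj' := yinj; apply: yinj'; rewrite -nx; apply: chord => //.
  by apply: contraNneq nkl => /yinj ->.
have edge k : pairing (u (x k)) (v (x (ordS k))) != 0.
  by rewrite /x -nx; exact: (next_cycle ct (yin k)).
have : \prod_k pairing (u (x k)) (v (x (ordS k))) != 0 by apply/prodf_neq0 => k _.
have [[k k0]|nk] := pselect (exists k, mu (cell_lim B (x k)) = 0%E).
  by rewrite (nonatomic_cycle KE Kincr mB cb cg xreg xinj k0 xchord) eqxx.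
rewrite (atomic_cycle KE Kincr mB cb cg dense xreg xinj _ xchord) ?eqxx//.
by move=> k; apply/eqP => k0; apply: nk; exists k.
Qed.

Lemma two_cycle x y : reg x -> reg y -> pairing (u x) (v y) != 0 -> pairing (u y) (v x) != 0 ->
  cell_lim B x y.
Proof.
move=> rx ry xy yx.
have ver z : reg z -> exists2 i : vertex, cell_lim B z (val i) & u (val i) = u z /\ v (val i) = v z.
  move=> rz; have zr := cell_repP z.
  have pr : `[< reg (cell_rep z) /\ cell_rep (cell_rep z) = cell_rep z >].
    by apply/asboolP; split; [exact: regular_rep zr rz|exact: eq_cell_rep].
  by exists (exist (fun x => `[< reg x /\ cell_rep x = x >]) (cell_rep z) pr) => //=; rewrite (urow_cell_lim zr) (vrow_cell_lim zr).
have [i xi [ui vi]] := ver _ rx; have [j yj [uj vj]] := ver _ ry.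
have ij : i = j.
  by apply: acyclic_vertices; apply: reaches1; rewrite ?ui ?vi ?uj ?vj.
have jy := cell_lim_sym yj; rewrite -ij in jy.
by rewrite -(cell_lim_eq_set xi).
Qed.

(** A loop is a cycle of length 1, so this is [nonatomic_cycle] with [r = 0]. *)
Lemma loop_atom x : reg x -> pairing (u x) (v x) != 0 -> mu (cell_lim B x) != 0%E.
Proof.
move=> rx xx; apply/eqP => x0.
have := @nonatomic_cycle _ _ _ _ _ _ _ _ KE Kincr _ mB cb cg 0 (fun=> x) ord0 (fun=> rx) _ x0.
rewrite big_ord1 => h; move: xx; rewrite h ?eqxx//.
  by move=> i j _; rewrite !ord1.
by move=> i j _; rewrite !ord1.
Qed.

End acyclic.

(** * Block labels *)

Section blocks.
Context d (X : measurableType d) (R : realType) (mu : {measure set X -> \bar R}).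
Local Notation L2 := (L2 mu).
Local Notation N := (@L2norm _ _ _ mu).
Local Notation P := (stdproj mu).

Lemma L2fun_sum (J : Type) (r : seq J) (a : J -> R[i]) (F : J -> L2) :
  {ae mu, forall x, L2fun (\sum_(i <- r) a i *: F i) x = \sum_(i <- r) a i * L2fun (F i) x}.
Proof.
elim: r => [|i r IH].
  rewrite big_nil; have /L2_eq0P := eqxx (0 : L2).
  by apply: filterS => x /(_ I) ->; rewrite big_nil.
rewrite big_cons.
have e := aeI (L2funDx (a i *: F i) (\sum_(j <- r) a j *: F j)) (L2funZx (a i) (F i)).
by apply: filterS2 e IH => x [-> ->] ->; rewrite big_cons.
Qed.

Variables (n : nat) (b g : 'I_n.+1 -> L2) (K : L2 -> L2).
Hypothesis KE : forall f, K f = \sum_i L2inner f (g i) *: b i.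
Hypothesis Kincr : increasing_spectrum K.
Variables (B : nat -> set X).
Hypothesis mB : forall k, measurable (B k).
Hypothesis cb : forall i, continuous_on_cells B (b i).
Hypothesis cg : forall i, continuous_on_cells B (g i).
Hypothesis dense : forall (f : L2) (eps : R), 0 < eps ->
  exists2 h, continuous_on_cells B h & N (f - h) < eps.
Variable S : set X.
Hypothesis mS : measurable S.
Hypothesis PS : forall f : L2, P S f = f.
Hypothesis Sfin : forall x, S x -> exists k, (mu (cell B k x) < +oo)%E.
Hypothesis dens : forall A, measurable A -> (mu A < +oo)%E -> forall eps : R, 0 < eps ->
      exists k, (mu ((A `&` B k) `|` (~` B k `\` A)) <= eps%:E)%E.

Local Notation u := (urow b).
Local Notation v := (vrow g).
Local Notation reg := (regular mu B).

(** The common change of basis [Q] replaces [b] by [invmx Q] applied to it and [g] by the adjoint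
    combination, conjugated since [vrow] holds conjugates; the operator stays the same.
    Representatives of linear combinations are determined almost everywhere only, so the pointwise
    relations hold off a null set. *)
Lemma triangular_representation : exists (Q : 'M[R[i]]_n.+1) (b' g' : 'I_n.+1 -> L2),
  [/\ Q \in unitmx, forall f, K f = \sum_i L2inner f (g' i) *: b' i &
    {ae mu, forall x, [/\ forall l, L2fun (b' l) x = (u x *m (invmx Q)^T) 0 l,
      forall k, (L2fun (g' k) x)^*%C = (v x *m Q) 0 k,
      forall k l : 'I_n.+1, (l < k)%N -> L2fun (g' k) x * L2fun (b' l) x = 0 &
      reg x \/ (forall l, L2fun (b' l) x = 0 /\ L2fun (g' l) x = 0)]}].
Proof.
have [Q Qu Qtri] := rank_one_triangularization
  (acyclic_vertices KE Kincr mB cb cg dense).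
pose b' l := \sum_j invmx Q l j *: b j.
pose g' k := \sum_i (Q i k)^*%C *: g i.
exists Q, b', g'; split=> //.
  move=> f; rewrite KE.
  transitivity (\sum_k \sum_j ((\sum_i Q i k * L2inner f (g i)) * invmx Q k j) *: b j).
    rewrite exchange_big/=; apply: eq_bigr => j _; rewrite -scaler_suml; congr (_ *: _).
    have := mulmxK Qu (\row_i L2inner f (g i)) => /rowP/(_ j); rewrite [RHS]mxE => <-.
    rewrite mxE; apply: eq_bigr => k _; rewrite mxE; congr (_ * _).
    by apply: eq_bigr => i _; rewrite mxE mulrC.
  apply: eq_bigr => k _; rewrite /g' /b' L2inner_Zsumr scaler_sumr; apply: eq_bigr => j _.
  by rewrite scalerA.
have e1 : {ae mu, forall x, forall l, L2fun (b' l) x = (u x *m (invmx Q)^T) 0 l}.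
  apply: filter_forall => l.
  apply: filterS (L2fun_sum (index_enum 'I_n.+1) (fun j => invmx Q l j) b) => x ->.
  by rewrite mxE; apply: eq_bigr => j _; rewrite !mxE mulrC.
have e2 : {ae mu, forall x, forall k, (L2fun (g' k) x)^*%C = (v x *m Q) 0 k}.
  apply: filter_forall => k.
  apply: filterS (L2fun_sum (index_enum 'I_n.+1) (fun i => (Q i k)^*%C) g) => x ->.
  rewrite mxE raddf_sum/=; apply: eq_bigr => j _; rewrite !mxE conjcM conjcK mulrC.
  by [].
have e3 : {ae mu, forall x, forall l, ~ S x -> L2fun (b' l) x = 0 /\ L2fun (g' l) x = 0}.
  apply: filter_forall => l.
  have h1 := (stdproj_fixP (b' l) mS).1 (PS _); have h2 := (stdproj_fixP (g' l) mS).1 (PS _).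
  by apply: filterS2 h1 h2 => x h1 h2 nS; rewrite h1// h2.
apply: filterS3 (aeI e1 e2) e3 (ae_cell_gt0 mu mB) => x [h1 h2] h3 h4.
have xr : reg x \/ (forall l, L2fun (b' l) x = 0 /\ L2fun (g' l) x = 0).
  by have [Sx|nS] := pselect (S x); [left; split=> //; exact: Sfin|right=> l; exact: h3].
split=> // k l lk; case: xr => [rx|/(_ k) [_ ->]]; last by rewrite mul0r.
have xr := cell_repP B x.
have pr : `[< reg (cell_rep B x) /\ cell_rep B (cell_rep B x) = cell_rep B x >].
  by apply/asboolP; split; [exact: regular_rep xr rx|exact: eq_cell_rep].
have /eqP := Qtri (exist (fun x => `[< reg x /\ cell_rep B x = x >]) (cell_rep B x) pr) k l lk.
rewrite /= (urow_cell_lim cb xr) (vrow_cell_lim cg xr) -h1 -h2 mulf_eq0 => /orP[/eqP|/eqP ->].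
  by move=> /(congr1 (@conjc R)); rewrite conjcK conjc0 => ->; rewrite mul0r.
by rewrite mulr0.
Qed.

Lemma ae_exists (Pr : X -> Prop) (E : set X) : {ae mu, forall x, Pr x} -> measurable E ->
  mu E != 0%E -> exists2 x, E x & Pr x.
Proof.
move=> [A [mA A0 hA]] mE /eqP E0; apply: contrapT => h; apply: E0.
apply: (subset_measure0 mE mA _ A0) => x Ex; apply: hA => /= px; apply: h.
by exists x.
Qed.

Lemma eq_stdproj_ae (E F : set X) f : measurable E -> measurable F ->
  {ae mu, forall x, E x <-> F x} -> P E f = P F f.
Proof.
move=> mE mF EF; apply: L2_ext; apply: filterS3 EF (stdprojE f mE) (stdprojE f mF) => x EF -> -> _.
have [/set_mem/EF/mem_set -> //|/negP xE] := boolP (x \in E).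
by rewrite memNset// => /EF/mem_set.
Qed.

Lemma stdproj_eq0 (E : set X) f : measurable E ->
  {ae mu, forall x, E x -> L2fun f x = 0} -> P E f = 0.
Proof.
move=> mE h; rewrite -(stdproj0 mu mE); apply: eq_stdproj => //.
have /L2_eq0P h0 := eqxx (0 : L2).
by apply: filterS2 h h0 => x h /(_ Logic.I) -> /h.
Qed.

Lemma has_dim_line (V : set L2) (w : L2) : w != 0 ->
  (forall f, V f <-> exists z : R[i], f = z *: w) -> has_dim V 1.
Proof.
move=> w0 Vw; exists (fun=> w); split.
  by move=> c; rewrite big_ord1 => /eqP; rewrite scaler_eq0 (negbTE w0) orbF => /eqP c0 i; rewrite ord1.
apply/seteqP; split => f.
  move=> /Vw[z ->]; exists 1%N, (fun=> z), (fun=> w); split; last by rewrite big_ord1.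
  by move=> i; exists ord0.
move=> [m [c [s [hs ->]]]]; apply/Vw; exists (\sum_i c i); rewrite scaler_suml.
by apply: eq_bigr => i _; have [_ _ <-] := hs i.
Qed.

(* With `a` the largest k with g'_k(x) != 0 (counted from 1, and 0 if there is none),
   the label is 2 a - 1 if b'_k(x) g'_k(x) != 0 for some k, and 2 a otherwise. *)
Lemma block_labels : exists lab : X -> nat,
  [/\ forall m, measurable [set x | lab x = m],
      forall x, (lab x <= 2 * n.+1)%N,
      forall p q, (q < p)%N -> block_eq0 K [set x | lab x = p] [set x | lab x = q] &
      forall p, ~ block_eq0 K [set x | lab x = p] [set x | lab x = p] ->
       [/\ has_dim (range (P [set x | lab x = p])) 1,
           exists A : set X, [/\ A `<=` [set x | lab x = p], is_atom mu A &
             range (P A) = range (P [set x | lab x = p])] &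
           exists z : R[i], [/\ z != 0, is_eigenvalue K z &
             forall f, range (P [set x | lab x = p]) f ->
               P [set x | lab x = p] (K f) = z *: f]]].
Proof.
have [Q [b' [g' [Qu KE' nice]]]] := triangular_representation.
pose a x := \max_(k | L2fun (g' k) x != 0) (k : nat).+1.
pose loop x k := (L2fun (b' k) x != 0) && (L2fun (g' k) x != 0).
pose lab x := if [exists k, loop x k] then (2 * a x).-1 else (2 * a x)%N.
pose F p := [set x | lab x = p].
have ag x k : L2fun (g' k) x != 0 -> (k < a x)%N 
  by move=> gk; exact: (@leq_bigmax_cond _ (fun k => L2fun (g' k) x != 0) (fun k : 'I_n.+1 => (k : nat).+1) k gk).
have an x : (a x <= n.+1)%N by apply/bigmax_leqP => k _; exact: ltn_ord.
have lab_ge x : ((2 * a x).-1 <= lab x)%N by rewrite /lab; case: ifP => // _; exact: leq_pred.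
have lab_le x : (lab x <= 2 * a x)%N by rewrite /lab; case: ifP => // _; exact: leq_pred.
(* The label depends only on which of the [b' k] and [g' k] vanish at [x], one of finitely many
   patterns. *)
have mF p : measurable (F p).
  pose s x := [ffun k => (L2fun (b' k) x != 0, L2fun (g' k) x != 0)].
  pose G (t : {ffun 'I_n.+1 -> bool * bool}) := let a := \max_(k | (t k).2) (k : nat).+1 in
    if [exists k, (t k).1 && (t k).2] then (2 * a).-1 else (2 * a)%N.
  have labE x : lab x = G (s x).
    rewrite /lab /G; have -> : a x = \max_(k | (s x k).2) (k : nat).+1.
      by apply: eq_bigl => k; rewrite ffunE.
    by congr (if _ then _ else _); apply: eq_existsb => k; rewrite ffunE.
  have mnz (f : L2) (c : bool) : measurable [set x | (L2fun f x != 0) = c].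
    have mz : measurable [set x | L2fun f x = 0].
      have -> : [set x | L2fun f x = 0] = (setT `&` (fun x => part true (L2fun f x)) @^-1` [set 0]) `&`
          (setT `&` (fun x => part false (L2fun f x)) @^-1` [set 0]).
        rewrite !setTI; apply/seteqP; split => x /=; first by move=> ->.
        by rewrite /part; case: (sqval _ _) => p' q' /= [-> ->].
      by apply: measurableI; apply: measurable_part => //; exact: measurable_set1.
    case: c; last first.
      by rewrite (_ : [set x | _] = [set x | L2fun f x = 0])//; apply/seteqP; split=> x /=;
        [move/negbFE/eqP|move=> ->; rewrite eqxx].
    rewrite (_ : [set x | _] = ~` [set x | L2fun f x = 0]); first exact: measurableC.
    by apply/seteqP; split=> x /= /eqP.
  have ms t : measurable [set x | s x = t].
    rewrite (_ : [set x | _] = \bigcap_(k in [set: 'I_n.+1])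
      ([set x | (L2fun (b' k) x != 0) = (t k).1] `&` [set x | (L2fun (g' k) x != 0) = (t k).2])).
      by apply: fin_bigcap_measurable => // k _; apply: measurableI; exact: mnz.
    apply/seteqP; split=> x /=.
      by move=> <- k _; rewrite !ffunE.
    by move=> h; apply/ffunP => k; rewrite ffunE; have [/= -> ->] := h k Logic.I; case: (t k).
  rewrite (_ : F p = \bigcup_(t in [set t | G t = p]) [set x | s x = t]).
    by apply: fin_bigcup_measurable => // t _; exact: ms.
  apply/seteqP; split=> x; rewrite /F /= labE; first by move=> sp; exists (s x).
  by move=> [t /= <- ->].
(* If [g' k] is nonzero at [x], then [a x >= k + 1] and the label is at least [2 k + 1]. *)
have gP p (k : 'I_n.+1) : (p <= 2 * (k : nat))%N -> P (F p) (g' k) = 0.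
  move=> pk; apply: stdproj_eq0 => //; apply: aeW => x; rewrite /F /= => xp.
  apply/eqP/negPn/negP => /ag ka; have := lab_ge x; rewrite xp.
  by apply/negP; rewrite -ltnNge (leq_ltn_trans pk)//; lia.
have tri x (k j : 'I_n.+1) : (forall k l : 'I_n.+1, (l < k)%N -> L2fun (g' k) x * L2fun (b' l) x = 0) ->
    L2fun (b' k) x != 0 -> L2fun (g' j) x != 0 -> (j <= k)%N.
  move=> h bk gj; rewrite leqNgt; apply/negP => /h/eqP.
  by rewrite mulf_eq0 (negbTE bk) (negbTE gj).
(* If [b' k] is nonzero at [x], triangularity gives [a x <= k + 1]. Either [g' k] is nonzero too,
   and the loop lowers the label to at most [2 k + 1], or [a x <= k] and the label is at most [2 k].
   Together with [gP], a term survives in block (p, q) only if [p <= 2 k + 1 <= q]. *)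
have bP p (k : 'I_n.+1) : (2 * (k : nat) + 1 < p)%N -> P (F p) (b' k) = 0.
  move=> pk; apply: stdproj_eq0 => //; apply: filterS nice => x [_ _ h _]; rewrite /F /= => xp.
  apply/eqP/negPn/negP => bk; move: pk; rewrite -xp ltnNge => /negP; apply.
  have ak : (a x <= k.+1)%N by apply/bigmax_leqP => j gj; rewrite ltnS; exact: tri gj.
  have [gk|gk] := eqVneq (L2fun (g' k) x) 0.
    have : (a x <= k)%N.
      apply/bigmax_leqP => j gj; have := tri x k j h bk gj; rewrite leq_eqVlt => /orP[/eqP/val_inj jk|//].
      by move: gj; rewrite jk gk eqxx.
    by have := lab_le x; lia.
  rewrite /lab (_ : [exists k, loop x k]); first by lia.
  by apply/existsP; exists k; rewrite /loop bk.
have PKP p q f : P (F p) (K (P (F q) f)) = \sum_k L2inner f (P (F q) (g' k)) *: P (F p) (b' k).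
  rewrite KE' stdproj_sum//; apply: eq_bigr => k _.
  by rewrite stdprojZ// L2inner_stdproj.
have blk0 p q : (forall k : 'I_n.+1, P (F q) (g' k) = 0 \/ P (F p) (b' k) = 0) -> block_eq0 K (F p) (F q).
  move=> h f /(range_stdprojP _ (mF q)) <-; rewrite PKP big1// => k _.
  by have [->|->] := h k; rewrite ?L2inner0r ?scale0r ?scaler0.
exists lab; split=> //.
- by move=> x; apply: leq_trans (lab_le x) _; rewrite leq_mul2l an.
- move=> p q qp; apply: blk0 => k; have [qk|qk] := leqP q (2 * (k : nat)); [left|right].
    exact: gP.
  by apply: bP; lia.
move=> p nb.
(* For [p = q] the two bounds meet only at odd [p = 2 k + 1], and only the k-th term contributes to
   this block. *)
have [k pk] : exists k : 'I_n.+1, p = (2 * k + 1)%N.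
  apply: contrapT => h; apply: nb; apply: blk0 => k.
  have [qk|qk] := leqP p (2 * (k : nat)); [by left; exact: gP|right].
  apply: bP; rewrite ltn_neqAle -[X in (X <= _)%N]/(2 * k + 1)%N addn1 qk andbT.
  by apply/eqP => e; apply: h; exists k; rewrite addn1.
set E := [set x | lab x = p] in nb *; have mE : measurable E by exact: mF.
have E0 : mu E != 0%E.
  by apply/eqP => E0; apply: nb => f _; exact: stdproj_null.
pose good x := [/\ forall l, L2fun (b' l) x = (u x *m (invmx Q)^T) 0 l,
      forall k, (L2fun (g' k) x)^*%C = (v x *m Q) 0 k,
      forall k l : 'I_n.+1, (l < k)%N -> L2fun (g' k) x * L2fun (b' l) x = 0 &
      reg x \/ (forall l, L2fun (b' l) x = 0 /\ L2fun (g' l) x = 0)].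
have Eloop x : good x -> E x -> [/\ loop x k, reg x, forall j : 'I_n.+1, (k < j)%N -> L2fun (g' j) x = 0 &
    forall j : 'I_n.+1, (j < k)%N -> L2fun (b' j) x = 0].
  move=> [_ _ h xr]; rewrite /E /= /lab; case: ifP => [/existsP[k' lk'] ax|_]; last by lia.
  have [bk' gk'] := andP lk'.
  have ak' : a x = k'.+1.
    apply/eqP; rewrite eqn_leq ag// andbT; apply/bigmax_leqP => j gj.
    by rewrite ltnS; exact: tri gj.
  have k'k : k' = k by apply: val_inj => /=; move: ax; rewrite ak' pk; lia.
  rewrite k'k in lk' bk' gk'; split=> //.
  - by case: xr => // /(_ k)[bk0]; rewrite bk0 eqxx in bk'.
  - by move=> j kj; apply/eqP/negPn/negP => gj; move: kj; rewrite ltnNge (tri x k j).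
  - by move=> j kj; apply/eqP/negPn/negP => bj; move: kj; rewrite ltnNge (tri x j k).
have pairE x y : good x -> good y ->
    pairing (u x) (v y) = \sum_j L2fun (b' j) x * (L2fun (g' j) y)^*%C.
  move=> [hb _ _ _] [_ hg _ _].
  have -> : pairing (u x) (v y) = pairing (u x *m (invmx Q)^T) (v y *m Q).
    rewrite /pairing trmx_mul mulmxA -(mulmxA (u x)) -trmx_mul mulmxV// trmx1 mulmx1.
    by [].
  by rewrite /pairing mxE; apply: eq_bigr => j _; rewrite hb hg; congr (_ * _); rewrite mxE.
have [x0 Ex0 gx0] := ae_exists nice mE E0.
have [lx0 rx0 _ _] := Eloop _ gx0 Ex0.
(* Between any two good points of [E] the kernel reduces to its k-th term, which is nonzero. Such
   points form two-cycles, so they cannot be separated by cells. *)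
have kap x y : good x -> good y -> E x -> E y -> pairing (u x) (v y) != 0.
  move=> gx gy Ex Ey; have [/andP[bx _] _ _ bx0] := Eloop _ gx Ex.
  have [/andP[_ gy'] _ gy0 _] := Eloop _ gy Ey.
  rewrite pairE// (bigD1 k)//= big1 ?addr0.
    by rewrite mulf_neq0//; apply: contraNneq gy' => /(congr1 (@conjc R)); rewrite conjcK conjc0 => ->.
  move=> j jk; have [jk'|jk'|/val_inj jk'] := ltngtP j k.
  - by rewrite bx0// mul0r.
  - by rewrite gy0// conjc0 mulr0.
  - by rewrite jk' eqxx in jk.
set A := cell_lim B x0; have mA : measurable A by exact: measurable_cell_lim.
have A0 : mu A != 0%E.
  by apply: (loop_atom KE Kincr mB cb cg rx0); exact: kap.
have Aoo : (mu A < +oo)%E by exact: regular_cell_lim_fin rx0.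
have Ap : (0 < mu A)%E by rewrite lt0e A0 measure_ge0.
(* The block is thus a single cell limit up to a null set; the converse inclusion holds since the
   label is determined by [u] and [v] at good points. *)
have EA : {ae mu, forall x, E x <-> A x}.
  apply: filterS nice => x gx; split=> [Ex|Ax].
    have [_ rx _ _] := Eloop _ gx Ex.
    by apply: (two_cycle KE Kincr mB cb cg dense rx0 rx); exact: kap.
  have [hb hg _ _] := gx; have [hb0 hg0 _ _] := gx0.
  have bE l : L2fun (b' l) x = L2fun (b' l) x0 by rewrite hb hb0 (urow_cell_lim cb Ax).
  have gE l : L2fun (g' l) x = L2fun (g' l) x0.
    by apply: (can_inj (@conjcK R)); rewrite hg hg0 (vrow_cell_lim cg Ax).
  have aE : a x = a x0 by apply: eq_bigl => j; rewrite gE.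
  rewrite /E /= -[RHS]Ex0 /lab aE; congr (if _ then _ else _).
  by apply: eq_existsb => j; rewrite /loop bE gE.
have PEA f : P E f = P A f by exact: eq_stdproj_ae.
have indE : P A (ind mu A) = ind mu A by rewrite stdproj_ind// setIid.
have ind0 : ind mu A != 0.
  apply/eqP => i0; have := L2inner_ind mA Aoo; rewrite i0 L2inner0l => /eqP.
  by rewrite eq_sym (inj_eq (@complexI R)) fine_eq0 ?ge0_fin_numE// (negbTE A0).
have rangeE f : range (P E) f <-> exists z : R[i], f = z *: ind mu A.
  split=> [/(range_stdprojP _ mE)|[z ->]].
    by rewrite PEA (stdproj_atom mB dense _ Ap Aoo) => <-; eexists.
  by apply/range_stdprojP => //; rewrite stdprojZ// PEA indE.
have mEA : measurable (A `&` E) by exact: measurableI.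
have PAE f : P (A `&` E) f = P E f by rewrite -stdprojI// PEA stdproj_id// PEA.
have KI : P E (K (ind mu A)) = ((fine (mu A))%:C * pairing (u x0) (v x0)) *: ind mu A.
  by rewrite PEA; exact: (stdproj_K_ind KE mB cb cg).
have z0 : (fine (mu A))%:C * pairing (u x0) (v x0) != 0.
  by rewrite mulf_neq0 ?kap// (inj_eq (@complexI R)) fine_eq0 ?ge0_fin_numE.
split.
- exact: has_dim_line ind0 rangeE.
(* [A] lies in [E] only almost everywhere, so the intersection is the atom inside the block. *)
- exists (A `&` E); split; first by move=> x [].
    have [_ _ atom] := cell_lim_is_atom mB dens Ap Aoo.
    split=> //.
      rewrite lt0e measure_ge0 andbT; apply/eqP => AE0; move: ind0; rewrite -indE -PEA -PAE.
      by rewrite stdproj_null// eqxx.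
    move=> G mG GAE; have [->|G0] := atom G mG (fun x Gx => (GAE x Gx).1); [by left|right].
    apply: (subset_measure0 _ (measurableD mA mG) _ G0); first exact: measurableD.
    by move=> x [[Ax _] nG].
  by rewrite (_ : P (A `&` E) = P E)//; apply/funext => f; exact: PAE.
exists ((fine (mu A))%:C * pairing (u x0) (v x0)); split=> //.
  apply: (compression_is_eigenvalue KE z0); apply: (spectrum_eigenvalue KE z0).
  apply: (@Kincr (P E) (P setT)).
  - by exists E.
  - by exists setT.
  - by move=> f _; apply/range_stdprojP => //; exact: stdprojT.
  apply: contrapT => ns; have : ind mu A = 0.
    apply: (not_spectrum_inj ns _ KI).
      by apply/rangeE; exists 1; rewrite scale1r.
    by apply/range_stdprojP => //; exact: stdproj0.
  by apply/eqP.
move=> f /rangeE[z ->]; have -> : K (z *: ind mu A) = z *: K (ind mu A).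
  rewrite !KE scaler_sumr; apply: eq_bigr => i _; by rewrite L2innerZl scalerA.
by rewrite stdprojZ// KI !scalerA mulrC.
Qed.

End blocks.

(** * Multiplication operators and the weak closure *)

Section commutant.
Context d (X : measurableType d) (R : realType) (mu : {measure set X -> \bar R}).
Local Notation L2 := (L2 mu).
Local Notation N := (@L2norm _ _ _ mu).
Local Notation P := (stdproj mu).

Variable D : nat -> set X.
Hypotheses (mD : forall i, measurable (D i)) (Dfin : forall i, (mu (D i) < +oo)%E).
Hypothesis tD : trivIset setT D.
Hypothesis PD : forall f, P (\bigcup_i D i) f = f.

(** The symbol is glued from the functions [A (ind mu (D i))], each read on its own [D i]. It is
    essentially bounded because on a set where it exceeded the operator bound, the indicator would
    be stretched too much. The formula for [A f] is checked where [f] is bounded, since there [f] is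
    a bounded multiple of an indicator and [A] commutes with that multiplication. *)
Lemma commutant_multiplication (A : L2 -> L2) : bounded_operator A ->
  (forall psi f, Lp mu +oo psi -> A (mulop mu psi f) = mulop mu psi (A f)) ->
  exists2 phi, Lp mu +oo phi & A = mulop mu phi.
Proof.
move=> [_ _ [M AM]] Acom.
have {}AM f : N (A f) <= M * N f by have := AM f Logic.I; rewrite !normL2E -rmorphM lecR.
pose a i := L2fun (A (ind mu (D i))).
have [phi phiD phi0] : exists2 phi : X -> R[i], forall i x, D i x -> phi x = a i x &
    forall x, (forall i, ~ D i x) -> phi x = 0.
  pose phi x := if pselect (exists i, D i x) is left e then a (sval (cid e)) x else 0.
  exists phi => [i x Dx|x nD]; rewrite /phi; case: pselect => //.
  - move=> e; case: cid => j /= Djx; congr (a _ x).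
    apply: contrapT => /eqP ji; have : (D j `&` D i) x by [].
    by move/trivIsetP : tD => /(_ j i Logic.I Logic.I ji) ->.
  - by case; exists i.
  - by move=> e; have [i Di] := e; case: (nD i Di).
pose D' i := if i is j.+1 then D j else ~` \bigcup_i D i.
have mUD : measurable (\bigcup_i D i) by exact: bigcup_measurable.
have UD' : setT = \bigcup_i D' i.
  rewrite predeqE => x; split=> // _; have [[i _ Dx]|nD] := pselect ((\bigcup_i D i) x).
    by exists i.+1.
  by exists 0%N.
have mD' i : measurable (D' i) by case: i => [|i]; [exact: measurableC|exact: mD].
have mphi : cmeasurable phi.
  split; rewrite UD'; apply/measurable_fun_bigcup => //.
  - case=> [|i].
      apply: (eq_measurable_fun (fun=> 0 : R)); last exact: measurable_cst.
      by move=> x /set_mem nD; rewrite phi0// => i Dx; apply: nD; exists i.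
    apply: (eq_measurable_fun (fun x => complex.Re (a i x))).
      by move=> x /set_mem Dx; rewrite (phiD i).
    apply: (@measurable_funS _ _ _ _ setT) => //; exact: (sqfun_cmeasurable _).1.
  - case=> [|i].
      apply: (eq_measurable_fun (fun=> 0 : R)); last exact: measurable_cst.
      by move=> x /set_mem nD; rewrite phi0// => i Dx; apply: nD; exists i.
    apply: (eq_measurable_fun (fun x => complex.Im (a i x))).
      by move=> x /set_mem Dx; rewrite (phiD i).
    apply: (@measurable_funS _ _ _ _ setT) => //; exact: (sqfun_cmeasurable _).2.
have mmod (h : X -> R[i]) (c : R) : cmeasurable h ->
    measurable [set x | c <= modc (h x)] /\ measurable [set x | modc (h x) <= c].
  move=> /measurable_modc mh; split.
    have -> : [set x | c <= modc (h x)] = setT `&` (fun x => modc (h x)) @^-1` `[c, +oo[.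
      by rewrite setTI; apply/seteqP; split=> x /=; rewrite in_itv/= andbT.
    by apply: mh => //; exact: measurable_itv.
  have -> : [set x | modc (h x) <= c] = setT `&` (fun x => modc (h x)) @^-1` `]-oo, c].
    by rewrite setTI; apply/seteqP; split=> x /=; rewrite in_itv.
  by apply: mh => //; exact: measurable_itv.
have PA E f : measurable E -> P E (A f) = A (P E f).
  by move=> mE; rewrite /stdproj Acom//; exact: Linfty_indic.
have M0 : 0 <= Num.max M 0 by rewrite le_max lexx orbT.
have phiM : {ae mu, forall x, modc (phi x) <= Num.max M 0}.
  have key i k : mu (D i `&` [set x | Num.max M 0 + k.+1%:R^-1 <= modc (phi x)]) = 0%E.
    pose c : R := Num.max M 0 + k.+1%:R^-1.
    pose E := D i `&` [set x | c <= modc (phi x)]; rewrite -/E.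
    have c0 : Num.max M 0 < c by rewrite ltrDl invr_gt0.
    have mE : measurable E by apply: measurableI => //; exact: (mmod phi c mphi).1.
    have Eoo : (mu E < +oo)%E by apply: le_lt_trans (Dfin i); apply: le_measure; rewrite ?inE// => x [].
    have := @chebyshev_L2 _ _ _ _ E (A (ind mu E)) c mE (le_lt_trans M0 c0).
    have -> : A (ind mu E) = P E (A (ind mu (D i))).
      rewrite PA// stdproj_ind//; congr (A (ind mu _)).
      by apply/seteqP; split=> x; [move=> []|case].
    move=> cheb; have {cheb} : ((c ^+ 2)%:E * mu E <= (N (P E (A (ind mu (D i)))) ^+ 2)%:E)%E.
      apply: cheb; apply: filterS (stdprojE (A (ind mu (D i))) mE) => x Px Ex.
      by rewrite Px mem_set// -[L2fun _ _]/(a i x) -(phiD i x Ex.1); exact: Ex.2.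
    have -> : P E (A (ind mu (D i))) = A (ind mu E).
      rewrite PA// stdproj_ind//; congr (A (ind mu _)).
      by apply/seteqP; split=> x; [case|move=> []].
    rewrite -(fineK (_ : mu E \is a fin_num)) ?ge0_fin_numE// => cheb.
    have {}cheb : c ^+ 2 * fine (mu E) <= (Num.max M 0) ^+ 2 * fine (mu E).
      rewrite -lee_fin EFinM; apply: (le_trans cheb); rewrite lee_fin.
      have -> : fine (mu E) = N (ind mu E) ^+ 2 by rewrite -(sqr_L2norm_ind mE Eoo).
      rewrite -exprMn lerXn2r ?nnegrE ?mulr_ge0 ?L2norm_ge0//.
      by apply: (le_trans (AM _)); rewrite ler_wpM2r ?L2norm_ge0// le_max lexx.
    congr EFin; apply/eqP; rewrite eq_le fine_ge0 ?measure_ge0// andbT leNgt.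
    apply/negP => muE; move: cheb; rewrite ler_pM2r// leNgt => /negP; apply.
    by rewrite ltrXn2r// ltW// (le_lt_trans M0 c0).
  have : {ae mu, forall x, forall i k, ~ (D i `&` [set x | Num.max M 0 + k.+1%:R^-1 <= modc (phi x)]) x}.
    apply: ae_foralln => i; apply: ae_foralln => k.
    exists (D i `&` [set x | Num.max M 0 + k.+1%:R^-1 <= modc (phi x)]); split=> //.
      by apply: measurableI => //; exact: (mmod phi _ mphi).1.
    by move=> x /= /contrapT.
  apply: filterS => x nx; have [[i Dx]|nD] := pselect (exists i, D i x); last first.
    by rewrite phi0 ?modc_real ?normr0// => i Dx; apply: nD; exists i.
  rewrite leNgt; apply/negP => lt.
  have [k hk] : exists k, k.+1%:R^-1 < modc (phi x) - Num.max M 0.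
    by have [k hk] := ltr_add_invr lt; exists k; rewrite ltrBrDl.
  by apply: (nx i k); split=> //=; rewrite -lerBrDl ltW.
have Lphi : Lp mu +oo phi by apply/LinftyP; split=> //; exists (Num.max M 0).
exists phi => //; apply/funext => f; apply: L2_ext.
pose T i m := D i `&` [set x | modc (L2fun f x) <= m%:R].
have mT i m : measurable (T i m).
  by apply: measurableI => //; exact: (mmod _ _ (sqfun_cmeasurable _)).2.
have ATm i m : {ae mu, forall x, T i m x -> L2fun (A f) x = phi x * L2fun f x}.
  pose psi x := (\1_(T i m) x)%:C * L2fun f x.
  have Lpsi : Lp mu +oo psi.
    apply/LinftyP; split.
      by apply: cmeasurableM; [exact: (Linfty_indic mu (mT i m)).1|exact: sqfun_cmeasurable].
    exists m%:R; apply: aeW => x; rewrite /psi indicE.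
    have [/set_mem[_ le]|_] := boolP (x \in T i m); first by rewrite mul1r.
    by rewrite mul0r modc_real normr0.
  have e : P (T i m) (A f) = mulop mu psi (A (ind mu (D i))).
    rewrite PA// -Acom//; congr (A _); apply: L2_ext.
    apply: filterS3 (stdprojE f (mT i m)) (mulopx (ind mu (D i)) Lpsi) (indE (mD i) (Dfin i)).
    move=> x -> -> -> _; rewrite /psi !indicE.
    have [/set_mem[Dx _]|_] := boolP (x \in T i m); last by rewrite !mul0r.
    by rewrite mem_set// mul1r mulr1.
  have := aeI (stdprojE (A f) (mT i m)) (mulopx (A (ind mu (D i))) Lpsi).
  apply: filterS => x [+ +] Tx; rewrite e mem_set// => <- ->.
  by rewrite /psi indicE mem_set// mul1r mulrC; congr (_ * _); rewrite (phiD i)//; case: Tx.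
have Af0 := stdprojE (A f) mUD; rewrite PD in Af0.
have {}ATm : {ae mu, forall x, forall i m, T i m x -> L2fun (A f) x = phi x * L2fun f x}.
  by apply: ae_foralln => i; apply: ae_foralln => m.
apply: filterS3 ATm Af0 (mulopx f Lphi) => x h h0 -> _.
have [[i _ Dx]|nD] := pselect ((\bigcup_i D i) x); last first.
  rewrite h0 memNset//= phi0 ?mul0r// => i Dx; apply: nD; by exists i.
apply: (h i (Num.bound (modc (L2fun f x)))); split=> //=.
by apply/ltW; have := archi_boundP (modc_ge0 (L2fun f x)).
Qed.

End commutant.

(** Double annihilator in finite dimension for an arbitrary family: a finite subfamily of maximal
    rank already spans, and the columns of its cokernel matrix are the annihilators to test. *)
Lemma row_span_dual (F : fieldType) m (T : Type) (r : T -> 'rV[F]_m) (w : 'rV[F]_m) :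
  (forall a : 'cV[F]_m, (forall t, r t *m a = 0) -> w *m a = 0) ->
  exists k (t : 'I_k -> T) (c : 'I_k -> F), w = \sum_(i < k) c i *: r (t i).
Proof.
move=> dual.
pose Q k := `[< exists j (t : 'I_j -> T), \rank (\matrix_i r (t i)) = k >].
have Q0 : exists k, Q k.
  exists 0%N; apply/asboolP; exists 0%N, (fun i : 'I_0 => let: Ordinal _ h := i in match notF h with end).
  by apply/eqP; rewrite -leqn0 rank_leq_row.
have Qm k : Q k -> (k <= m)%N by move=> /asboolP[j [t <-]]; exact: rank_leq_col.
case: (ex_maxnP Q0 Qm) => _ /asboolP[k [t <-]] max.
set M := \matrix_i r (t i) in max.
have rM s : (r s <= M)%MS.
  pose t' (i : 'I_(k + 1)) := match fintype.split i with inl j => t j | inr _ => s end.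
  have tE : \matrix_i r (t' i) = col_mx M (r s).
    apply/row_matrixP => i; rewrite rowK /t' -[in RHS](splitK i).
    by case: (fintype.split i) => j; rewrite /= ?rowKu ?rowKd ?rowK ?row_id.
  have : (\rank (col_mx M (r s)) <= \rank M)%N.
    by apply: max; apply/asboolP; exists (k + 1)%N, t'; rewrite tE.
  rewrite -addsmxE => rk; have := addsmxSr M (r s); move=> /submx_trans; apply.
  by rewrite -(geq_leqif (mxrank_leqif_sup (addsmxSl M (r s)))).
have wM : (w <= M)%MS.
  apply/submxP; suff /eqP : w *m cokermx M = 0.
    by rewrite -submxE => /submxP.
  apply/rowP => j; have : w *m col j (cokermx M) = 0.
    apply: dual => s; have /submxP[c ->] := rM s.
    by rewrite -mulmxA colE (mulmxA M) mulmx_coker mul0mx mulmx0.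
  rewrite colE mulmxA -colE => /colP/(_ 0).
  by rewrite !mxE => ->.
have /submxP[c ->] := wM; exists k, t, (fun i => c 0 i).
by rewrite mulmx_sum_row; apply: eq_bigr => i _; rewrite rowK.
Qed.

Section weak_closure.
Context d (X : measurableType d) (R : realType) (mu : {measure set X -> \bar R}).
Local Notation L2 := (L2 mu).
Local Notation P := (stdproj mu).
Local Notation coef := (@coefficients _ _ _ mu).

(** A weak operator neighbourhood restricts finitely many coefficients, so exact agreement on every
    finite list suffices. The filter indexed by such lists converges to [A]. *)
Lemma closure_lin_span (S : set (L2 -> L2)) (A : L2 -> L2) :
  (forall m (f g : 'I_m -> L2), exists2 C, lin_span S C &
     forall i, L2inner (C (f i)) (g i) = L2inner (A (f i)) (g i)) ->
  closure (lin_span S : set (initial_topology coef)) A.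
Proof.
move=> approx.
pose U (s : seq (L2 * L2)) : set (L2 -> L2) :=
  [set C | lin_span S C /\ forall p, p \in s -> coef C p = coef A p].
have UI s t : U (s ++ t) `<=` U s `&` U t.
  by move=> C [SC Cst]; split; split=> // p ps; apply: Cst; rewrite mem_cat ps ?orbT.
have GF : Filter (filter_from [set: seq (L2 * L2)] U).
  by apply: filter_from_filter; [exists [::]|move=> s t _ _; exists (s ++ t)].
have GP : ProperFilter (filter_from [set: seq (L2 * L2)] U).
  apply: filter_from_proper => s _.
  have [C SC Cs] := approx _ (fun i : 'I_(size s) => (nth (0, 0) s i).1) (fun i => (nth (0, 0) s i).2).
  exists C; split=> // p ps; have ip : (index p s < size s)%N by rewrite index_mem.
  by have := Cs (Ordinal ip); rewrite /= nth_index.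
rewrite closureEcvg; exists (filter_from [set: seq (L2 * L2)] U) => //; split; last first.
  by move=> W SW; exists [::] => // C [SC _]; exact: SW.
move=> W [_ [[V Vopen <-] VA sub]].
have : {ptws, coef @ filter_from [set: seq (L2 * L2)] U --> coef A}.
  apply/pointwise_cvgP => p W' /nbhs_singleton W'A.
  by exists [:: p] => // C [_ /(_ p)]; rewrite inE eqxx => e /=; rewrite e.
case/(_ V).
  exact: open_nbhs_nbhs.
by move=> s _ sV; exists s => // C UC; apply: sub; exact: sV.
Qed.

Lemma lin_span_commutes (S : set (L2 -> L2)) C psi f : S `<=` @standard_projection _ _ _ mu ->
  lin_span S C -> Lp mu +oo psi -> C (mulop mu psi f) = mulop mu psi (C f).
Proof.
move=> SP [n [c [s [Ss ->]]]] Lpsi; rewrite !fct_sumE.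
have mul0 : mulop mu psi 0 = 0.
  by have := mulopP 1 0 0 Lpsi; rewrite !scale1r addr0 => /eqP; rewrite -subr_eq subrr => /eqP <-.
elim/big_ind2 : _ => //.
- by move=> y x t z -> ->; have := mulopP 1 y t Lpsi; rewrite !scale1r => ->.
move=> i _; have [E mE sE] := SP _ (Ss i); rewrite -sE.
rewrite -[LHS]/(c i *: P E (mulop mu psi f)) -[RHS]/(mulop mu psi (c i *: P E f)).
by have := mulopP (c i) (P E f) 0 Lpsi; rewrite !addr0 mul0 addr0 => ->; rewrite mulopC//; exact: Linfty_indic.
Qed.

(** For fixed [f] and [g], commutation tested against [g] is the vanishing of a difference of two
    coefficients of the operator, a closed condition in this topology. *)
Lemma closure_commutes (S : set (L2 -> L2)) (A : L2 -> L2) psi f :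
  S `<=` @standard_projection _ _ _ mu ->
  closure (lin_span S : set (initial_topology coef)) A -> Lp mu +oo psi ->
  A (mulop mu psi f) = mulop mu psi (A f).
Proof.
move=> SP clA Lpsi; apply/eqP; rewrite -subr_eq0; apply/eqP.
set h := (X in X = 0).
suff E g : L2inner h g = 0.
  apply: L2norm_eq0E; have := E h; rewrite L2inner_self => /eqP.
  by rewrite (inj_eq (@complexI R)) sqrf_eq0 => /eqP.
pose psi' x := (psi x)^*%C.
pose Phi : initial_topology coef -> (R[i] : numFieldType) :=
  fun C => coef C (mulop mu psi f, g) - coef C (f, mulop mu psi' g).
have ccoef p : continuous (fun C : initial_topology coef => coef C p : (R[i] : numFieldType)).
  move=> C; apply: (@continuous_comp _ _ _ (coef : initial_topology coef -> _) (fun F => F p)).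
    exact: initial_continuous.
  exact: proj_continuous.
have cPhi : continuous Phi by move=> C; exact: (continuousB (ccoef _ C) (ccoef _ C)).
have clo0 : closed [set 0 : (R[i] : numFieldType)].
  exact/accessible_closed_set1/hausdorff_accessible/norm_hausdorff.
have /closure_id clo := (continuous_closedP Phi).1 cPhi _ clo0.
have : (Phi @^-1` [set 0]) A.
  rewrite clo; apply: closure_subset clA => C SC.
  rewrite /= /Phi /coefficients/= (lin_span_commutes f SP SC Lpsi).
  by rewrite L2inner_mulop// subrr.
by rewrite /h L2innerBl /= /Phi /coefficients /= -L2inner_mulop.
Qed.

End weak_closure.

(** * Functionals that vanish on a generating family *)

Section duality.
Context d (X : measurableType d) (R : realType) (mu : {measure set X -> \bar R}).
Local Notation L2 := (L2 mu).
Local Notation P := (stdproj mu).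

Lemma RintegralID (u : X -> R) A C : measurable A -> measurable C ->
  mu.-integrable setT (EFin \o u) ->
  \int[mu]_(x in A) u x = \int[mu]_(x in A `&` C) u x + \int[mu]_(x in A `\` C) u x.
Proof.
move=> mA mC ui; rewrite -Rintegral_setU ?setUIDK//.
- exact: measurableI.
- exact: measurableD.
- exact: integrableS ui.
- by apply/disj_set2P; rewrite setDE setIACA setICr setI0.
Qed.

Variables (B : nat -> set X) (D : nat -> set X).
Hypothesis mB : forall k, measurable (B k).
Hypothesis dens : forall A, measurable A -> (mu A < +oo)%E -> forall eps : R, 0 < eps ->
  exists k, (mu ((A `&` B k) `|` (~` B k `\` A)) <= eps%:E)%E.
Hypotheses (mD : forall i, measurable (D i)) (Dfin : forall i, (mu (D i) < +oo)%E).

(** The sets approximating [A] are complements of the [B k], which is where the vanishing of the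
    total integral enters. Absolute continuity of the integral then gives 0 over every set of finite
    measure, hence [u = 0] almost everywhere on each [D i]. *)
Lemma Rintegral_generating_eq0 (u : X -> R) : mu.-integrable setT (EFin \o u) ->
  \int[mu]_x u x = 0 -> (forall k, \int[mu]_(x in B k) u x = 0) ->
  {ae mu, forall x, (\bigcup_i D i) x -> u x = 0}.
Proof.
move=> ui uT uB.
have uA A : measurable A -> (mu A < +oo)%E -> \int[mu]_(x in A) u x = 0.
  move=> mA Aoo; apply/eqP; rewrite -normr_le0; apply/ler_addgt0Pr => e e0; rewrite add0r.
  have [r [r0 small]] := integral_normr_continuous ui (divr_gt0 e0 (ltr0n _ 2)).
  have [k] := dens mA Aoo (divr_gt0 r0 (ltr0n _ 2)).
  set S := (_ `|` _) => muS; set C := ~` B k.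
  have mC : measurable C by exact: measurableC.
  have mS : measurable S by apply: measurableU; [exact: measurableI|exact: measurableD].
  have uC : \int[mu]_(x in C) u x = 0.
    have := RintegralID measurableT (mB k) ui.
    by rewrite uT setTI uB add0r setTD.
  have sub W : measurable W -> W `<=` S -> `|\int[mu]_(x in W) u x| <= e / 2.
    move=> mW WS; apply: le_trans (le_normr_Rintegral _ (integrableS measurableT mW _ ui)) _ => //.
    apply/ltW/small => //; apply: (@le_lt_trans _ _ (mu S)).
      by apply: le_measure; rewrite ?inE.
    by apply: le_lt_trans muS _; rewrite lte_fin ltr_pdivrMr// ltr_pMr// ltr1n.
  rewrite -[X in `|X|]subr0 -uC (RintegralID mA mC ui) (RintegralID mC mA ui) (setIC C A).
  rewrite opprD addrACA subrr add0r (splitr e).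
  apply: (le_trans (ler_normB _ _)); apply: lerD; apply: sub.
  - exact: measurableD.
  - by move=> x [Ax /contrapT Bx]; left.
  - exact: measurableD.
  - by move=> x; right.
have uD i : ae_eq mu (D i) (EFin \o u) (cst 0%E).
  apply: integral_ae_eq => //; first exact: integrableS ui.
  move=> E ED mE; rewrite integral_cst// mul0e.
  have Eoo : (mu E < +oo)%E by apply: le_lt_trans (Dfin i); apply: le_measure; rewrite ?inE.
  have := uA E mE Eoo; rewrite /Rintegral => u0.
  rewrite -[LHS]fineK; first by rewrite [X in (X)%:E]u0.
  by apply: integrable_fin_num => //; exact: integrableS ui.
apply: filterS (ae_foralln uD) => x ux [i _ Dx].
by have [] := ux i Dx.
Qed.

Lemma cintegral_generating_eq0 (U : X -> R[i]) : cintegrable mu U ->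
  cintegral mu U = 0 -> (forall k, cintegral mu (fun x => (\1_(B k) x)%:C * U x) = 0) ->
  {ae mu, forall x, (\bigcup_i D i) x -> U x = 0}.
Proof.
move=> [_ [Ur Ui]] [Tr Ti] UB.
have restr (u : X -> R) (k : nat) : \int[mu]_(x in B k) u x = \int[mu]_x (\1_(B k) x * u x).
  rewrite Rintegral_mkcond; apply: eq_Rintegral => x _; rewrite /patch indicE.
  by case: ifP; rewrite ?mul1r ?mul0r.
have H1 : forall k, \int[mu]_(x in B k) complex.Re (U x) = 0.
  move=> k; have [Re _] := UB k; rewrite restr -[RHS]Re; apply: eq_Rintegral => x _.
  by rewrite ReM /= mul0r subr0.
have H2 : forall k, \int[mu]_(x in B k) complex.Im (U x) = 0.
  move=> k; have [_ Im] := UB k; rewrite restr -[RHS]Im; apply: eq_Rintegral => x _.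
  by rewrite ImM /= mul0r addr0.
apply: filterS2 (Rintegral_generating_eq0 Ur Tr H1) (Rintegral_generating_eq0 Ui Ti H2) => x h1 h2 Dx.
by rewrite (complexE (U x)) h1// h2.
Qed.

Hypothesis PD : forall f : L2, P (\bigcup_i D i) f = f.

(** On multiplication operators such a functional is integration of the symbol against one
    integrable function [U], and that function vanishes almost everywhere. *)
Lemma mulop_functional_eq0 m (a : 'I_m -> R[i]) (f g : 'I_m -> L2) phi : Lp mu +oo phi ->
  \sum_i a i * L2inner (f i) (g i) = 0 ->
  (forall k, \sum_i a i * L2inner (P (B k) (f i)) (g i) = 0) ->
  \sum_i a i * L2inner (mulop mu phi (f i)) (g i) = 0.
Proof.
move=> Lphi L0 LB.
pose U x := \sum_i a i * (L2fun (f i) x * (L2fun (g i) x)^*%C).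
have csum (r : seq 'I_m) (h : 'I_m -> X -> R[i]) : (forall i, cintegrable mu (h i)) ->
    cintegrable mu (fun x => \sum_(i <- r) a i * h i x) /\
    cintegral mu (fun x => \sum_(i <- r) a i * h i x) = \sum_(i <- r) a i * cintegral mu (h i).
  move=> hi; elim: r => [|i r [IH1 IH2]].
    rewrite big_nil (_ : (fun _ => _) = cst 0); last by apply/funext => x; rewrite big_nil.
    split; last by rewrite /cintegral /= /Rintegral !integral0.
    by split; [exact: cmeasurable_cst|split; exact: integrable0].
  rewrite big_cons (_ : (fun _ => _) = fun x => a i * h i x + \sum_(j <- r) a j * h j x).
    split; first exact: cintegrableD (cintegrableZ _ (hi i)) IH1.
    by rewrite cintegralD ?cintegralZ ?IH2//; exact: cintegrableZ.
  by apply/funext => x; rewrite big_cons.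
have mU : cintegrable mu U.
  by apply: (csum _ (fun i x => L2fun (f i) x * (L2fun (g i) x)^*%C) _).1 => i; exact: L2inner_cintegrable.
have LE psi : Lp mu +oo psi -> \sum_i a i * L2inner (mulop mu psi (f i)) (g i) =
    cintegral mu (fun x => psi x * U x).
  move=> Lpsi; pose h i x := L2fun (mulop mu psi (f i)) x * (L2fun (g i) x)^*%C.
  have [[mh _] <-] := csum (index_enum 'I_m) h (fun i => L2inner_cintegrable (mulop mu psi (f i)) (g i)).
  apply: eq_cintegral => //; first by apply: cmeasurableM; [case: Lpsi|case: mU].
  have : {ae mu, forall x, forall i, L2fun (mulop mu psi (f i)) x = psi x * L2fun (f i) x}.
    by apply: filter_forall => i; exact: mulopx.
  apply: filterS => x hx _; rewrite /U mulr_sumr; apply: eq_bigr => i _.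
  by rewrite /h hx -!mulrA mulrCA.
have U0 : {ae mu, forall x, (\bigcup_i D i) x -> U x = 0}.
  apply: cintegral_generating_eq0 => //.
    have := LE _ (Linfty_indic mu measurableT).
    under eq_bigr do rewrite -[mulop _ _ _]/(P setT _) stdprojT.
    rewrite L0 => e; rewrite [RHS]e.
    by congr cintegral; apply/funext => x; rewrite indicE in_setT mul1r.
  by move=> k; rewrite -(LE _ (Linfty_indic mu (mB k))) LB.
rewrite LE// -[RHS](_ : cintegral mu (cst 0) = 0); last by rewrite /cintegral /= /Rintegral !integral0.
apply: eq_cintegral; [by apply: cmeasurableM; [case: Lphi|case: mU]|exact: cmeasurable_cst|].
have mUD : measurable (\bigcup_i D i) by exact: bigcup_measurable.
have f0 : {ae mu, forall x, forall i, ~ (\bigcup_i D i) x -> L2fun (f i) x = 0}.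
  apply: filter_forall => i; have := stdprojE (f i) mUD; rewrite PD.
  by apply: filterS => x -> nD; rewrite memNset.
apply: filterS2 U0 f0 => x U0 f0 _.
have [/U0 ->|nD] := pselect ((\bigcup_i D i) x); first by rewrite mulr0.
by rewrite /U big1 ?mulr0// => i _; rewrite f0// mul0r mulr0.
Qed.

End duality.

(** * Maximal chains *)

(** The proof of totality is a parameter of the type, so that the order structure below can be
    attached to it. *)
Definition chain_elt (T : Type) (C : set (set T)) of total_on C subset := {V | C V}.

Section chain_order.
Variables (T : Type) (C : set (set T)) (totC : total_on C subset).
Local Notation E := (chain_elt totC).

HB.instance Definition _ := gen_eqMixin E.
HB.instance Definition _ := gen_choiceMixin E.

Definition chain_le : rel E := fun V W => `[< sval V `<=` sval W >].

Lemma chain_le_refl : reflexive chain_le.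
Proof. by move=> V; apply/asboolP. Qed.

Lemma chain_le_anti : antisymmetric chain_le.
Proof.
move=> [V CV] [W CW] /andP[/asboolP VW /asboolP WV].
by apply: eq_exist => /=; apply/seteqP.
Qed.

Lemma chain_le_trans : transitive chain_le.
Proof. by move=> V U W /asboolP UV /asboolP VW; apply/asboolP; exact: subset_trans VW. Qed.

HB.instance Definition _ := Order.Le_isPOrder.Build (Order.Disp tt tt) E
  chain_le_refl chain_le_anti chain_le_trans.

Lemma chain_le_total : total chain_le.
Proof. by move=> [V CV] [W CW]; apply/orP; have [h|h] := totC CV CW; [left|right]; apply/asboolP. Qed.

HB.instance Definition _ := Order.POrder_isTotal.Build (Order.Disp tt tt) E chain_le_total.

End chain_order.

Section triangularization.
Context d (X : measurableType d) (R : realType) (mu : {measure set X -> \bar R}).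
Local Notation L2 := (L2 mu).
Local Notation P := (stdproj mu).

Lemma maximal_chain_extension (C0 : set (set L2)) :
  C0 `<=` @standard_subspace _ _ _ mu -> total_on C0 subset ->
  exists2 C, maximal_standard_chain C & C0 `<=` C.
Proof.
move=> std0 tot0.
(* Zorn's lemma is applied to the part added to [C0]: the condition is then met by the union of the
   empty family, namely by the empty set. *)
pose Z (S : set (set L2)) := S `<=` @standard_subspace _ _ _ mu /\ total_on (S `|` C0) subset.
have [|S [[stdS totS] max]] := @Zorn_bigcup _ Z.
  move=> F FZ totF; split; first by move=> V [S FS SV]; exact: (FZ S FS).1.
  move=> V W [[S FS SV]|CV] [[S' FS' SW]|CW].
  - have [sub|sub] := totF _ _ FS FS'.
      by apply: (FZ _ FS').2; left => //; exact: sub.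
    by apply: (FZ _ FS).2; left => //; exact: sub.
  - by apply: (FZ _ FS).2; [left|right].
  - by apply: (FZ _ FS').2; [right|left].
  - exact: tot0.
exists (S `|` C0); last by move=> V; right.
split=> // [V [/stdS|/std0]//|C' stdC' totC' sub].
apply/seteqP; split=> // V CV; left; apply: contrapT => nSV; apply: (max C').
  by split=> [W SW|C'S]; [apply: sub; left|apply/nSV/C'S].
split=> //; rewrite (_ : _ `|` _ = C')//; apply/seteqP; split=> [W [//|C0W]|W]; last by left.
by apply: sub; right.
Qed.

Lemma stdproj_eq_range E F : measurable E -> measurable F ->
  range (P E) = range (P F) -> P E = P F.
Proof.
move=> mE mF EF; apply/funext => f.
have e : P F (P E f) = P E f by apply/range_stdprojP => //; rewrite -EF; exists f.
have e' : P E (P F f) = P F f by apply/range_stdprojP => //; rewrite EF; exists f.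
by rewrite -e -[in RHS]e' !stdprojI// setIC.
Qed.

(** * Invariance of the members of the chain *)

Section invariance.
Variables (K : L2 -> L2) (lab : X -> nat) (N : nat).
Hypothesis KD : forall f g, K (f + g) = K f + K g.
Hypothesis KZ : forall c f, K (c *: f) = c *: K f.
Hypothesis mlab : forall m, measurable [set x | lab x = m].
Hypothesis labN : forall x, (lab x < N)%N.
Hypothesis lower : forall p q, (q < p)%N -> block_eq0 K [set x | lab x = p] [set x | lab x = q].
Hypothesis diag : forall p, ~ block_eq0 K [set x | lab x = p] [set x | lab x = p] ->
  has_dim (range (P [set x | lab x = p])) 1.

Local Notation F m := [set x | (lab x < m)%N].
Local Notation G m := [set x | lab x = m].

Lemma label_ltS m : F m.+1 = F m `|` G m.
Proof.
apply/seteqP; split=> x /=; first by rewrite ltnS leq_eqVlt => /orP[/eqP|]; [right|left].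
by case=> [/ltnW|->]; rewrite ltnS.
Qed.

Lemma measurable_label_lt m : measurable (F m).
Proof.
elim: m => [|m IH]; last by rewrite label_ltS; exact: measurableU.
by rewrite (_ : F 0 = set0)//; apply/seteqP; split.
Qed.

Lemma stdproj_label_ltS m f : P (F m.+1) f = P (F m) f + P (G m) f.
Proof.
rewrite label_ltS stdprojU//; first exact: measurable_label_lt.
by apply/seteqP; split=> // x [/= + xm]; rewrite xm ltnn.
Qed.

Lemma stdproj_label_lt0 f : P (F 0) f = 0.
Proof.
apply: stdproj_null; first exact: measurable_label_lt.
by rewrite (_ : F 0 = set0) ?measure0//; apply/seteqP; split.
Qed.

Lemma triangular0 : K 0 = 0.
Proof. by have := KZ 0 0; rewrite !scale0r. Qed.

Lemma triangular_below m p f : P (F m) f = f -> (m <= p)%N -> P (G p) (K f) = 0.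
Proof.
elim: m f => [|m IH] f fE mp.
  by rewrite -fE stdproj_label_lt0 triangular0 stdproj0.
rewrite -fE stdproj_label_ltS KD stdprojD// IH; last 2 first.
- by rewrite stdproj_id//; exact: measurable_label_lt.
- exact: ltnW.
by rewrite add0r (lower mp)//; exists f.
Qed.

(** The range for [E] lies between consecutive label segments [F m] and [F m.+1]. For [f] in it,
    [K f] stays in the segment [F m.+1], and its part in [F m] is harmless. Its part in [G m] comes
    from the diagonal block: it is 0, or the block is a line, on which it is a multiple of the
    component of [f], itself in the range. *)
Lemma triangular_invariant E : measurable E ->
  (forall m, range (P (F m)) `<=` range (P E) \/ range (P E) `<=` range (P (F m))) ->
  forall f, range (P E) f -> range (P E) (K f).
Proof.
move=> mE cmp f rf; have fE : P E f = f by exact/range_stdprojP.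
pose c m := range (P (F m)) `<=` range (P E).
have [call|nc] := pselect (forall m, c m).
  apply: (call N); apply/range_stdprojP; first exact: measurable_label_lt.
  by rewrite (_ : F N = setT) ?stdprojT//; apply/seteqP; split=> // x _; exact: labN.
have {nc} [m cm ncm] : exists2 m, c m & ~ c m.+1.
  apply: contrapT => H; apply: nc; elim=> [|m cm].
    by move=> _ [g _ <-]; rewrite stdproj_label_lt0; exists 0 => //; exact: stdproj0.
  by apply: contrapT => ncm; apply: H; exists m.
have fm : P (F m.+1) f = f.
  have [//|sub] := cmp m.+1.
  by apply/range_stdprojP; [exact: measurable_label_lt|exact: sub].
have KF : P (F m.+1) (K f) = K f.
  apply/stdproj_fixP; first exact: measurable_label_lt.
  have : {ae mu, forall x, forall p, (m < p)%N -> lab x = p -> L2fun (K f) x = 0}.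
    apply: ae_foralln => p; have [mp|/negP pm] := boolP (m < p)%N; last exact: aeW.
    have := stdprojE (K f) (mlab p); rewrite (triangular_below fm mp).
    have /L2_eq0P := eqxx (0 : L2).
    by apply: filterS2 => x /(_ Logic.I) -> + _ xp; rewrite mem_set.
  by apply: filterS => x h /negP; rewrite -leqNgt => lt; exact: (h (lab x)).
have sum_in g h : range (P E) g -> range (P E) h -> range (P E) (g + h).
  by move=> /(range_stdprojP _ mE) ge /(range_stdprojP _ mE) he; apply/range_stdprojP => //;
    rewrite stdprojD// ge he.
rewrite -KF stdproj_label_ltS; apply: sum_in; first by apply: cm; exists (K f).
have Kdiag : P (G m) (K f) = P (G m) (K (P (G m) f)).
  rewrite -{1}fm stdproj_label_ltS KD stdprojD// (@triangular_below m m) ?add0r//.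
  by rewrite stdproj_id//; exact: measurable_label_lt.
have gE : P E (P (G m) f) = P (G m) f by rewrite -{2}fE !stdprojI// setIC.
rewrite Kdiag; have [/(_ (P (G m) f)) ->|ndiag] := pselect (block_eq0 K (G m) (G m)).
- by exists 0 => //; exact: stdproj0.
- by exists f.
have [->|g0] := eqVneq (P (G m) f) 0.
  by rewrite triangular0 stdproj0//; exists 0 => //; exact: stdproj0.
have [b [_ rb]] := diag ndiag.
have line h : range (P (G m)) h -> exists z, h = z *: b 0.
  rewrite rb => -[k [a [s [sb ->]]]]; exists (\sum_i a i); rewrite scaler_suml.
  by apply: eq_bigr => i _; have [j _ <-] := sb i; rewrite ord1.
have [z gz] := line (P (G m) f) (ex_intro2 _ _ f Logic.I erefl).
have [w ->] := line (P (G m) (K (P (G m) f))) (ex_intro2 _ _ _ Logic.I erefl).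
have z0 : z != 0 by apply: contraNneq g0 => z0; rewrite gz z0 scale0r.
have -> : w *: b 0 = (w / z) *: P (G m) f by rewrite gz scalerA divfK.
by apply/range_stdprojP => //; rewrite stdprojZ// gE.
Qed.

End invariance.
End triangularization.

(** * The chain of code segments and its weakly closed span *)

Section multiplicity_free.
Context d (X : measurableType d) (R : realType) (mu : {measure set X -> \bar R}).
Local Notation L2 := (L2 mu).
Local Notation P := (stdproj mu).

Variables (B D : nat -> set X) (lab : X -> nat) (N : nat).
Hypothesis mB : forall k, measurable (B k).
Hypothesis dens : forall A, measurable A -> (mu A < +oo)%E -> forall eps : R, 0 < eps ->
  exists k, (mu ((A `&` B k) `|` (~` B k `\` A)) <= eps%:E)%E.
Hypotheses (mD : forall i, measurable (D i)) (Dfin : forall i, (mu (D i) < +oo)%E).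
Hypothesis tD : trivIset setT D.
Hypothesis PD : forall f : L2, P (\bigcup_i D i) f = f.
Hypothesis mlab : forall m, measurable [set x | lab x = m].
Hypothesis labN : forall x, (lab x < N)%N.

Local Notation code := (code B lab).
Local Notation H k m := [set x | (code k x < m)%N].

Lemma measurable_code_lt k m : measurable (H k m).
Proof. exact: (measurable_label_lt (measurable_code mB mlab k)). Qed.

Lemma code_lt_bound k x : (code k x < 2 ^ k * N)%N.
Proof.
have [r rk] := code_shift B lab 0 k x; rewrite addn0 => ->.
rewrite (@leq_trans (2 ^ k * (lab x).+1))%N ?leq_mul2l ?labN ?orbT//.
by rewrite mulnS addnC ltn_add2r.
Qed.

(** Refining from level [k] to level [l] multiplies bounds by a power of 2, so every segment is also
    a segment of the finer level, where segments are ordered by their bounds. *)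
Lemma code_lt_nested k l m m' : H k m `<=` H l m' \/ H l m' `<=` H k m.
Proof.
wlog kl : k l m m' / (k <= l)%N.
  move=> wl; have [kl|/ltnW lk] := leqP k l; first exact: wl.
  by case: (wl l k m' m lk); [right|left].
have HE : H k m = H l (2 ^ (l - k) * m)%N.
  apply/seteqP; split=> x /=; have [r rk] := code_shift B lab k (l - k) x; rewrite subnK// => ->.
    move=> xm; rewrite (@leq_trans (2 ^ (l - k) * (code k x).+1))%N ?leq_mul2l ?xm ?orbT//.
    by rewrite mulnS addnC ltn_add2r.
  by move=> /(leq_ltn_trans (leq_addr _ _)); rewrite ltn_mul2l => /andP[].
rewrite HE; have [mm|/ltnW mm] := leqP (2 ^ (l - k) * m) m'.
  by left=> x /= /leq_trans; apply.
by right=> x /= /leq_trans; apply.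
Qed.

Definition code_chain : set (set L2) := [set range (P (H km.1 km.2)) | km in [set: nat * nat]].

Lemma code_chain_total : total_on code_chain subset.
Proof.
have sub k m l m' : H k m `<=` H l m' -> range (P (H k m)) `<=` range (P (H l m')).
  move=> kl f /(range_stdprojP _ (measurable_code_lt _ _)) fE.
  apply/range_stdprojP; first exact: measurable_code_lt.
  by apply: stdproj_sub kl fE; exact: measurable_code_lt.
move=> _ _ [[k m] _ <-] [[l m'] _ <-] /=.
by have [h|h] := code_lt_nested k l m m'; [left|right]; exact: sub.
Qed.

(** Differences of consecutive segments are the sets of constant code, and [B k] is the finite
    disjoint union of those with odd code at level [k.+1]. The functional therefore vanishes on all
    [B k]. *)
Lemma code_chain_functional m (a : 'I_m -> R[i]) (f g : 'I_m -> L2) phi : Lp mu +oo phi ->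
  (forall k j, \sum_i a i * L2inner (P (H k j) (f i)) (g i) = 0) ->
  \sum_i a i * L2inner (mulop mu phi (f i)) (g i) = 0.
Proof.
move=> Lphi H0; pose La E := \sum_i a i * L2inner (P E (f i)) (g i).
have LaU E F : measurable E -> measurable F -> E `&` F = set0 -> La (E `|` F) = La E + La F.
  move=> mE mF EF; rewrite /La -big_split; apply: eq_bigr => i _.
  by rewrite stdprojU// L2innerDl mulrDr.
have La0 : La set0 = 0 by rewrite (_ : set0 = H 0 0) ?[LHS]H0//; apply/seteqP; split.
have mc k j : measurable [set x | code k x = j] by exact: measurable_code.
have Lac k j : La [set x | code k x = j] = 0.
  have Hz l : La (H k l) = 0 by exact: H0.
  have := Hz j.+1; rewrite label_ltS LaU; last 3 first.
  - exact: measurable_code_lt.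
  - exact: mc.
  - by apply/seteqP; split=> // x [/= + xm]; rewrite xm ltnn.
  by rewrite Hz add0r.
have LaB k : La (B k) = 0.
  have LaH j : La (B k `&` H k.+1 j) = 0.
    elim: j => [|j IH]; first by rewrite (_ : _ `&` _ = set0)//; apply/seteqP; split=> // x [].
    rewrite label_ltS setIUr LaU; last 3 first.
    - by apply: measurableI => //; exact: measurable_code_lt.
    - exact: measurableI.
    - by apply/seteqP; split=> // x [[_ /= +] [_ xm]]; rewrite xm ltnn.
    rewrite IH add0r; have [oj|ej] := boolP (odd j).
      rewrite (_ : _ `&` _ = [set x | code k.+1 x = j]) ?Lac//.
      apply/seteqP; split=> x; [by case|move=> xj; split=> //].
      by apply/set_mem; rewrite -(odd_codeS B lab) xj.
    rewrite (_ : _ `&` _ = set0)//; apply/seteqP; split=> // x [/mem_set Bx xj].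
    by move: ej; rewrite -xj odd_codeS Bx.
  rewrite -(LaH (2 ^ k.+1 * N)%N); congr La; apply/seteqP; split=> [x Bx|x []//].
  by split=> //; exact: code_lt_bound.
apply: (mulop_functional_eq0 mB dens mD Dfin PD Lphi) => //.
have := H0 0%N N; rewrite (_ : H 0%N N = setT); last by apply/seteqP; split=> // x _; exact: labN.
by move=> e; rewrite -[RHS]e; apply: eq_bigr => i _; rewrite stdprojT.
Qed.

Lemma chain_multiplicity_free (J : Type) (Q : J -> L2 -> L2) :
  (forall j, standard_projection (Q j)) ->
  (forall k m, exists j, Q j = P (H k m)) -> multiplicity_free Q.
Proof.
move=> stdQ QH; have rangeQ : range Q `<=` @standard_projection _ _ _ mu by move=> _ [j _ <-].
apply/seteqP; split=> [A [bA clA]|_ [phi Lphi <-]].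
  have [phi Lphi ->] := commutant_multiplication mD Dfin tD PD bA
    (fun psi f Lpsi => closure_commutes f rangeQ clA Lpsi).
  by exists phi.
split.
  split=> //; first by move=> c f g _ _; exact: mulopP.
  have [M phiM] := Linfty_bounded Lphi; exists (Num.max M 0) => f _.
  rewrite !normL2E -rmorphM lecR; apply: L2norm_mulop => //; last by rewrite le_max lexx orbT.
  by apply: filterS phiM => x le; rewrite le_max le.
apply: closure_lin_span => m f g.
(* If no combination of the [Q j] matched the m coefficients of [mulop mu phi], some vector [a]
   would separate them: a functional vanishing on the chain but not on a multiplication operator. *)
have := @row_span_dual _ m _ (fun j => \row_i L2inner (Q j (f i)) (g i))
  (\row_i L2inner (mulop mu phi (f i)) (g i)).
case=> [a aQ|k [t [c e]]].
  apply/matrixP => i j; rewrite !ord1 !mxE.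
  under eq_bigr do rewrite mxE mulrC.
  apply: (code_chain_functional (a := fun i => a i 0) Lphi) => l n.
  have [s QE] := QH l n; have /matrixP/(_ 0 0) := aQ s; rewrite !mxE => es.
  by rewrite -[RHS]es; apply: eq_bigr => i' _; rewrite !mxE mulrC QE.
exists (\sum_(i < k) c i *: Q (t i)).
  by exists k, c, (fun i => Q (t i)); split=> // i; exists (t i).
move=> i; move/rowP : e => /(_ i); rewrite mxE summxE => ->.
rewrite fct_sumE L2inner_suml; apply: eq_bigr => l _.
by rewrite !mxE -[X in L2inner X _]/(c l *: Q (t l) (f i)) L2innerZl.
Qed.

Lemma standard_triangularization_exists (K : L2 -> L2) : bounded_operator K ->
  (forall p q, (q < p)%N -> block_eq0 K [set x | lab x = p] [set x | lab x = q]) ->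
  (forall p, ~ block_eq0 K [set x | lab x = p] [set x | lab x = p] ->
    has_dim (range (P [set x | lab x = p])) 1) ->
  exists (disp : Order.disp_t) (L : orderType disp) (Q : L -> L2 -> L2),
     standard_triangularization K Q /\ multiplicity_free Q.
Proof.
move=> [_ Klin _] lower diag.
have KD f g : K (f + g) = K f + K g by have := Klin 1 f g Logic.I Logic.I; rewrite !scale1r.
have K0 : K 0 = 0 by apply: (@addrI _ (K 0)); rewrite -KD !addr0.
have KZ c f : K (c *: f) = c *: K f by have := Klin c f 0 Logic.I Logic.I; rewrite K0 !addr0.
have std0 : code_chain `<=` @standard_subspace _ _ _ mu.
  by move=> _ [km _ <-]; exists (P (H km.1 km.2)) => //; exists (H km.1 km.2) => //; exact: measurable_code_lt.
have [C maxC C0C] := maximal_chain_extension std0 code_chain_total.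
have [stdC totC _] := maxC.
have rep (V : chain_elt totC) : exists q : L2 -> L2, standard_projection q /\ range q = sval V.
  by case: V => V CV; have [q sq qV] := stdC V CV; exists q.
have [Q QP] := choice rep.
(* The maximal chain indexes itself by inclusion. *)
exists (Order.Disp tt tt), (chain_elt totC), Q.
have rangeE : range (fun V => range (Q V)) = C.
  apply/seteqP; split=> [_ [V _ <-]|V CV]; first by rewrite (QP V).2; exact: svalP.
  by exists (exist _ V CV) => //; exact: (QP _).2.
split.
  split.
  - by move=> V; exact: (QP V).1.
  - by move=> V W /asboolP; rewrite (QP V).2 (QP W).2.
  - by rewrite rangeE.
  move=> V; have [[E mE QE] QV] := QP V; rewrite -QE.
  apply: (triangular_invariant KD KZ mlab labN lower diag mE) => m.
  have : C (range (P E)) by rewrite QE QV; exact: svalP.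
  (* At level 0 the code is the label, so the label segments belong to the chain and are comparable
     with each of its members. *)
  have : C (range (P [set x | (lab x < m)%N])) by apply: C0C; exists (0%N, m).
  exact: totC.
apply: chain_multiplicity_free => [V|k m]; first exact: (QP V).1.
have CH : C (range (P (H k m))) by apply: C0C; exists (k, m).
(* [Q] was chosen only with the prescribed range; a standard projection is determined by its
   range. *)
exists (exist _ _ CH); have [[E mE QE] QV] := QP (exist _ _ CH).
by rewrite -QE; apply: stdproj_eq_range => //; [exact: measurable_code_lt|rewrite QE].
Qed.

End multiplicity_free.

Lemma finite_measure_cover d (X : measurableType d) (R : realType)
    (mu : {measure set X -> \bar R}) (B : nat -> set X) (S : set X) :
  (forall k, measurable (B k)) ->
  (forall x, S x -> exists j, (B j x /\ (mu (B j) < +oo)%E) \/ (~ B j x /\ (mu (~` B j) < +oo)%E)) ->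
  exists D : nat -> set X, [/\ forall i, measurable (D i), forall i, (mu (D i) < +oo)%E,
    trivIset setT D & S `<=` \bigcup_i D i].
Proof.
move=> mB SB.
pose T i := let E := if odd i then ~` B i./2 else B i./2 in
  if (mu E < +oo)%E then E else set0.
have mT i : measurable (T i).
  by rewrite /T; case: ifP => // _; case: odd => //; exact: measurableC.
exists (seqDU T); split.
- exact: seqDU_measurable.
- move=> i; apply: (@le_lt_trans _ _ (mu (T i))).
    by apply: le_measure; rewrite ?inE//; [exact: seqDU_measurable|exact: subset_seqDU].
  by rewrite /T; case: ifP => // _; rewrite measure0.
- exact: trivIset_seqDU.
rewrite -seqDU_bigcup_eq => x /SB[j [[Bx Boo]|[nBx Boo]]].
- by exists j.*2 => //; rewrite /T odd_double doubleK/= Boo.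
- by exists j.*2.+1 => //; rewrite /T /= odd_double uphalf_double/= Boo.
Qed.

(** Members of a partition are nonempty, so labels that do not occur are dropped and the others
    renumbered in increasing order. *)
Lemma partition_reindex d (X : measurableType d) (lab : X -> nat) N : (forall x, (lab x < N)%N) ->
  exists m (s : 'I_m -> nat), [/\ (1 <= m <= N)%N,
    partition [set: 'I_m] (fun i => [set x | lab x = s i]) setT &
    forall i j : 'I_m, (j < i)%N -> (s j < s i)%N].
Proof.
move=> labN; pose r := [seq p <- iota 0 N | `[< exists x, lab x = p >]].
have lr x : lab x \in r.
  by rewrite mem_filter mem_iota /= add0n labN andbT; apply/asboolP; exists x.
have rsort : sorted ltn r by apply: sorted_filter; [exact: ltn_trans|exact: iota_ltn_sorted].
exists (size r), (fun i => nth 0%N r i); split.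
- apply/andP; split; first by have := lr point; case: (r).
  by rewrite size_filter (leq_trans (count_size _ _))// size_iota.
- split.
  + apply/seteqP; split=> // x _.
    have ir : (index (lab x) r < size r)%N by rewrite index_mem.
    by exists (Ordinal ir) => //=; rewrite nth_index.
  + move=> i j _ _ [x /= [xi xj]]; apply/val_inj/eqP.
    by rewrite -(nth_uniq 0%N _ _ (sorted_uniq ltn_trans ltnn rsort))//= -xi -xj.
  + move=> i _; have : nth 0%N r i \in r by rewrite mem_nth.
    by rewrite mem_filter => /andP[/asboolP[x xi] _]; exists x.
by move=> i j ji; apply: (sorted_ltn_nth ltn_trans 0%N rsort); rewrite ?inE.
Qed.

Theorem theorem10 (d : measure_display) (X : measurableType d) (R : realType)
    (mu : {measure set X -> \bar R}) (n : nat) (K : L2 mu -> L2 mu) :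
  separable_L2 mu ->
  bounded_operator K ->
  (1 <= n)%N ->
  has_dim (range K) n ->
  increasing_spectrum K ->
  (exists (disp : Order.disp_t) (L : orderType disp) (Q : L -> L2 mu -> L2 mu),
     standard_triangularization K Q /\ multiplicity_free Q) /\
  (exists (m : nat) (E : 'I_m -> set X),
     [/\ (1 <= m <= 2 * n + 1)%N,
         forall j, measurable (E j),
         partition [set: 'I_m] E [set: X],
         forall i j : 'I_m, (j < i)%N -> block_eq0 K (E i) (E j) &
         forall j : 'I_m, ~ block_eq0 K (E j) (E j) ->
           [/\ has_dim (range (stdproj mu (E j))) 1,
               exists A : set X, [/\ A `<=` E j, is_atom mu A &
                 range (stdproj mu A) =
                 range (stdproj mu (E j))] &
               exists z : R[i], [/\ z != 0, is_eigenvalue K z &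
                 forall f, range (stdproj mu (E j)) f ->
                   stdproj mu (E j) (K f) = z *: f]]]).
Proof.
move=> sep bK; case: n => // n _ dimK inc.
have [b [g KE]] := finite_rank_representation bK dimK.
pose e (i : 'I_(n.+1 + n.+1)) := match fintype.split i with inl j => b j | inr j => g j end.
have [B [h [[mB hcell he hdense] [dens [S [mS PS SB]]]]]] := generating_family e sep.
have hcont l : continuous_on_cells B (h l).
  move=> x eps eps0; have [k hk] := hcell l x eps eps0; exists k => y /cellP; exact: hk.
have cb i : continuous_on_cells B (b i).
  by have [l] := he (lshift n.+1 i); rewrite /e (unsplitK (inl i)) => <-.
have cg i : continuous_on_cells B (g i).
  by have [l] := he (rshift n.+1 i); rewrite /e (unsplitK (inr i)) => <-.
have dense (f : L2 mu) (eps : R) : 0 < eps -> exists2 h, continuous_on_cells B h & L2norm (f - h) < eps.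
  by move=> /(hdense f)[l hl]; exists (h l).
have Sfin x : S x -> exists k, (mu (cell B k x) < +oo)%E.
  move=> /SB[j xj]; exists j.+1; have cellj y : cell B j.+1 x y -> (y \in B j) = (x \in B j).
    by move=> /cellP; apply.
  have sub (E : set X) : measurable E -> (mu E < +oo)%E -> cell B j.+1 x `<=` E ->
      (mu (cell B j.+1 x) < +oo)%E.
    move=> mE Eoo xE; apply: le_lt_trans Eoo; apply: le_measure; rewrite ?inE//.
    exact: measurable_cell.
  case: xj => -[Bx Boo].
    by apply: sub Boo _ => // y /cellj; rewrite (mem_set Bx) => /set_mem.
  apply: sub Boo _; first exact: measurableC.
  by move=> y /cellj; rewrite (memNset Bx) => /negbT/negP nB /mem_set.
have [lab [mlab labN lower diag]] := block_labels KE inc mB cb cg dense mS PS Sfin dens.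
(* The rank is [n.+1] here; labels start at 0, which accounts for the additional 1. *)
have {}labN x : (lab x < 2 * n.+1 + 1)%N by rewrite addn1 ltnS.
have [D [mD Dfin tD SD]] := finite_measure_cover mB SB.
have PD (f : L2 mu) : stdproj mu (\bigcup_i D i) f = f.
  by apply: stdproj_sub (PS f) => //; exact: bigcup_measurable.
split.
  apply: (standard_triangularization_exists mB dens mD Dfin tD PD mlab labN bK lower).
  by move=> p /diag[].
have [m [s [mN part_s s_lt]]] := partition_reindex labN.
exists m, (fun i => [set x | lab x = s i]); split=> //.
- by move=> i j /s_lt; exact: lower.
- by move=> j /diag.
Qed.
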